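(* Let $g\in\mathcal{H}(\mathbb{D})$. (i) The following conditions are equivalent: (a) $T_g:H^\infty\to H^\infty$ is bounded; (b) $T_g:A\to H^\infty$ is bounded; (c) $\sup_{z\in\mathbb{D}}\|G^{H^2}_{g,z}\|_{\mathcal{K}}<\infty$. (ii) $T_g:\mathcal{K}_a\to H^\infty$ is bounded if and only if $g$ is constant.
   Context: $\mathbb{D}$ is the open unit disc, $\mathbb{T}$ its boundary, $\mathcal{H}(\mathbb{D})$ the space of analytic functions in $\mathbb{D}$, $H^\infty$ the bounded analytic functions with sup norm, $A$ the disc algebra (functions analytic in $\mathbb{D}$ and continuous on $\overline{\mathbb{D}}$, sup norm). $T_g(f)(z)=\int_0^z f(\zeta)g'(\zeta)\,d\zeta$. $\mathcal{K}$ is the space of Cauchy transforms $(K\mu)(z)=\int_{\mathbb{T}}\frac{d\mu(\xi)}{1-\overline\xi z}$, $z\in\mathbb{D}$, with $\mu$ a finite complex Borel measure on $\mathbb{T}$, normed by $\|f\|_{\mathcal{K}}=\inf\{\|\mu\|:f=K\mu\}$ where $\|\mu\|$ is the total variation. $\mathcal{K}_a\subset\mathcal{K}$ is the subspace of Cauchy transforms of absolutely continuous (with respect to Lebesgue measure on $\mathbb{T}$) measures, with the norm of $\mathcal{K}$. For $z\in\mathbb{D}$, $G^{H^2}_{g,z}$ is the analytic function defined by $\overline{G^{H^2}_{g,z}(w)}=\int_0^z\frac{g'(\zeta)}{1-\overline w\zeta}\,d\zeta$, $w\in\overline{\mathbb{D}}$. *)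

(* Defs.v *)
From HB Require Import structures.
From mathcomp Require Import all_boot all_order all_algebra.
From mathcomp Require Import all_classical all_reals all_analysis.
From mathcomp Require Import complex.

Set Implicit Arguments.
Unset Strict Implicit.
Unset Printing Implicit Defensive.

Import Order.TTheory GRing.Theory Num.Theory.
Import numFieldNormedType.Exports.

Local Open Scope classical_set_scope.
Local Open Scope ring_scope.
Local Open Scope complex_scope.

Local Notation normc := ComplexField.Normc.normc.

HB.instance Definition _ (R : realType) := NormedModule.copy R[i] R[i]^o.

Section Disc.
Context {R : realType}.
Implicit Types (f g h : R[i] -> R[i]) (z w : R[i]).

Definition disc : set R[i] := [set z | `|z| < 1].
Definition closed_disc : set R[i] := [set z | `|z| <= 1].

(* `derivable f z 1` over the field R[i] is complex differentiability at z. *)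
Definition analytic f := forall z, disc z -> derivable f z 1.

Definition sup_norm (S : set R[i]) f : \bar R :=
  ereal_sup [set (normc (f z))%:E | z in S].

(* Functions on the disc are total functions on R[i]; their values off the
   disc (off the closed disc for the disc algebra) are irrelevant. *)
Definition Hinfty : set (R[i] -> R[i]) :=
  [set f | analytic f /\ (sup_norm disc f < +oo)%E].

Definition disc_algebra : set (R[i] -> R[i]) :=
  [set f | analytic f /\ {within closed_disc, continuous f}].

Definition bounded_operator (T : (R[i] -> R[i]) -> R[i] -> R[i])
    (X : set (R[i] -> R[i])) (normX : (R[i] -> R[i]) -> \bar R)
    (Y : set (R[i] -> R[i])) (normY : (R[i] -> R[i]) -> \bar R) : Prop :=
  (forall f, X f -> Y (T f)) /\
  exists c : R, forall f, X f -> (normY (T f) <= c%:E * normX f)%E.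

(* The integral from 0 to z, taken along the segment t |-> t * z, 0 <= t <= 1. *)
Definition path_integral h z : R[i] :=
  z * ((\int[lebesgue_measure]_(t in `[0, 1]) complex.Re (h (t%:C * z))) +i*
       (\int[lebesgue_measure]_(t in `[0, 1]) complex.Im (h (t%:C * z)))).

Definition Tg g f z : R[i] := path_integral (fun u => f u * derive1 g u) z.

Definition GH2 g z w : R[i] :=
  (path_integral (fun u => derive1 g u / (1 - w^* * u)) z)^*.

End Disc.

Definition circle (R : realType) := set_type [set z : R[i] | `|z| = 1].

HB.instance Definition _ (R : realType) := Topological.on (circle R).

Section CirclePoint.
Context {R : realType}.

Lemma normc_cis (t : R) : `|cos t +i* sin t| = 1 :> R[i].
Proof. by rewrite normc_def /= cos2Dsin2 sqrtr1. Qed.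

Definition cis (t : R) : circle R :=
  SigSub (mem_set (normc_cis t : [set z : R[i] | `|z| = 1] _)).

HB.instance Definition _ := isPointed.Build (circle R) (cis 0).

End CirclePoint.

Notation borel_circle R := (g_sigma_algebraType (@open (circle R))).

Section CauchyTransforms.
Context {R : realType}.
Implicit Types (f : R[i] -> R[i]) (z : R[i]).

(* A finite complex Borel measure on the circle, given by its real and
   imaginary parts; charges take finite values on measurable sets. *)
Record complex_measure := ComplexMeasure {
  re_part : {charge set (borel_circle R) -> \bar R} ;
  im_part : {charge set (borel_circle R) -> \bar R} }.
Implicit Types mu : complex_measure.

Definition cm_value mu (A : set (borel_circle R)) : R[i] :=
  fine (re_part mu A) +i* fine (im_part mu A).

Definition total_variation mu : \bar R :=
  ereal_sup [set v | exists n (E : 'I_n -> set (borel_circle R)),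
    [/\ forall i, measurable (E i), trivIset setT E,
        \bigcup_i E i = setT &
        v = (\sum_(i < n) normc (cm_value mu (E i)))%:E]].

(* The integral against a signed measure is the difference of the integrals
   against its Jordan parts (independent of the chosen Hahn decomposition). *)
Definition charge_integral (nu : {charge set (borel_circle R) -> \bar R})
    (f : circle R -> R) : R :=
  let P := cid (Hahn_decomposition nu) in
  let N := cid (projT2 P) in
  \int[jordan_pos (projT2 N)]_x f x - \int[jordan_neg (projT2 N)]_x f x.

Definition cm_integral mu (f : circle R -> R[i]) : R[i] :=
  ((charge_integral (re_part mu) (fun x => complex.Re (f x))
    - charge_integral (im_part mu) (fun x => complex.Im (f x))) +i*
   (charge_integral (re_part mu) (fun x => complex.Im (f x))
    + charge_integral (im_part mu) (fun x => complex.Re (f x)))).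

Definition cauchy_transform mu z : R[i] :=
  cm_integral mu (fun x => (1 - (val x)^* * z)^-1).

Definition represents mu f :=
  forall z, disc z -> f z = cauchy_transform mu z.

Definition cauchy_norm f : \bar R :=
  ereal_inf [set total_variation mu | mu in [set mu | represents mu f]].

Definition arc_length (A : set (borel_circle R)) : \bar R :=
  lebesgue_measure (`[0, 2 * pi[%classic `&` cis @^-1` A).

Definition abs_continuous mu :=
  (re_part mu : set _ -> \bar R) `<< arc_length /\
  (im_part mu : set _ -> \bar R) `<< arc_length.

Definition Ka : set (R[i] -> R[i]) :=
  [set f | exists2 mu, abs_continuous mu & represents mu f].

End CauchyTransforms.

(* Main.v *)
Require Import Defs.
From HB Require Import structures.
From mathcomp Require Import all_boot all_order all_algebra.
From mathcomp Require Import all_classical all_reals all_analysis.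
From mathcomp Require Import measurable_realfun complex ring lra.

(** The moments [b_n = int_0^z g'(u) u^n du] carry everything: [T_g f (z) = sum a_n b_n]
    when [f = sum a_n u^n], and [conj b_n] are the Taylor coefficients of [G_{g,z}], so
    that [G_{g,z} = K mu] says that [mu] has the moments [conj b_n].

    (c) implies (a): integrating the dilated partial sums of [f] against [mu] bounds
    [T_g f (z)] by a multiple of [||mu|| ||f||].  (b) implies (c): (b) applied to polynomials
    bounds the functional [p |-> sum p_n b_n] by the sup norm on the circle.  A finite
    Hahn-Banach argument extends it to Laurent polynomials of degree at least [1 - N]; the
    Cesaro mean of the extended moments is the density of a measure whose total variation is
    bounded because the Fejer kernel is positive.  Its moments are [(1 - n/N) conj b_n], and
    since [b_n] decays geometrically the defect is a small analytic density for [N] large.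

    (ii): the Cauchy transforms of the Fejer kernels at the points of the circle have norm
    at most 1.  Testing on them at radius [r] and reading off a Fourier coefficient bounds
    [|c_j| sum_n (1 - n/N) r^(n+j+1) / (n+j+1)] uniformly in [r] and [N], where
    [g' = sum c_j u^j]; the harmonic series diverges, so every [c_j] vanishes. *)

Set Implicit Arguments.
Unset Strict Implicit.
Unset Printing Implicit Defensive.

Import Order.TTheory GRing.Theory Num.Theory.
Import numFieldNormedType.Exports.

Local Open Scope classical_set_scope.
Local Open Scope ring_scope.
Local Open Scope complex_scope.

(** The classical way from (b) to (c) extends the functional to all continuous functions and
    represents it by a measure. Here the extension stays in finitely many coefficients and the
    measure is written down as a density, so no compactness of measures enters. The price is an
    additive constant in the variation, harmless because (c) asks only for a bound uniform in z.
    Negative frequencies must be filled in because G fixes only the moments n >= 0, while the Fejer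
    kernel uses all frequencies from 1 - N to N - 1. How large N must be depends on z through |b_n|
    <= M |z|^n; the variation bound does not.

    Convergence is kept in the quantitative form [K * q ^ N] on smaller discs: exchanges of limit
    and integral become finite sums with an error, and what is below [K * q ^ N] for all N is zero.

    In (ii) the kernel centred at eta is tested at r eta, on the same ray: there conj eta^n
    eta^(n+j+1) collapses to eta^(j+1), so all n contribute to one Fourier coefficient with the same
    phase. *)

Local Notation normc := ComplexField.Normc.normc.
Local Notation normcM := ComplexField.Normc.normcM.
Local Notation normcV := ComplexField.Normc.normcV.
Local Notation normc0 := ComplexField.Normc.normc0.
Local Notation normc1 := ComplexField.Normc.normc1.

(** * Real-valued moduli and complex differentiability *)

Section ComplexBasics.
Context {R : realType}.
Implicit Types (x y : R) (z w : R[i]).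

Lemma norm_normc z : `|z| = (normc z)%:C.
Proof. by rewrite normc_def; case: z. Qed.

Lemma normc_ge0 z : 0 <= normc z.
Proof. by case: z => a b; exact: sqrtr_ge0. Qed.

Lemma normc_eq0 z : (normc z == 0) = (z == 0).
Proof.
apply/eqP/eqP => [/ComplexField.Normc.eq0_normc //|->].
exact: normc0.
Qed.

Lemma normc_gt0 z : (0 < normc z) = (z != 0).
Proof. by rewrite lt_neqAle normc_ge0 andbT eq_sym normc_eq0. Qed.

Lemma normc_real x : normc x%:C = `|x|.
Proof. by rewrite /= expr0n /= addr0 sqrtr_sqr. Qed.

Lemma normc_nat n : normc (n%:R : R[i]) = n%:R.
Proof. by rewrite -(rmorph_nat (real_complex R)) normc_real ger0_norm. Qed.

Lemma normc_i : normc ('i : R[i]) = 1.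
Proof. by rewrite /= expr0n expr1n add0r sqrtr1. Qed.

Lemma normcX z n : normc (z ^+ n) = normc z ^+ n.
Proof.
elim: n => [|n IH]; first by rewrite !expr0 normc1.
by rewrite !exprS normcM IH.
Qed.

Lemma normc_conj z : normc (conjc z) = normc z.
Proof. by case: z => a b /=; rewrite sqrrN. Qed.

Lemma normcB z w : normc (z - w) = normc (w - z).
Proof. by rewrite -normcN opprB. Qed.

Lemma ler_normcB z w : normc (z - w) <= normc z + normc w.
Proof. by rewrite -(normcN w); exact: le_normcD. Qed.

Lemma ler_normc_trans z w v : normc (z - v) <= normc (z - w) + normc (w - v).
Proof. by rewrite (_ : z - v = (z - w) + (w - v)) ?le_normcD //; ring. Qed.

Lemma lerB_normc z w : normc z - normc w <= normc (z - w).
Proof. by rewrite lerBlDr -{1}(subrK w z) le_normcD. Qed.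

Lemma ler_normc_sum (I : Type) (r : seq I) (P : pred I) (F : I -> R[i]) :
  normc (\sum_(i <- r | P i) F i) <= \sum_(i <- r | P i) normc (F i).
Proof.
elim/big_rec2: _ => [|i a b _ h]; first by rewrite normc0.
by rewrite (le_trans (le_normcD _ _)) // lerD2l.
Qed.

Lemma abs_Re_le z : `|complex.Re z| <= normc z.
Proof.
case: z => a b /=; rewrite -sqrtr_sqr ler_wsqrtr // lerDl; exact: sqr_ge0.
Qed.

Lemma abs_Im_le z : `|complex.Im z| <= normc z.
Proof.
case: z => a b /=; rewrite -sqrtr_sqr ler_wsqrtr // lerDr; exact: sqr_ge0.
Qed.

Lemma normc_le_ReIm z : normc z <= `|complex.Re z| + `|complex.Im z|.
Proof.
rewrite {1}(complexE z); apply: (le_trans (le_normcD _ _)).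
rewrite normcM !normc_real /= expr0n expr1n /= add0r sqrtr1.
by rewrite mul1r.
Qed.

Lemma discE z : disc z <-> normc z < 1.
Proof. by rewrite /disc /= norm_normc -ltcR. Qed.

Lemma closed_discE z : closed_disc z <-> normc z <= 1.
Proof. by rewrite /closed_disc /= norm_normc -lecR. Qed.

Lemma cReD z w : complex.Re (z + w) = complex.Re z + complex.Re w.
Proof. by case: z w => [a b] [c d]. Qed.

Lemma cImD z w : complex.Im (z + w) = complex.Im z + complex.Im w.
Proof. by case: z w => [a b] [c d]. Qed.

Lemma cReM z w : complex.Re (z * w) =
  complex.Re z * complex.Re w - complex.Im z * complex.Im w.
Proof. by case: z w => [a b] [c d]. Qed.

Lemma cImM z w : complex.Im (z * w) =
  complex.Re z * complex.Im w + complex.Im z * complex.Re w.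
Proof. by case: z w => [a b] [c d]. Qed.

Lemma cReB z w : complex.Re (z - w) = complex.Re z - complex.Re w.
Proof. by case: z w => [a b] [c d]. Qed.

Lemma cImB z w : complex.Im (z - w) = complex.Im z - complex.Im w.
Proof. by case: z w => [a b] [c d]. Qed.

Lemma cRe_sum (I : Type) (r : seq I) (P : pred I) (F : I -> R[i]) :
  complex.Re (\sum_(i <- r | P i) F i) = \sum_(i <- r | P i) complex.Re (F i).
Proof. by elim/big_rec2: _ => // i x y _ <-; rewrite cReD. Qed.

Lemma cIm_sum (I : Type) (r : seq I) (P : pred I) (F : I -> R[i]) :
  complex.Im (\sum_(i <- r | P i) F i) = \sum_(i <- r | P i) complex.Im (F i).
Proof. by elim/big_rec2: _ => // i x y _ <-; rewrite cImD. Qed.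

Lemma complex_eqP z w :
  complex.Re z = complex.Re w -> complex.Im z = complex.Im w -> z = w.
Proof. by case: z w => [a b] [c d] /= -> ->. Qed.

Lemma cconjM z w : conjc (z * w) = conjc z * conjc w.
Proof. exact: rmorphM. Qed.

Lemma cconjB z w : conjc (z - w) = conjc z - conjc w.
Proof. exact: rmorphB. Qed.

Lemma cconjX z n : conjc (z ^+ n) = conjc z ^+ n.
Proof. exact: rmorphXn. Qed.

Lemma cconj_sum (I : Type) (r : seq I) (P : pred I) (F : I -> R[i]) :
  conjc (\sum_(i <- r | P i) F i) = \sum_(i <- r | P i) conjc (F i).
Proof. exact: rmorph_sum. Qed.

(** Positive elements of [R[i]] are real, so the complex-valued tolerances of the norm on [R[i]]
    reduce to real ones. *)
Lemma cvgcP (T : Type) (F : set_system T) (FF : Filter F) (f : T -> R[i]) l :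
  f @ F --> l <-> forall e : R, 0 < e -> \forall t \near F, normc (l - f t) < e.
Proof.
split=> [/cvgrPdist_lt h e e0|h].
  have e0' : 0 < e%:C by rewrite -(ltcR 0 e) in e0.
  by apply: filterS (h _ e0') => t; rewrite norm_normc ltcR.
apply/cvgrPdist_lt => e; case: e => a b; rewrite ltcE /= => /andP[/eqP -> a0].
apply: filterS (h _ a0) => t; rewrite norm_normc.
by rewrite (ltcR _ a).
Qed.

Lemma nbhscP z (P : set R[i]) :
  (\forall w \near z, P w) <-> exists2 d : R, 0 < d &
    forall w, normc (w - z) < d -> P w.
Proof.
split.
  move=> /nbhs_ballP[[a b] /= ]; rewrite ltcE /= => /andP[/eqP -> a0] h.
  exists a => // w wz; apply: h; rewrite /ball /= norm_normc normcB.
  by rewrite (ltcR _ a).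
move=> [d d0 h]; apply/nbhs_ballP; exists d%:C => /=; first by rewrite (ltcR 0 d).
by move=> w; rewrite /ball /= norm_normc normcB ltcR => /h.
Qed.

Lemma cvgc_atP (f : R[i] -> R[i]) z : {for z, continuous f} <->
  forall e : R, 0 < e -> exists2 d : R, 0 < d &
    forall w, normc (w - z) < d -> normc (f w - f z) < e.
Proof.
split=> [h e e0|h].
  have /cvgcP /(_ e e0) /nbhscP [d d0 hd] := h.
  by exists d => // w /hd; rewrite normcB.
apply/(@cvgcP _ (nbhs z)) => e e0; apply/nbhscP; have [d d0 hd] := h e e0.
by exists d => // w /hd; rewrite normcB.
Qed.

Lemma cvgr_atP (f : R[i] -> R) z : {for z, continuous f} <->
  forall e : R, 0 < e -> exists2 d : R, 0 < d &
    forall w, normc (w - z) < d -> `|f w - f z| < e.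
Proof.
split=> [/(@cvgrPdist_lt _ _ _ (nbhs z)) h e e0|h].
  by have /nbhscP[d d0 hd] := h e e0; exists d => // w /hd; rewrite distrC.
apply/(@cvgrPdist_lt _ _ _ (nbhs z)) => e e0; apply/nbhscP.
by have [d d0 hd] := h e e0; exists d => // w /hd; rewrite distrC.
Qed.

Lemma continuous_Re : continuous (@complex.Re R : R[i] -> R).
Proof.
move=> z; apply/cvgr_atP => e e0; exists e => // w.
by apply: le_lt_trans; rewrite (le_trans _ (abs_Re_le _)) //; case: z w => [a b] [c d].
Qed.

Lemma continuous_Im : continuous (@complex.Im R : R[i] -> R).
Proof.
move=> z; apply/cvgr_atP => e e0; exists e => // w.
by apply: le_lt_trans; rewrite (le_trans _ (abs_Im_le _)) //; case: z w => [a b] [c d].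
Qed.

Lemma continuous_normc : continuous (@ComplexField.Normc.normc R : R[i] -> R).
Proof.
move=> z; apply/cvgr_atP => e e0; exists e => // w.
by apply: le_lt_trans; rewrite ler_norml lerB_normc andbT lerNl opprB normcB lerB_normc.
Qed.

Lemma cvgc_complex (T : Type) (F : set_system T) (FF : Filter F) (f g : T -> R) a b :
  f @ F --> a -> g @ F --> b -> (fun t => (f t +i* g t) : R[i]) @ F --> (a +i* b : R[i]).
Proof.
move=> /cvgrPdist_lt hf /cvgrPdist_lt hg; apply/cvgcP => e e0.
have e2 : 0 < e / 2 by rewrite divr_gt0.
near=> t; apply: (le_lt_trans (normc_le_ReIm _)) => /=.
rewrite (splitr e) ltrD //; near: t; [exact: hf|exact: hg].
Unshelve. all: by end_near.
Qed.

Lemma continuous_real_complex : continuous (fun x => x%:C : R[i]).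
Proof. by move=> x; apply: cvgc_complex; [exact: cvg_id|exact: cvg_cst]. Qed.

Lemma continuous_conj : continuous (fun z => conjc z : R[i]).
Proof.
move=> z; apply/cvgc_atP => e e0; exists e => // w.
by rewrite -cconjB normc_conj.
Qed.

(* The bounds are real here, whereas the norm of [R[i]] over itself is [R[i]]-valued. *)
Definition cder (f : R[i] -> R[i]) z (l : R[i]) :=
  forall e : R, 0 < e -> exists2 d : R, 0 < d &
    forall w, normc (w - z) < d ->
      normc (f w - f z - l * (w - z)) <= e * normc (w - z).

Lemma cder_cvg f z l : cder f z l <->
  (fun h : R[i] => h^-1 *: (f (h + z) - f z)) @ 0^' --> l.
Proof.
split=> [H|/cvgcP H].
  apply/cvgcP => e e0; have [|d d0 hd] := H (e / 2); first by rewrite divr_gt0.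
  apply/nbhscP; exists d => // h; rewrite subr0 => hd' h0.
  have := hd (h + z); rewrite addrK => /(_ hd') => hb.
  have hn : 0 < normc h by rewrite normc_gt0.
  rewrite normcB /= -(ltr_pM2r hn) -normcM.
  apply: (@le_lt_trans _ _ (e / 2 * normc h)); last first.
    by rewrite ltr_pM2r // ltr_pdivrMr // ltr_pMr // ltr1n.
  apply: le_trans hb; rewrite le_eqVlt; apply/orP; left; apply/eqP; congr normc.
  by rewrite mulrBl; congr (_ - _); rewrite mulrC /GRing.scale /= mulrA mulfV // mul1r.
move=> e e0; have /nbhscP [d d0 hd] := H e e0; exists d => // w wd.
have [->|wz] := eqVneq w z; first by rewrite !subrr mulr0 subrr normc0 mulr0.
have wz0 : w - z != 0 by rewrite subr_eq0.
have := hd (w - z); rewrite subr0 => /(_ wd wz0); rewrite subrK => hb.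
have hn : 0 < normc (w - z) by rewrite normc_gt0.
rewrite -ler_pdivrMr //; apply: le_trans (ltW hb).
rewrite -(normcV) -normcM normcB.
rewrite le_eqVlt; apply/orP; left; apply/eqP; congr normc.
by rewrite mulrBl mulfK //; congr (_ - _); exact: mulrC.
Qed.

Lemma derivable_quotE (f : R[i] -> R[i]) (z : R[i]) : derivable f z 1 <->
  cvg ((fun h : R[i] => h^-1 *: (f (h + z) - f z)) @ 0^').
Proof.
rewrite /derivable; set F := (X in cvg (X @ _) <-> _).
set G := (X in _ <-> cvg (X @ _)); suff -> : F = G by [].
by apply/funext => h; rewrite /F /G /= /shift [h *: 1]mulr1.
Qed.

Lemma cderP f z l : cder f z l -> derivable f z 1 /\ derive1 f z = l.
Proof.
move=> /cder_cvg h; split; last by exact: cvg_lim h.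
by apply/derivable_quotE/cvg_ex; exists l.
Qed.

Lemma derivable_cder f z : derivable f z 1 -> cder f z (derive1 f z).
Proof.
move=> /derivable_quotE/cvg_ex[l] h.
by have /cderP[_ ->] := (cder_cvg _ _ _).2 h; apply/cder_cvg.
Qed.

Lemma cder_continuous f z l : cder f z l -> {for z, continuous f}.
Proof.
move=> H; apply/cvgc_atP => e e0; have [d d0 hd] := H 1 ltr01.
have l0 : 0 < 1 + normc l by rewrite ltr_pwDl // normc_ge0.
exists (Num.min d (e / (1 + normc l))).
  by rewrite lt_min d0 divr_gt0.
move=> w; rewrite lt_min => /andP[wd we].
have hb := hd w wd; rewrite mul1r in hb.
rewrite -(subrK (l * (w - z)) (f w - f z)); apply: (le_lt_trans (le_normcD _ _)).
rewrite normcM.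
apply: le_lt_trans (lerD hb (lexx _)) _.
by rewrite -{1}[normc (w - z)]mul1r -mulrDl mulrC -ltr_pdivlMr.
Qed.

Lemma cder_local f g z l r : 0 < r -> (forall w, normc (w - z) < r -> f w = g w) ->
  cder f z l -> cder g z l.
Proof.
move=> r0 fg H e e0; have [d d0 hd] := H e e0.
exists (Num.min d r); first by rewrite lt_min d0.
move=> w; rewrite lt_min => /andP[wd wr].
by rewrite -!fg ?subrr ?normc0 //; exact: hd.
Qed.

Lemma cder_cst c z : cder (fun=> c) z 0.
Proof.
by move=> e e0; exists 1 => // w _; rewrite subrr mul0r subr0 normc0 mulr_ge0 ?normc_ge0 // ltW.
Qed.

Lemma cder_id z : cder id z 1.
Proof.
by move=> e e0; exists 1 => // w _; rewrite mul1r subrr normc0 mulr_ge0 ?normc_ge0 // ltW.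
Qed.

Lemma cderD f g z k l : cder f z k -> cder g z l -> cder (fun w => f w + g w) z (k + l).
Proof.
move=> Hf Hg e e0; have e2 : 0 < e / 2 by rewrite divr_gt0.
have [d d0 hd] := Hf _ e2; have [d' d'0 hd'] := Hg _ e2.
exists (Num.min d d'); first by rewrite lt_min d0.
move=> w; rewrite lt_min => /andP[/hd h1 /hd' h2].
rewrite (_ : _ - _ = (f w - f z - k * (w - z)) + (g w - g z - l * (w - z))); last by ring.
apply: (le_trans (le_normcD _ _)).
by rewrite (splitr e) mulrDl lerD.
Qed.

Lemma cderM f g z k l : cder f z k -> cder g z l ->
  cder (fun w => f w * g w) z (k * g z + f z * l).
Proof.
move=> Hf Hg e e0.
(* [B] bounds [g w] near [z], and [A] dominates both [f z] and [k]; the three terms of the product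
   rule below receive the shares e/2, e/4 and e/4. *)
pose A := 1 + normc (f z) + normc k; pose B := 1 + normc (g z).
have A0 : 0 < A by rewrite /A -addrA ltr_pwDl // addr_ge0 // normc_ge0.
have B0 : 0 < B by rewrite ltr_pwDl // normc_ge0.
have [|d d0 hd] := Hf (Num.min 1 (e / (2 * B))).
  by rewrite lt_min ltr01 divr_gt0 // mulr_gt0.
have eA : 0 < e / (4 * A) by rewrite divr_gt0 // mulr_gt0.
have [d' d'0 hd'] := Hg _ eA.
have /cvgc_atP /(_ (Num.min 1 (e / (4 * A)))) [|c c0 hc] := cder_continuous Hg.
  by rewrite lt_min ltr01 eA.
exists (Num.min d (Num.min d' c)); first by rewrite !lt_min d0 d'0 c0.
move=> w; rewrite !lt_min => /and3P[/hd h1 /hd' h2 /hc]; rewrite lt_min => /andP[h3 h4].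
rewrite (_ : _ - _ = (f w - f z - k * (w - z)) * g w + f z * (g w - g z - l * (w - z))
   + k * (w - z) * (g w - g z)); last by ring.
set n := normc (w - z) in h1 h2 *.
have n0 : 0 <= n by exact: normc_ge0.
have gB : normc (g w) <= B.
  rewrite -(subrK (g z) (g w)); apply: (le_trans (le_normcD _ _)).
  by rewrite lerD2r ltW.
have -> : e * n = e / (2 * B) * n * B + A * (e / (4 * A)) * n + A * n * (e / (4 * A)).
  by field; rewrite ?lt0r_neq0.
apply: (le_trans (le_normcD _ _)); apply: lerD;
  first (apply: (le_trans (le_normcD _ _)); apply: lerD); rewrite ?normcM.
- apply: ler_pM; rewrite ?normc_ge0 //.
  by apply: (le_trans h1); rewrite ler_wpM2r // ge_min lexx orbT.
- rewrite -mulrA; apply: ler_pM; rewrite ?normc_ge0 //.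
  by rewrite /A -addrA addrCA lerDl addr_ge0 // normc_ge0.
- apply: ler_pM; rewrite ?normc_ge0 ?mulr_ge0 ?normc_ge0 //; last exact: ltW.
  apply: ler_pM; rewrite ?normc_ge0 //.
  by rewrite /A lerDr addr_ge0 // normc_ge0.
Qed.

Lemma cder_comp f g z k l : cder g z l -> cder f (g z) k -> cder (f \o g) z (k * l).
Proof.
move=> Hg Hf e e0.
have k0 : 0 < 1 + normc k by rewrite ltr_pwDl // normc_ge0.
have l0 : 0 < 1 + normc l by rewrite ltr_pwDl // normc_ge0.
have [|d d0 hd] := Hf (e / (2 * (1 + normc l))); first by rewrite divr_gt0 // mulr_gt0.
have /cvgc_atP /(_ d d0) [c c0 hc] := cder_continuous Hg.
have [|b b0 hb] := Hg (Num.min 1 (e / (2 * (1 + normc k)))).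
  by rewrite lt_min ltr01 divr_gt0 // mulr_gt0.
exists (Num.min c b); first by rewrite lt_min c0.
move=> w; rewrite lt_min => /andP[/hc/hd h1 /hb h2] /=.
set n := normc (w - z) in h2 *.
have n0 : 0 <= n by exact: normc_ge0.
have h3 : normc (g w - g z) <= (1 + normc l) * n.
  rewrite -(subrK (l * (w - z)) (g w - g z)); apply: (le_trans (le_normcD _ _)).
  rewrite mulrDl normcM lerD2r (le_trans h2) //.
  by rewrite ler_wpM2r // ge_min lexx.
rewrite (_ : _ - _ = (f (g w) - f (g z) - k * (g w - g z)) + k * (g w - g z - l * (w - z))); last by ring.
apply: (le_trans (le_normcD _ _)).
have -> : e * n = e / (2 * (1 + normc l)) * ((1 + normc l) * n) + (1 + normc k) * (e / (2 * (1 + normc k)) * n).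
  by field; rewrite ?lt0r_neq0.
apply: lerD.
  by apply: (le_trans h1); rewrite ler_wpM2l // ltW // divr_gt0 // mulr_gt0.
rewrite normcM; apply: ler_pM; rewrite ?normc_ge0 //.
  by rewrite lerDr.
by apply: (le_trans h2); rewrite ler_wpM2r // ge_min lexx orbT.
Qed.

Lemma cder_inv z : z != 0 -> cder GRing.inv z (- z ^- 2).
Proof.
move=> z0 e e0; have n0 : 0 < normc z by rewrite normc_gt0.
(* The first radius keeps |w| above |z|/2; the second makes the remainder (w - z)^2 / (w z^2) at
   most e |w - z|. *)
exists (Num.min (normc z / 2) (e * normc z ^+ 3 / 2)).
  by rewrite lt_min !divr_gt0 // mulr_gt0 // exprn_gt0.
move=> w; rewrite lt_min => /andP[h1 h2].
have wn : normc z / 2 <= normc w.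
  have : normc z - normc w <= normc (w - z) by rewrite normcB lerB_normc.
  by lra.
have w0 : w != 0 by rewrite -normc_gt0 (lt_le_trans _ wn) // divr_gt0.
rewrite (_ : _ - _ = (w - z) ^+ 2 / (w * z ^+ 2)); last by field; rewrite ?w0 ?z0.
rewrite normcM normcV [normc (w * _)]normcM !normcX.
rewrite expr2 -mulrA mulrC ler_wpM2r ?normc_ge0 // ler_pdivrMr; last first.
  by rewrite mulr_gt0 ?exprn_gt0 // normc_gt0.
apply: (le_trans (ltW h2)).
rewrite -mulrA ler_pM2l // exprSr -mulrA [leRHS]mulrC.
by rewrite ler_pM2l // exprn_gt0.
Qed.

Lemma geometric_small (q K e : R) : 0 <= q < 1 -> 0 <= K -> 0 < e ->
  exists N, forall n, (N <= n)%N -> K * q ^+ n < e.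
Proof.
move=> /andP[q0 q1] K0 e0.
have K1 : 0 < K + 1 by rewrite ltr_wpDl.
have /cvgrPdist_lt /(_ _ (divr_gt0 e0 K1)) [N _ hN] : q ^+ n @[n --> \oo] --> (0 : R).
  by apply: cvg_expr; rewrite ger0_norm.
exists N => n /hN; rewrite sub0r normrN ger0_norm ?exprn_ge0 // ltr_pdivlMr // mulrC.
by apply: le_lt_trans; rewrite ler_wpM2r ?exprn_ge0 // lerDl.
Qed.

(** The principle by which identities are proved below: the difference of the two sides is truncated
    at every order [n] and bounded geometrically. *)
Lemma le_geometric_eq0 (q K : R) z : 0 <= q < 1 -> 0 <= K ->
  (forall n, normc z <= K * q ^+ n) -> z = 0.
Proof.
move=> hq K0 h; apply/eqP; rewrite -normc_eq0; apply/eqP/le_anti.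
rewrite normc_ge0 andbT; apply/ler_addgt0Pr => e e0; rewrite add0r.
have [N hN] := geometric_small hq K0 e0.
by rewrite (le_trans (h N)) // ltW // hN.
Qed.

End ComplexBasics.

Arguments ComplexField.Normc.normc : simpl never.

(** * Continuity of complex-valued maps *)

Section ComplexContinuity.
Context {R : realType} {T : topologicalType}.
Implicit Types (f g : T -> R[i]) (t : T).

Lemma ccont_cst {c : R[i]} {t : T} : {for t, continuous (fun=> c : R[i])}.
Proof. exact: cvg_cst. Qed.

Lemma ccont_comp f (F : R[i] -> R[i]) t : {for t, continuous f} ->
  {for f t, continuous F} -> {for t, continuous (fun s => F (f s))}.
Proof. exact: continuous_comp. Qed.

Lemma ccont_complex (u v : T -> R) t : {for t, continuous u} -> {for t, continuous v} ->
  {for t, continuous (fun s => u s +i* v s : R[i])}.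
Proof. by move=> hu hv; apply: cvgc_complex. Qed.

Lemma cont_Re f t : {for t, continuous f} -> {for t, continuous (fun s => complex.Re (f s))}.
Proof. by move=> hf; apply: (continuous_comp hf); exact: continuous_Re. Qed.

Lemma cont_Im f t : {for t, continuous f} -> {for t, continuous (fun s => complex.Im (f s))}.
Proof. by move=> hf; apply: (continuous_comp hf); exact: continuous_Im. Qed.

Lemma ccont_ReIm f t : {for t, continuous (fun s => complex.Re (f s))} ->
  {for t, continuous (fun s => complex.Im (f s))} -> {for t, continuous f}.
Proof.
move=> hr hi; rewrite (_ : f = (fun s => complex.Re (f s) +i* complex.Im (f s))).
  exact: ccont_complex.
by apply/funext => s; case: (f s).
Qed.

Lemma ccontD f g t : {for t, continuous f} -> {for t, continuous g} ->
  {for t, continuous (fun s => f s + g s)}.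
Proof.
move=> hf hg; apply: ccont_ReIm.
- rewrite (_ : (fun s => _) = (fun s => complex.Re (f s) + complex.Re (g s))).
    by apply: (@cvgD R R); exact: cont_Re.
  by apply/funext => s; exact: cReD.
- rewrite (_ : (fun s => _) = (fun s => complex.Im (f s) + complex.Im (g s))).
    by apply: (@cvgD R R); exact: cont_Im.
  by apply/funext => s; exact: cImD.
Qed.

Lemma ccontM f g t : {for t, continuous f} -> {for t, continuous g} ->
  {for t, continuous (fun s => f s * g s)}.
Proof.
move=> hf hg; apply: ccont_ReIm.
- rewrite (_ : (fun s => _) = (fun s => complex.Re (f s) * complex.Re (g s)
     - complex.Im (f s) * complex.Im (g s))).
    by apply: (@cvgB R R); apply: (@cvgM R); (exact: cont_Re || exact: cont_Im).
  by apply/funext => s; exact: cReM.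
- rewrite (_ : (fun s => _) = (fun s => complex.Re (f s) * complex.Im (g s)
     + complex.Im (f s) * complex.Re (g s))).
    by apply: (@cvgD R R); apply: (@cvgM R); (exact: cont_Re || exact: cont_Im).
  by apply/funext => s; exact: cImM.
Qed.

Lemma ccontB f g t : {for t, continuous f} -> {for t, continuous g} ->
  {for t, continuous (fun s => f s - g s)}.
Proof.
move=> hf hg; rewrite (_ : (fun s => _) = (fun s => f s + (-1) * g s)).
  exact: (ccontD hf (ccontM ccont_cst hg)).
by apply/funext => s; rewrite mulN1r.
Qed.

Lemma ccontV f t : {for t, continuous f} -> f t != 0 ->
  {for t, continuous (fun s => (f s)^-1)}.
Proof.
by move=> hf f0; apply: ccont_comp hf (cder_continuous (cder_inv f0)).
Qed.

Lemma ccontX f n t : {for t, continuous f} -> {for t, continuous (fun s => f s ^+ n)}.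
Proof.
move=> hf; elim: n => [|n IH]; first exact: ccont_cst.
rewrite (_ : (fun s => _) = (fun s => f s * f s ^+ n)); first exact: ccontM.
by apply/funext => s; rewrite exprS.
Qed.

Lemma ccont_sum (I : Type) (r : seq I) (F : I -> T -> R[i]) t :
  (forall i, {for t, continuous (F i)}) ->
  {for t, continuous (fun s => \sum_(i <- r) F i s)}.
Proof.
move=> h; elim: r => [|i r IH].
  rewrite (_ : (fun s => _) = (fun=> 0)); first exact: ccont_cst.
  by apply/funext => s; rewrite big_nil.
rewrite (_ : (fun s => _) = (fun s => F i s + \sum_(j <- r) F j s)); first exact: (ccontD (h i) IH).
by apply/funext => s; rewrite big_cons.
Qed.

End ComplexContinuity.

(** * Integrals of complex-valued functions *)

Section ComplexIntegral.
Context d {T : measurableType d} {R : realType} (mu : {measure set T -> \bar R}).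
Implicit Types (D : set T) (f g : T -> R[i]) (c : R[i]).

Definition cint D f : R[i] :=
  (\int[mu]_(t in D) complex.Re (f t)) +i* (\int[mu]_(t in D) complex.Im (f t)).

Definition cintegrable D f :=
  mu.-integrable D (EFin \o (fun t => complex.Re (f t))) /\
  mu.-integrable D (EFin \o (fun t => complex.Im (f t))).

Lemma cintegrableS D E f : measurable D -> measurable E -> D `<=` E ->
  cintegrable E f -> cintegrable D f.
Proof. by move=> mD mE DE [h1 h2]; split; apply: integrableS h1 || apply: integrableS h2. Qed.

Lemma eq_cint D f g : (forall t, D t -> f t = g t) -> cint D f = cint D g.
Proof.
by move=> fg; rewrite /cint; congr (_ +i* _); apply: eq_Rintegral => t /set_mem/fg ->.
Qed.

Lemma eq_cintegrable D f g : measurable D -> (forall t, D t -> f t = g t) ->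
  cintegrable D f -> cintegrable D g.
Proof.
move=> mD fg [h1 h2]; split; [apply: eq_integrable h1|apply: eq_integrable h2] => //;
  by move=> t /set_mem/fg /= ->.
Qed.

Lemma integrable_lin D (u v : T -> R) (a b : R) : measurable D ->
  mu.-integrable D (EFin \o u) -> mu.-integrable D (EFin \o v) ->
  mu.-integrable D (EFin \o (fun t => a * u t + b * v t)).
Proof.
move=> mD hu hv.
have hau : mu.-integrable D (fun t => (a%:E * (u t)%:E)%E) by exact: integrableZl.
have hbv : mu.-integrable D (fun t => (b%:E * (v t)%:E)%E) by exact: integrableZl.
by apply: eq_integrable (integrableD mD hau hbv).
Qed.

Lemma Rintegral_lin D (u v : T -> R) (a b : R) : measurable D ->
  mu.-integrable D (EFin \o u) -> mu.-integrable D (EFin \o v) ->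
  \int[mu]_(t in D) (a * u t + b * v t) =
  a * \int[mu]_(t in D) u t + b * \int[mu]_(t in D) v t.
Proof.
move=> mD hu hv.
have hau : mu.-integrable D (EFin \o (fun t => a * u t)).
  apply: eq_integrable (integrable_lin a 0 mD hu hv) => // t _ /=.
  by rewrite mul0r addr0.
have hbv : mu.-integrable D (EFin \o (fun t => b * v t)).
  apply: eq_integrable (integrable_lin 0 b mD hu hv) => // t _ /=.
  by rewrite mul0r add0r.
by rewrite (RintegralD mD hau hbv) !RintegralZl.
Qed.

Lemma cintegrableD D f g : measurable D ->
  cintegrable D f -> cintegrable D g -> cintegrable D (fun t => f t + g t).
Proof.
move=> mD [f1 f2] [g1 g2]; split.
- apply: eq_integrable (integrable_lin 1 1 mD f1 g1) => // t _ /=.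
  by rewrite !mul1r cReD.
- apply: eq_integrable (integrable_lin 1 1 mD f2 g2) => // t _ /=.
  by rewrite !mul1r cImD.
Qed.

Lemma cintD D f g : measurable D -> cintegrable D f -> cintegrable D g ->
  cint D (fun t => f t + g t) = cint D f + cint D g.
Proof.
move=> mD [f1 f2] [g1 g2]; rewrite /cint; simpc; congr (_ +i* _).
- rewrite -[in RHS](mul1r (\int[mu]_(_ in _) complex.Re (f _))) -[X in _ = _ + X]mul1r.
  rewrite -Rintegral_lin //; apply: eq_Rintegral => t _; rewrite !mul1r; exact: cReD.
- rewrite -[in RHS](mul1r (\int[mu]_(_ in _) complex.Im (f _))) -[X in _ = _ + X]mul1r.
  rewrite -Rintegral_lin //; apply: eq_Rintegral => t _; rewrite !mul1r; exact: cImD.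
Qed.

Lemma cintegrableZ D c f : measurable D -> cintegrable D f ->
  cintegrable D (fun t => c * f t).
Proof.
move=> mD [f1 f2]; split.
- apply: eq_integrable (integrable_lin (complex.Re c) (- complex.Im c) mD f1 f2) => // t _.
  by congr EFin; rewrite /= cReM mulNr.
- apply: eq_integrable (integrable_lin (complex.Re c) (complex.Im c) mD f2 f1) => // t _.
  by congr EFin; rewrite /= cImM.
Qed.

Lemma cintZ D c f : measurable D -> cintegrable D f ->
  cint D (fun t => c * f t) = c * cint D f.
Proof.
move=> mD [f1 f2]; apply: complex_eqP; rewrite ?cReM ?cImM /cint /=.
- by rewrite -mulNr -Rintegral_lin //; apply: eq_Rintegral => t _; rewrite mulNr; exact: cReM.
- by rewrite -Rintegral_lin //; apply: eq_Rintegral => t _; exact: cImM.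
Qed.

Lemma cintegrable0 D : measurable D -> cintegrable D (fun=> 0).
Proof.
move=> mD; split; apply: (@eq_integrable _ _ _ mu D mD (cst 0)) => //; exact: integrable0.
Qed.

Lemma cint0 D : cint D (fun=> 0) = 0.
Proof.
by apply: complex_eqP; rewrite /cint /= /Rintegral integral0.
Qed.

Lemma cintegrable_sum D (I : Type) (r : seq I) (F : I -> T -> R[i]) :
  measurable D -> (forall i, cintegrable D (F i)) ->
  cintegrable D (fun t => \sum_(i <- r) F i t).
Proof.
move=> mD h; elim: r => [|i r IH].
  by apply: eq_cintegrable (cintegrable0 mD) => // t _; rewrite big_nil.
by apply: eq_cintegrable (cintegrableD mD (h i) IH) => // t _; rewrite big_cons.
Qed.

Lemma cint_sum D (I : Type) (r : seq I) (F : I -> T -> R[i]) :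
  measurable D -> (forall i, cintegrable D (F i)) ->
  cint D (fun t => \sum_(i <- r) F i t) = \sum_(i <- r) cint D (F i).
Proof.
move=> mD h; elim: r => [|i r IH].
  by rewrite big_nil -[RHS](cint0 D); apply: eq_cint => t _; rewrite big_nil.
rewrite big_cons -IH -cintD //; last exact: cintegrable_sum.
by apply: eq_cint => t _; rewrite big_cons.
Qed.

Lemma cintegrableB D f g : measurable D ->
  cintegrable D f -> cintegrable D g -> cintegrable D (fun t => f t - g t).
Proof.
move=> mD hf hg.
apply: eq_cintegrable (cintegrableD mD hf (cintegrableZ (-1) mD hg)) => // t _.
by rewrite mulN1r.
Qed.

Lemma cintB D f g : measurable D -> cintegrable D f -> cintegrable D g ->
  cint D (fun t => f t - g t) = cint D f - cint D g.
Proof.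
move=> mD hf hg; rewrite -[- cint D g]mulN1r -cintZ // -cintD //; last exact: cintegrableZ.
by apply: eq_cint => t _; rewrite mulN1r.
Qed.

Lemma cint_conj D f : measurable D -> cintegrable D f ->
  cint D (fun t => conjc (f t)) = conjc (cint D f).
Proof.
move=> mD [f1 f2]; rewrite /cint /=; congr (_ +i* _).
  by apply: eq_Rintegral => t _; case: (f t).
rewrite -[RHS]addr0 -[X in _ = _ + X](mul0r (\int[mu]_(t in D) complex.Re (f t))).
rewrite -mulN1r -Rintegral_lin //; apply: eq_Rintegral => t _.
by case: (f t) => a b /=; rewrite mul0r addr0 mulN1r.
Qed.

Lemma integrable_bounded D (u : T -> R) (M : R) : measurable D -> (mu D < +oo)%E ->
  measurable_fun D u -> (forall t, D t -> `|u t| <= M) ->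
  mu.-integrable D (EFin \o u).
Proof.
move=> mD Dfin mu_ hM; apply/integrableP; split; first exact/measurable_EFinP.
apply: (@le_lt_trans _ _ (\int[mu]_(t in D) (M%:E))%E).
  apply: ge0_le_integral => //=.
  by apply/(@measurable_EFinP _ _ _ D (fun x => `|u x|)); exact: measurableT_comp.
rewrite integral_cst //.
have [DM|] := leP 0 M; first by rewrite lte_mul_pinfty // ?lee_fin.
move=> M0; rewrite (@le_lt_trans _ _ 0%E) //.
by rewrite mule_le0_ge0 // lee_fin ltW.
Qed.

Lemma normc_Rintegral_le D (u : T -> R) (M : R) : measurable D -> (mu D < +oo)%E ->
  mu.-integrable D (EFin \o u) -> (forall t, D t -> `|u t| <= M) ->
  `|\int[mu]_(t in D) u t| <= M * fine (mu D).
Proof.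
move=> mD Dfin hu hM; apply: (le_trans (le_normr_Rintegral mD hu)).
rewrite -Rintegral_cst //; apply: le_Rintegral => //.
- have [h1 h2] := integrableP _ _ _ hu.
  by apply: eq_integrable (integrable_abse hu) => // t _.
- by apply: finite_measure_integrable_cst_on || apply: (@integrable_bounded _ _ `|M|) => //.
Qed.

(** Real and imaginary parts are bounded separately, whence the factor 2 that recurs in later
    constants. *)
Lemma normc_cint_le D f (M : R) : measurable D -> (mu D < +oo)%E ->
  cintegrable D f -> (forall t, D t -> normc (f t) <= M) ->
  normc (cint D f) <= 2 * M * fine (mu D).
Proof.
move=> mD Dfin [f1 f2] hM; apply: (le_trans (normc_le_ReIm _)).
rewrite -mulrA [leRHS]mulr_natl mulr2n /=; apply: lerD.
- by apply: normc_Rintegral_le => // t /hM; apply: le_trans; exact: abs_Re_le.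
- by apply: normc_Rintegral_le => // t /hM; apply: le_trans; exact: abs_Im_le.
Qed.

Lemma cintegrable_cst D c : measurable D -> (mu D < +oo)%E -> cintegrable D (fun=> c).
Proof.
move=> mD Dfin; split.
- by apply: (@integrable_bounded _ _ `|complex.Re c|) => //.
- by apply: (@integrable_bounded _ _ `|complex.Im c|) => //.
Qed.

Lemma cint_cst D c : measurable D -> cint D (fun=> c) = c * (fine (mu D))%:C.
Proof.
move=> mD; rewrite /cint !Rintegral_cst //.
by case: c => a b; simpc.
Qed.

End ComplexIntegral.

Arguments cint : simpl never.

(** * Complex integrals over real intervals *)

Section LebesgueComplexIntegral.
Context {R : realType}.
Local Notation lam := (@lebesgue_measure R).
Implicit Types (f : R -> R[i]) (a b m : R).

Lemma cintegrable_continuous a b f : {within `[a, b], continuous f} ->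
  cintegrable lam `[a, b] f.
Proof.
move=> cf; split; apply: continuous_compact_integrable (@segment_compact _ a b) _ => x;
  apply: continuous_comp; (exact: cf || exact: continuous_Re || exact: continuous_Im).
Qed.

Lemma fine_lebesgue_itv a b : a <= b -> fine (lam `[a, b]%classic) = b - a.
Proof.
rewrite lebesgue_measure_itv /= lte_fin le_eqVlt => /orP[/eqP ->|ab].
  by rewrite ltxx subrr.
by rewrite ab.
Qed.

Lemma lebesgue_itv_fin a b : (lam `[a, b]%classic < +oo)%E.
Proof. by rewrite lebesgue_measure_itv /=; case: ifPn => //; rewrite -EFinB ltry. Qed.

Lemma cint_split a m b f : a <= m -> m <= b -> cintegrable lam `[a, b] f ->
  cint lam `[a, b] f = cint lam `[a, m] f + cint lam `[m, b] f.
Proof.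
move=> am mb [f1 f2].
have key (u : R -> R) : lam.-integrable `[a, b] (EFin \o u) ->
    \int[lam]_(x in `[a, b]) u x =
    \int[lam]_(x in `[a, m]) u x + \int[lam]_(x in `[m, b]) u x.
  move=> hu; rewrite -[X in _ = _ + X]Rintegral_itv_obnd_cbnd; last first.
    apply: integrableS hu => //; apply: subset_itv; rewrite bnd_simp //.
  by rewrite -(Rintegral_itvB hu) ?bnd_simp // addrC subrK.
by apply: complex_eqP; rewrite ?cReD ?cImD /cint /= key.
Qed.

Lemma normc_cint_itv_le a b f M : a <= b -> cintegrable lam `[a, b] f ->
  (forall t, a <= t <= b -> normc (f t) <= M) ->
  normc (cint lam `[a, b] f) <= 2 * M * (b - a).
Proof.
move=> ab hf hM; rewrite -(fine_lebesgue_itv ab); apply: normc_cint_le => //.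
exact: lebesgue_itv_fin.
Qed.

Lemma path_integralE (h : R[i] -> R[i]) z :
  path_integral h z = z * cint lam `[0, 1] (fun t => h (t%:C * z)).
Proof. by []. Qed.

End LebesgueComplexIntegral.

(** * Goursat's theorem for rectangles *)

Section Goursat.
Context {R : realType}.
Local Notation lam := (@lebesgue_measure R).
Implicit Types (F : R[i] -> R[i]) (a b c d x y : R) (z l : R[i]).

(** The counterclockwise contour integral, with opposite sides combined under one integral over an
    interval. *)
Definition rect_int F a b c d : R[i] :=
  cint lam `[a, b] (fun x => F (x +i* c) - F (x +i* d)) +
  'i * cint lam `[c, d] (fun y => F (b +i* y) - F (a +i* y)).

Arguments rect_int : simpl never.

Definition rect_cont F a b c d := forall x y, a <= x <= b -> c <= y <= d ->
  {for x +i* y, continuous F}.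

Lemma within_pointwise_continuous a b (f : R -> R[i]) :
  (forall x, a <= x <= b -> {for x, continuous f}) -> {within `[a, b], continuous f}.
Proof.
move=> h; apply: continuous_in_subspaceT => x.
by rewrite inE /= in_itv /= => /h.
Qed.

Lemma cintegrable_hor F a b y : (forall x, a <= x <= b -> {for x +i* y, continuous F}) ->
  cintegrable lam `[a, b] (fun x => F (x +i* y)).
Proof.
move=> h; apply/cintegrable_continuous/within_pointwise_continuous => x /h cF.
exact: (ccont_comp (f := fun x => x +i* y) (ccont_complex cvg_id (cvg_cst _)) cF).
Qed.

Lemma cintegrable_ver F c d x : (forall y, c <= y <= d -> {for x +i* y, continuous F}) ->
  cintegrable lam `[c, d] (fun y => F (x +i* y)).
Proof.
move=> h; apply/cintegrable_continuous/within_pointwise_continuous => y /h cF.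
exact: (ccont_comp (f := fun y => x +i* y) (ccont_complex (cvg_cst _) cvg_id) cF).
Qed.

Lemma rect_int_splitx F a m b c d : a <= m -> m <= b -> c <= d -> rect_cont F a b c d ->
  rect_int F a b c d = rect_int F a m c d + rect_int F m b c d.
Proof.
move=> am mb cd cF; have ab := le_trans am mb.
have hor y : c <= y <= d -> cintegrable lam `[a, b] (fun x => F (x +i* y)).
  by move=> hy; apply: cintegrable_hor => x hx; apply: cF.
have ver x : a <= x <= b -> cintegrable lam `[c, d] (fun y => F (x +i* y)).
  by move=> hx; apply: cintegrable_ver => y hy; apply: cF.
have hc : c <= c <= d by rewrite lexx.
have hd : c <= d <= d by rewrite lexx cd.
have ha : a <= a <= b by rewrite lexx.
have hb : a <= b <= b by rewrite lexx ab.
have hm : a <= m <= b by rewrite am mb.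
rewrite /rect_int (cint_split am mb); last by apply: cintegrableB => //; exact: hor.
rewrite !(cintB (mu := lam) (D := `[c, d]%classic)) //; try exact: ver.
by ring.
Qed.

Lemma rect_int_splity F a b c m d : c <= m -> m <= d -> a <= b -> rect_cont F a b c d ->
  rect_int F a b c d = rect_int F a b c m + rect_int F a b m d.
Proof.
move=> cm md ab cF; have cd := le_trans cm md.
have hor y : c <= y <= d -> cintegrable lam `[a, b] (fun x => F (x +i* y)).
  by move=> hy; apply: cintegrable_hor => x hx; apply: cF.
have ver x : a <= x <= b -> cintegrable lam `[c, d] (fun y => F (x +i* y)).
  by move=> hx; apply: cintegrable_ver => y hy; apply: cF.
have hc : c <= c <= d by rewrite lexx.
have hd : c <= d <= d by rewrite lexx cd.
have ha : a <= a <= b by rewrite lexx.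
have hb : a <= b <= b by rewrite lexx ab.
have hm : c <= m <= d by rewrite cm md.
rewrite /rect_int (cint_split cm md); last by apply: cintegrableB => //; exact: ver.
rewrite !(cintB (mu := lam) (D := `[a, b]%classic)) //; try exact: hor.
by ring.
Qed.

Lemma normc_complex_le x y : normc (x +i* y) <= `|x| + `|y|.
Proof. exact: normc_le_ReIm. Qed.

(** An affine function has zero contour integral, so only a remainder of size e D is left. It counts
    twice on each pair of opposite sides, and the factor 2 of [normc_cint_itv_le] makes 4. *)
Lemma rect_int_local F a b c d x0 y0 l e D : a <= b -> c <= d -> rect_cont F a b c d ->
  a <= x0 <= b -> c <= y0 <= d -> (b - a) + (d - c) <= D -> 0 <= e ->
  (forall w, normc (w - (x0 +i* y0)) <= D ->
    normc (F w - F (x0 +i* y0) - l * (w - (x0 +i* y0))) <= e * normc (w - (x0 +i* y0))) ->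
  normc (rect_int F a b c d) <= 4 * e * D * ((b - a) + (d - c)).
Proof.
move=> ab cd cF hx0 hy0 hD e0 H.
pose p : R[i] := x0 +i* y0.
have [r rE] : exists r : R[i] -> R[i], forall w, r w = F w - F p - l * (w - p) by eexists.
have cr : rect_cont r a b c d.
  have -> : r = fun w => F w - F p - l * (w - p) by apply/funext.
  move=> x y hx hy.
  exact: (ccontB (ccontB (cF x y hx hy) ccont_cst) (ccontM ccont_cst (ccontB cvg_id ccont_cst))).
have rb x y : a <= x <= b -> c <= y <= d -> normc (r (x +i* y)) <= e * D.
  move=> /andP[? ?] /andP[? ?]; have hxy : normc (x +i* y - p) <= D.
    apply: (le_trans _ hD); rewrite /p; simpc; apply: (le_trans (normc_complex_le _ _)).
    move: hx0 hy0 => /andP[? ?] /andP[? ?].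
    by apply: lerD; rewrite ler_norml; lra.
  by rewrite rE; apply: (le_trans (H _ hxy)); rewrite ler_wpM2l.
have hc : c <= c <= d by rewrite lexx.
have hd : c <= d <= d by rewrite lexx cd.
have ha : a <= a <= b by rewrite lexx.
have hb : a <= b <= b by rewrite lexx ab.
have hor y : c <= y <= d -> cintegrable lam `[a, b] (fun x => r (x +i* y)).
  by move=> hy; apply: cintegrable_hor => x hx; apply: cr.
have ver x : a <= x <= b -> cintegrable lam `[c, d] (fun y => r (x +i* y)).
  by move=> hx; apply: cintegrable_ver => y hy; apply: cr.
(* The affine part contributes l i (c - d) (b - a) on the horizontal sides and l i (b - a) (d - c)
   on the vertical ones, which cancel. *)
have -> : rect_int F a b c d = rect_int r a b c d.
  rewrite /rect_int.
  have -> : cint lam `[a, b] (fun x => F (x +i* c) - F (x +i* d)) =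
     cint lam `[a, b] (fun x => (r (x +i* c) - r (x +i* d)) + l * (0 +i* (c - d))).
    apply: eq_cint => x _; rewrite !rE.
    rewrite (_ : 0 +i* (c - d) = (x +i* c) - (x +i* d)); last by rewrite -[RHS]/((x - x) +i* (c - d)) subrr.
    by ring.
  have -> : cint lam `[c, d] (fun y => F (b +i* y) - F (a +i* y)) =
     cint lam `[c, d] (fun y => (r (b +i* y) - r (a +i* y)) + l * (b - a)%:C).
    apply: eq_cint => y _; rewrite !rE.
    rewrite (_ : (b - a)%:C = (b +i* y) - (a +i* y)); last by rewrite -[RHS]/((b - a) +i* (y - y)) subrr.
    by ring.
  have key s t (u : R -> R[i]) k : s <= t -> cintegrable lam `[s, t] u ->
      cint lam `[s, t] (fun x => u x + k) = cint lam `[s, t] u + k * (t - s)%:C.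
    move=> st hu; rewrite cintD ?cint_cst ?fine_lebesgue_itv //.
    by apply: cintegrable_cst => //; exact: lebesgue_itv_fin.
  rewrite !key //; last 2 first.
  - by apply: cintegrableB => //; exact: ver.
  - by apply: cintegrableB => //; exact: hor.
  rewrite (_ : 0 +i* (c - d) = 'i * - (d - c)%:C); first by ring.
  by rewrite -rmorphN opprB; simpc.
rewrite /rect_int; apply: (le_trans (le_normcD _ _)).
have -> : 4 * e * D * (b - a + (d - c)) =
  2 * (e * D + e * D) * (b - a) + 1 * (2 * (e * D + e * D) * (d - c)) by ring.
apply: lerD; last rewrite normcM; last apply: ler_pM; rewrite ?normc_ge0 //.
- apply: normc_cint_itv_le => //; first by apply: cintegrableB => //; exact: hor.
  move=> x hx; apply: (le_trans (ler_normcB _ _)).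
  by apply: lerD; apply: rb.
- by rewrite normc_i.
- apply: normc_cint_itv_le => //; first by apply: cintegrableB => //; exact: ver.
  move=> y hy; apply: (le_trans (ler_normcB _ _)).
  by apply: lerD; apply: rb.
Qed.

(* Some quarter of a dyadic rectangle carries at least a quarter of the boundary integral. *)
Lemma goursat F a b c d : a <= b -> c <= d ->
  (forall x y, a <= x <= b -> c <= y <= d -> exists l, cder F (x +i* y) l) ->
  rect_int F a b c d = 0.
Proof.
move=> ab cd dF.
have cF : rect_cont F a b c d.
  by move=> x y hx hy; have [l /cder_continuous] := dF x y hx hy.
pose w := b - a; pose h := d - c.
have w0 : 0 <= w by rewrite subr_ge0.
have h0 : 0 <= h by rewrite subr_ge0.
pose J n (p : R * R) := rect_int F p.1 (p.1 + w / 2 ^+ n) p.2 (p.2 + h / 2 ^+ n).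
apply/eqP; rewrite -normc_eq0; apply/eqP/le_anti; rewrite normc_ge0 andbT.
apply/ler_addgt0Pr => e e0; rewrite add0r leNgt; apply/negP => Je.
(* Invariant of the subdivision: the rectangle of stage [n] with lower left corner [p] lies in the
   original one, and its boundary integral exceeds e / 4^n. *)
pose Q n (p : R * R) := [/\ a <= p.1, p.1 + w / 2 ^+ n <= b, c <= p.2,
  p.2 + h / 2 ^+ n <= d & e / 4 ^+ n < normc (J n p)].
have step (np : nat * (R * R)) : exists p' : R * R, Q np.1 np.2 ->
    Q np.1.+1 p' /\ [/\ np.2.1 <= p'.1, p'.1 + w / 2 ^+ np.1.+1 <= np.2.1 + w / 2 ^+ np.1,
      np.2.2 <= p'.2 & p'.2 + h / 2 ^+ np.1.+1 <= np.2.2 + h / 2 ^+ np.1].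
  case: np => n [x y] /=.
  have [Qn|] := pselect (Q n (x, y)); last by move=> nQ; exists (x, y) => /nQ.
  case: Qn => /= ax xb cy yd eJ.
  pose wn := w / 2 ^+ n.+1; pose hn := h / 2 ^+ n.+1.
  have wn0 : 0 <= wn by rewrite divr_ge0 // ltW.
  have hn0 : 0 <= hn by rewrite divr_ge0 // ltW.
  have wE : x + w / 2 ^+ n = x + wn + wn.
    by rewrite /wn exprS; field; rewrite lt0r_neq0.
  have hE : y + h / 2 ^+ n = y + hn + hn.
    by rewrite /hn exprS; field; rewrite lt0r_neq0.
  rewrite /J /= wE hE in xb yd eJ *.
  have JE : rect_int F x (x + wn + wn) y (y + hn + hn) =
     (J n.+1 (x, y) + J n.+1 (x, y + hn)) + (J n.+1 (x + wn, y) + J n.+1 (x + wn, y + hn)).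
    have cR : rect_cont F x (x + wn + wn) y (y + hn + hn).
      by move=> u v /andP[? ?] /andP[? ?]; apply: cF; apply/andP; split; lra.
    have cR1 : rect_cont F x (x + wn) y (y + hn + hn).
      by move=> u v /andP[? ?] hv; apply: cR => //; apply/andP; split; lra.
    have cR2 : rect_cont F (x + wn) (x + wn + wn) y (y + hn + hn).
      by move=> u v /andP[? ?] hv; apply: cR => //; apply/andP; split; lra.
    have l1 : x <= x + wn by rewrite lerDl.
    have l2 : x + wn <= x + wn + wn by rewrite lerDl.
    have l3 : y <= y + hn by rewrite lerDl.
    have l4 : y + hn <= y + hn + hn by rewrite lerDl.
    rewrite (rect_int_splitx l1 l2 (le_trans l3 l4) cR) (rect_int_splity l3 l4 l1 cR1).
    by rewrite (rect_int_splity l3 l4 l2 cR2).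
  have [k Qk] : exists k : bool * bool, let p' := (x + k.1%:R * wn, y + k.2%:R * hn) in
      e / 4 ^+ n.+1 < normc (J n.+1 p').
    apply: contrapT => /forallNP nk.
    have small (k1 k2 : bool) : normc (J n.+1 (x + k1%:R * wn, y + k2%:R * hn)) <= e / 4 ^+ n.+1.
      by rewrite leNgt; apply/negP => hk; apply: (nk (k1, k2)).
    have := small false false; have := small false true.
    have := small true false; have := small true true.
    rewrite !mul0r !mul1r !addr0 => s1 s2 s3 s4.
    move: eJ; rewrite ltNge => /negP; apply; rewrite JE.
    apply: (le_trans (le_normcD _ _)).
    apply: (le_trans (lerD (le_normcD _ _) (le_normcD _ _))).
    have -> : e / 4 ^+ n = 4 * (e / 4 ^+ n.+1) by rewrite exprS; field; rewrite lt0r_neq0.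
    by clear - s1 s2 s3 s4; lra.
  have k1b : 0 <= k.1%:R * wn <= wn by case: (k.1); rewrite ?mul1r ?mul0r ?lexx ?wn0.
  have k2b : 0 <= k.2%:R * hn <= hn by case: (k.2); rewrite ?mul1r ?mul0r ?lexx ?hn0.
  move: k1b k2b => /andP[k1a k1b] /andP[k2a k2b].
  exists (x + k.1%:R * wn, y + k.2%:R * hn) => _; rewrite /Q /= -/wn -/hn.
  by split; split => //; clear Qk; clear - ax xb cy yd k1a k1b k2a k2b wn0 hn0; lra.
have [f Hf] := choice step.
pose s := fix s n := if n is n'.+1 then f (n', s n') else (a, c).
have Qs n : Q n (s n).
  elim: n => [|n IH]; last by have [] := Hf (n, s n) IH.
  by split; rewrite /J /= ?expr0 ?divr1 ?lexx // ?subrKC // /w /h !subrKC.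
have mono n : [/\ (s n).1 <= (s n.+1).1, (s n.+1).1 + w / 2 ^+ n.+1 <= (s n).1 + w / 2 ^+ n,
      (s n).2 <= (s n.+1).2 & (s n.+1).2 + h / 2 ^+ n.+1 <= (s n).2 + h / 2 ^+ n].
  by have [] := Hf (n, s n) (Qs n).
(* Nested intervals: the supremum of the left ends lies in all of them. *)
have limit (u v : nat -> R) : (forall n, u n <= u n.+1) -> (forall n, v n.+1 <= v n) ->
    (forall n, u n <= v n) -> exists x, forall n, u n <= x <= v n.
  move=> hu hv uv.
  have uU n m : (n <= m)%N -> u n <= u m.
    by move=> /subnK <-; elim: (m - n)%N => [|j IH] //; rewrite addSn (le_trans IH).
  have vV n m : (n <= m)%N -> v m <= v n.
    by move=> /subnK <-; elim: (m - n)%N => [|j IH] //; rewrite addSn (le_trans _ IH).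
  have uvnm n m : u n <= v m.
    have [nm|/ltnW mn] := leqP n m; first exact: le_trans (uU _ _ nm) (uv m).
    exact: le_trans (uv n) (vV _ _ mn).
  exists (sup (range u)) => n; apply/andP; split.
    apply: ub_le_sup; last by exists n.
    by exists (v 0%N) => _ [m _ <-].
  by apply: ge_sup; [exists (u 0%N), 0%N|move=> _ [m _ <-]].
have [x0 hx0] : exists x, forall n, (s n).1 <= x <= (s n).1 + w / 2 ^+ n.
  apply: limit => n; [by have [] := mono n|by have [] := mono n|].
  by rewrite lerDl divr_ge0 // ltW.
have [y0 hy0] : exists y, forall n, (s n).2 <= y <= (s n).2 + h / 2 ^+ n.
  apply: limit => n; [by have [] := mono n|by have [] := mono n|].
  by rewrite lerDl divr_ge0 // ltW.
have [l Hl] : exists l, cder F (x0 +i* y0) l.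
  by apply: dF; [move: (hx0 0%N)|move: (hy0 0%N)]; rewrite /= expr0 divr1 subrKC.
(* With D = (w + h) / 2^n the local estimate 4 (e / K) D^2 is then at most e / 4^n, against the
   invariant; the summand 1 keeps [K] positive for degenerate rectangles. *)
pose K := 8 * ((w + h) ^+ 2 + 1).
have K0 : 0 < K by rewrite mulr_gt0 // ltr_wpDl // sqr_ge0.
have [dl dl0 hdl] := Hl (e / K) (divr_gt0 e0 K0).
have [n hn] : exists n, (w + h) / 2 ^+ n < dl.
  have [|N hN] := @geometric_small R (1 / 2) (w + h) dl _ (addr_ge0 w0 h0) dl0.
    by clear; lra.
  by exists N; have := hN N (leqnn N); rewrite expr_div_n expr1n mul1r.
have [as_ sb cs sd eJ] := Qs n.
have Dn : (w + h) / 2 ^+ n = w / 2 ^+ n + h / 2 ^+ n by rewrite mulrDl.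
have := @rect_int_local F (s n).1 ((s n).1 + w / 2 ^+ n) (s n).2 ((s n).2 + h / 2 ^+ n) x0 y0 l
  (e / K) ((w + h) / 2 ^+ n).
rewrite !(addrC (s n).1) !(addrC (s n).2) !addrK -Dn.
have wn0 : 0 <= w / 2 ^+ n by rewrite divr_ge0 // ltW.
have hn0 : 0 <= h / 2 ^+ n by rewrite divr_ge0 // ltW.
rewrite ![_ / _ + (s n).1]addrC ![_ / _ + (s n).2]addrC !lerDl.
move=> /(_ wn0 hn0) H; move: eJ; rewrite ltNge => /negP; apply.
apply: (le_trans (H _ (hx0 n) (hy0 n) (lexx _) (ltW (divr_gt0 e0 K0)) _)).
- move=> u v /andP[u1 u2] /andP[v1 v2]; apply: cF; apply/andP; split.
  + exact: le_trans as_ u1.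
  + exact: le_trans u2 sb.
  + exact: le_trans cs v1.
  + exact: le_trans v2 sd.
- by move=> u hu; apply: hdl; apply: le_lt_trans hu hn.
have -> : 4 ^+ n = 2 ^+ n * 2 ^+ n :> R by rewrite -exprMn; congr (_ ^+ n); ring.
have -> : 4 * (e / K) * ((w + h) / 2 ^+ n) * ((w + h) / 2 ^+ n) =
  (4 * (w + h) ^+ 2 / K) * (e / (2 ^+ n * 2 ^+ n)).
  by field; rewrite !lt0r_neq0.
rewrite ler_piMl //; first by rewrite divr_ge0 ?mulr_ge0 // ltW.
rewrite ler_pdivrMr // mul1r /K.
have := sqr_ge0 (w + h); set X := (w + h) ^+ 2; clear; lra.
Qed.
End Goursat.

(** * The complex exponential *)

Section ComplexExponential.
Context {R : realType}.
Implicit Types (x y r s t : R) (u w z : R[i]).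

Lemma is_derive_eps (f : R -> R) x l : is_derive x (1 : R) f l ->
  forall e : R, 0 < e -> exists2 d : R, 0 < d &
    forall h : R, `|h| < d -> `|f (h + x) - f x - l * h| <= e * `|h|.
Proof.
move=> [df fl] e e0.
have /cvgrPdist_lt /(_ e e0) : h^-1 *: ((f \o shift x) (h *: 1) - f x) @[h --> 0^'] --> l.
  by rewrite -fl; exact: df.
move=> /nbhs_ballP[d /= d0 hd]; exists d => // h hd'.
have [->|h0] := eqVneq h 0; first by rewrite add0r subrr mulr0 subr0 normr0 mulr0.
have hb : `|l - h^-1 *: (f (h *: 1 + x) - f x)| < e.
  by apply: hd => //; rewrite /ball /= sub0r normrN.
rewrite (_ : h *: 1 = h) in hb; last by exact: mulr1.
have hn : 0 < `|h| by rewrite normr_gt0.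
rewrite -ler_pdivrMr // -normfV -normrM; apply: le_trans (ltW hb).
by rewrite distrC mulrBl mulfK // mulrC lexx.
Qed.

Definition cisC t : R[i] := cos t +i* sin t.

Definition cexp u : R[i] := (expR (complex.Re u))%:C * cisC (complex.Im u).

Lemma normc_cisC t : normc (cisC t) = 1.
Proof. by rewrite /ComplexField.Normc.normc /cisC cos2Dsin2 sqrtr1. Qed.

Lemma cisCD s t : cisC (s + t) = cisC s * cisC t.
Proof. by rewrite /cisC cosD sinD; simpc; congr (_ +i* _); ring. Qed.

Lemma cisC0 : cisC 0 = 1.
Proof. by rewrite /cisC cos0 sin0. Qed.

Lemma cisC_2pi : cisC (2 * pi) = 1.
Proof. by rewrite /cisC mulr_natl cos2pi sin2pi. Qed.

Lemma cisC_neq0 t : cisC t != 0.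
Proof. by rewrite -normc_eq0 normc_cisC oner_neq0. Qed.

Lemma cisC_conj t : conjc (cisC t) = (cisC t)^-1.
Proof.
apply: (mulfI (cisC_neq0 t)); rewrite mulfV ?cisC_neq0 // /cisC; simpc.
by apply: complex_eqP => /=; [rewrite -!expr2 cos2Dsin2|ring].
Qed.

Lemma continuous_cisC : continuous (cisC : R -> R[i]).
Proof. by move=> t; apply: ccont_complex; [exact: continuous_cos|exact: continuous_sin]. Qed.

Lemma cexpD u w : cexp (u + w) = cexp u * cexp w.
Proof. by rewrite /cexp cReD cImD expRD cisCD rmorphM /= mulrACA. Qed.

Lemma cexp_near0 (e : R) : 0 < e -> exists2 d : R, 0 < d &
  forall h, normc h < d -> normc (cexp h - 1 - h) <= e * normc h.
Proof.
move=> e0; pose k := Num.min (e / 6) 1.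
have k0 : 0 < k by rewrite lt_min divr_gt0 //= ltr01.
have ke : k <= e / 6 by rewrite ge_min lexx.
have k1 : k <= 1 by rewrite ge_min lexx orbT.
have [d1 d10 h1] := is_derive_eps (is_derive_expR 0) k0.
have [d2 d20 h2] := is_derive_eps (is_derive_cos 0) k0.
have [d3 d30 h3] := is_derive_eps (is_derive_sin 0) k0.
exists (Num.min (Num.min d1 d2) (Num.min d3 (k / 2))).
  by rewrite !lt_min d10 d20 d30 divr_gt0.
move=> [a b]; rewrite !lt_min => /andP[/andP[n1 n2] /andP[n3 n4]].
have na : `|a| <= normc (a +i* b) by exact: (abs_Re_le (a +i* b)).
have nb : `|b| <= normc (a +i* b) by exact: (abs_Im_le (a +i* b)).
set n := normc _ in n1 n2 n3 n4 na nb *.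
have n0 : 0 <= n by exact: normc_ge0.
have /h1 := le_lt_trans na n1; rewrite addr0 expR0 mul1r => e1.
have /h2 := le_lt_trans nb n2; rewrite addr0 cos0 sin0 oppr0 mul0r subr0 => e2.
have /h3 := le_lt_trans nb n3; rewrite addr0 cos0 sin0 mul1r subr0 => e3.
have ea : `|expR a - 1| <= k.
  rewrite -(subrK a (expR a - 1)); apply: (le_trans (ler_normD _ _)).
  have : k * `|a| <= `|a| by rewrite ler_piMl.
  by lra.
have ea2 : expR a <= 2 by move: ea; rewrite ler_norml => /andP[_]; lra.
(* Error of the real exponential, errors of cosine and sine scaled by e^a <= 2, and the cross term i
   b (e^a - 1); their shares are e/6, 4e/6 and e/6. *)
rewrite (_ : _ - _ = (expR a - 1 - a)%:C + (expR a)%:C * ((cos b - 1) +i* (sin b - b)) +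
   'i * (b * (expR a - 1))%:C); last first.
  rewrite /cexp /cisC /=; apply: complex_eqP; rewrite ?cReD ?cImD ?cReM ?cImM /=; ring.
apply: (le_trans (le_normcD _ _)).
have -> : e * n = (e / 6) * n + 2 * (2 * (e / 6) * n) + (e / 6) * n by field.
apply: lerD; first (apply: (le_trans (le_normcD _ _)); apply: lerD).
- by rewrite normc_real (le_trans e1) // ler_pM // ltW.
- rewrite normcM normc_real ger0_norm ?expR_ge0 // ler_pM ?expR_ge0 ?normc_ge0 //.
  apply: (le_trans (normc_complex_le _ _)).
  have -> : 2 * (e / 6) * n = e / 6 * n + e / 6 * n by ring.
  by apply: lerD; [apply: (le_trans e2)|apply: (le_trans e3)]; rewrite ler_pM // ltW.
- rewrite normcM normc_i mul1r normc_real normrM mulrC ler_pM //.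
  exact: le_trans ea ke.
Qed.

Lemma cder_cexp u : cder cexp u (cexp u).
Proof.
move=> e e0; have n0 : 0 < 1 + normc (cexp u) by rewrite ltr_pwDl // normc_ge0.
have [d d0 hd] := cexp_near0 (divr_gt0 e0 n0).
exists d => // w wd.
rewrite (_ : _ - _ = cexp u * (cexp (w - u) - 1 - (w - u))); last first.
  have -> : cexp w = cexp u * cexp (w - u) by rewrite -cexpD subrKC.
  by ring.
rewrite normcM.
apply: (le_trans (ler_wpM2l (normc_ge0 _) (hd _ wd))).
rewrite mulrA ler_wpM2r ?normc_ge0 // mulrCA ler_piMr ?(ltW e0) //.
by rewrite ler_pdivrMr // mul1r lerDr.
Qed.

End ComplexExponential.

(** * Means over circles *)

Section CircleMeans.
Context {R : realType}.
Local Notation lam := (@lebesgue_measure R).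
Implicit Types (H : R[i] -> R[i]) (r x : R) (z w : R[i]).

Definition circle_int H r : R[i] := cint lam `[0, 2 * pi] (fun t => H (r%:C * cisC t)).

Lemma normc_rcis r t : normc (r%:C * cisC t) = `|r|.
Proof. by rewrite normcM normc_real normc_cisC mulr1. Qed.

Lemma cintegrable_circle H r : (forall w, normc w = `|r| -> {for w, continuous H}) ->
  cintegrable lam `[0, 2 * pi] (fun t => H (r%:C * cisC t)).
Proof.
move=> cH; apply/cintegrable_continuous/within_pointwise_continuous => t _.
exact: (ccont_comp (f := fun t => r%:C * cisC t) (ccontM ccont_cst (@continuous_cisC R t))
  (cH _ (normc_rcis _ _))).
Qed.

(** In logarithmic coordinates the annulus is a rectangle of height 2 pi. Goursat's theorem applies
    to [H \o cexp]; the horizontal sides cancel by periodicity, which leaves i times the difference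
    of the two circle integrals. *)
Lemma circle_int_const H r1 r2 : 0 < r1 -> r1 <= r2 ->
  (forall w, r1 <= normc w <= r2 -> exists l, cder H w l) ->
  circle_int H r1 = circle_int H r2.
Proof.
move=> r10 r12 dH; have r20 := lt_le_trans r10 r12.
have pi0 : 0 <= 2 * pi :> R by rewrite mulr_ge0 // pi_ge0.
have Hexp r y : 0 < r -> H (cexp (ln r +i* y)) = H (r%:C * cisC y).
  by move=> r0; rewrite /cexp /= lnK.
have nexp x y : ln r1 <= x <= ln r2 -> r1 <= normc (cexp (x +i* y)) <= r2.
  rewrite /cexp /= normc_rcis ger0_norm ?expR_ge0 // => /andP[h1 h2].
  by apply/andP; split; [rewrite -(lnK r10)|rewrite -(lnK r20)]; rewrite ler_expR.
have l12 : ln r1 <= ln r2 by rewrite ler_ln.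
have dF x y : ln r1 <= x <= ln r2 -> 0 <= y <= 2 * pi ->
    exists l, cder (H \o cexp) (x +i* y) l.
  move=> hx _; have [l hl] := dH _ (nexp x y hx).
  by exists (l * cexp (x +i* y)); apply: cder_comp hl; exact: cder_cexp.
have := goursat l12 pi0 dF; rewrite /rect_int.
rewrite [X in X + _](_ : _ = 0) ?add0r; last first.
  rewrite -[RHS](cint0 lam `[ln r1, ln r2]); apply: eq_cint => x _ /=.
  by rewrite /cexp /= cisC0 cisC_2pi subrr.
move=> /eqP; rewrite mulf_eq0 => /orP[/eqP[] /eqP|]; first by rewrite oner_eq0.
have cH r : r1 <= r <= r2 -> cintegrable lam `[0, 2 * pi] (fun t => H (r%:C * cisC t)).
  move=> /andP[h1 h2]; apply: cintegrable_circle => w wr.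
  have [|l /cder_continuous//] := dH w.
  by rewrite wr ger0_norm ?h1 ?h2 // (le_trans (ltW r10)).
rewrite (_ : cint _ _ _ = circle_int H r2 - circle_int H r1); last first.
  rewrite -cintB //; first by apply: eq_cint => y _ /=; rewrite !Hexp.
  - by apply: cH; rewrite lexx r12.
  - by apply: cH; rewrite lexx r12.
by rewrite subr_eq0 => /eqP.
Qed.

Lemma compact_disc r : compact [set w : R[i] | normc w <= r].
Proof.
pose sq := `[- r, r]%classic `*` `[- r, r]%classic : set (R * R).
pose e (p : R * R) : R[i] := p.1 +i* p.2.
have ce : continuous e.
  by move=> p; apply: ccont_complex; [exact: cvg_fst|exact: cvg_snd].
apply: (@subclosed_compact _ _ (e @` sq)).
- apply: (@closed_comp _ _ (@ComplexField.Normc.normc R) [set x | x <= r]).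
    by move=> w _; exact: continuous_normc.
  exact: closed_le.
- apply: continuous_compact; first exact: continuous_subspaceT.
  by apply: compact_setX; exact: segment_compact.
- move=> [a b] /= hr; exists (a, b) => //; split; rewrite /= in_itv /= -ler_norml.
    exact: le_trans (abs_Re_le (a +i* b)) hr.
  exact: le_trans (abs_Im_le (a +i* b)) hr.
Qed.

Lemma compact_bounded_normc (K : set R[i]) H : compact K -> {within K, continuous H} ->
  exists2 B : R, 0 <= B & forall w, K w -> normc (H w) <= B.
Proof.
move=> cK cH.
have cN : {within K, continuous (fun w => normc (H w))}.
  by move=> w; apply: continuous_comp; [exact: cH|exact: continuous_normc].
have [M [_ hM]] := compact_bounded (continuous_compact cN cK).
exists (`|M| + 1); first by rewrite addr_ge0.
move=> w Kw; have MM : M < `|M| + 1 by rewrite (le_lt_trans (ler_norm M)) // ltrDl.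
have hw : [set normc (H w) | w in K] (normc (H w)) by exists w.
by have := hM _ MM _ hw; rewrite /= ger0_norm ?normc_ge0.
Qed.

Lemma disc_bounded H r : (forall w, normc w <= r -> {for w, continuous H}) ->
  exists2 B : R, 0 <= B & forall w, normc w <= r -> normc (H w) <= B.
Proof.
move=> cH; apply: (compact_bounded_normc (@compact_disc r)).
by apply: continuous_in_subspaceT => w; rewrite inE => /cH.
Qed.

(** Continuity under the integral sign: the integrand is dominated by a constant on a disc of radius
    [s] strictly between |r| and 1. *)
Lemma continuous_circle_int H r : `|r| < 1 -> (forall w, normc w < 1 -> {for w, continuous H}) ->
  {for r, continuous (circle_int H)}.
Proof.
move=> r1 cH; pose s := (`|r| + 1) / 2.
have rs : `|r| < s by rewrite /s; lra.
have s1 : s < 1 by rewrite /s; lra.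
have [B B0 hB] : exists2 B : R, 0 <= B & forall w, normc w <= s -> normc (H w) <= B.
  by apply: disc_bounded => w ws; apply: cH; apply: le_lt_trans ws s1.
have ns x t : - s < x < s -> normc (x%:C * cisC t) <= s.
  by rewrite normc_rcis => /andP[? ?]; rewrite ler_norml; lra.
have ci x : - s < x < s -> cintegrable lam `[0, 2 * pi] (fun t => H (x%:C * cisC t)).
  move=> hx; apply: cintegrable_circle => w wx; apply: cH; rewrite wx.
  by apply: le_lt_trans s1; rewrite -(normc_rcis x 0) ns.
have ct t x : - s < x < s -> {for x, continuous (fun x => H (x%:C * cisC t))}.
  move=> hx; apply: (ccont_comp (f := fun x => x%:C * cisC t)
    (ccontM (@continuous_real_complex R x) ccont_cst)).
  by apply: cH; apply: le_lt_trans s1; exact: ns.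
have rI : r \in (`]- s, s[%classic : set R).
  by rewrite inE /= in_itv /= -ltr_norml.
have main (P : R[i] -> R) : continuous P -> (forall w, `|P w| <= normc w) ->
    (forall x, - s < x < s -> lam.-integrable `[0, 2 * pi] (EFin \o (fun t => P (H (x%:C * cisC t))))) ->
    {for r, continuous (fun x => \int[lam]_(t in `[0, 2 * pi]) P (H (x%:C * cisC t)))}.
  move=> cP hP iP; apply: (@continuity_under_integral _ _ _ lam
    (fun x t => P (H (x%:C * cisC t))) _ _ (- s) s _ _ (cst B)) => //.
  - apply: aeW => t _ x; rewrite inE /= in_itv /= => hx.
    exact: (continuous_comp (ct t x hx) (cP _)).
  - by apply: finite_measure_integrable_cst_on || apply: (@integrable_bounded _ _ _ _ _ _ B) => //;
      [exact: lebesgue_itv_fin|move=> t _; rewrite ger0_norm].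
  - move=> x; rewrite /= in_itv /= => hx; apply: aeW => t _.
    by apply: (le_trans (hP _)); apply: hB; exact: ns.
apply: ccont_complex; apply: main => //.
- exact: continuous_Re.
- exact: abs_Re_le.
- by move=> x /ci[].
- exact: continuous_Im.
- exact: abs_Im_le.
- by move=> x /ci[].
Qed.

Lemma continuous_limit_point (phi : R -> R[i]) x0 c : {for x0, continuous phi} ->
  (forall d : R, 0 < d -> exists2 x, `|x - x0| < d & phi x = c) -> phi x0 = c.
Proof.
move=> /cvgcP h H; apply/eqP; rewrite -subr_eq0 -normc_eq0; apply/eqP/le_anti.
rewrite normc_ge0 andbT; apply/ler_addgt0Pr => e e0; rewrite add0r.
have /nbhs_ballP[d /= d0 hd] := h e e0.
have [x xd <-] := H d d0; apply/ltW/hd.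
by rewrite /ball /= distrC.
Qed.

(* Constancy of the circle means is only available on either side of the exceptional
   circle; continuity of the means carries it across, and down to the centre. *)
Lemma mean_value H rho r : 0 <= rho -> 0 <= r < 1 ->
  (forall w, normc w < 1 -> {for w, continuous H}) ->
  (forall w, normc w < 1 -> normc w != rho -> exists l, cder H w l) ->
  circle_int H r = H 0 * (2 * pi)%:C.
Proof.
move=> rho0 /andP[r0 r1] cH dH.
have cM x : 0 <= x < 1 -> {for x, continuous (circle_int H)}.
  by move=> /andP[x0 x1]; apply: continuous_circle_int => //; rewrite ger0_norm.
have <- : circle_int H 0 = H 0 * (2 * pi)%:C.
  rewrite -[in RHS](subr0 (2 * pi)) -(fine_lebesgue_itv (a := 0)) ?mulr_ge0 ?pi_ge0 //.
  by rewrite -cint_cst //; apply: eq_cint => t _; rewrite mul0r.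
have const x y : 0 < x -> x <= y -> y < 1 -> (y < rho) || (rho < x) ->
    circle_int H x = circle_int H y.
  move=> x0 xy y1 hrho; apply: circle_int_const => // w /andP[w1 w2].
  apply: dH; first exact: le_lt_trans w2 y1.
  apply/eqP => wr; move: hrho; rewrite -wr => /orP[]; lra.
(* Below [rho], or everywhere if [rho] is 0, the radius can shrink to 0 without meeting the
   exceptional circle. *)
have inner x : 0 < x < 1 -> (x < rho) || (rho <= 0) -> circle_int H x = circle_int H 0.
  move=> /andP[x0 x1] hx; apply/esym; apply: continuous_limit_point; first by apply: cM; rewrite lexx ltr01.
  move=> d d0; pose y := Num.min (d / 2) x.
  have y0 : 0 < y by rewrite lt_min x0 divr_gt0.
  have yx : y <= x by rewrite ge_min lexx orbT.
  have yd : y <= d / 2 by rewrite ge_min lexx.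
  exists y; first by rewrite subr0 gtr0_norm //; lra.
  by apply: const => //; case/orP: hx => [->//|h]; rewrite (le_lt_trans h y0) orbT.
have [->//|rn0] := eqVneq r 0.
have rp : 0 < r by rewrite lt_neqAle eq_sym rn0.
have [h|h] := boolP ((r < rho) || (rho <= 0)); first by apply: inner => //; rewrite rp.
move: h; rewrite negb_or -leNgt -ltNge => /andP[rhor rhop].
have rho1 : rho < 1 by exact: le_lt_trans rhor r1.
have Erho : circle_int H rho = circle_int H 0.
  apply: continuous_limit_point; first by apply: cM; rewrite rho0.
  move=> d d0; pose y := Num.max (rho / 2) (rho - d / 2).
  have y1 : rho / 2 <= y by rewrite le_max lexx.
  have y2 : rho - d / 2 <= y by rewrite le_max lexx orbT.
  have y3 : y < rho by rewrite gt_max; lra.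
  exists y; first by rewrite ltr_norml; lra.
  by apply: inner; rewrite ?y3 //; lra.
rewrite -Erho; apply/esym; have [->//|nr] := eqVneq rho r.
have rr : rho < r by rewrite lt_neqAle nr.
apply: continuous_limit_point; first by apply: cM; rewrite rho0.
move=> d d0; pose y := Num.min r (rho + d / 2).
have y1 : y <= r by rewrite ge_min lexx.
have y2 : y <= rho + d / 2 by rewrite ge_min lexx orbT.
have y3 : rho < y by rewrite lt_min rr; lra.
exists y; first by rewrite ltr_norml; lra.
by apply: const => //; [lra|rewrite y3 orbT].
Qed.

End CircleMeans.

(** * Fourier coefficients, Cauchy's formula and power series expansions *)

Section PowerSeries.
Context {R : realType}.
Local Notation lam := (@lebesgue_measure R).
Local Notation circ := (`[0, 2 * pi]%classic : set R).
Implicit Types (f : R[i] -> R[i]) (a c : nat -> R[i]) (r rho q K B t : R) (z w : R[i]).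

Lemma two_pi_gt0 : 0 < 2 * pi :> R.
Proof. by rewrite mulr_gt0 // pi_gt0. Qed.

Lemma two_pi_neq0 : (2 * pi)%:C != 0 :> R[i].
Proof. by rewrite -normc_eq0 normc_real normr_eq0 gt_eqF // two_pi_gt0. Qed.

Lemma cintegrable_circ (u : R -> R[i]) : continuous u -> cintegrable lam circ u.
Proof. by move=> cu; apply/cintegrable_continuous/continuous_subspaceT. Qed.

Lemma normc_cint_circ (u : R -> R[i]) B : continuous u -> (forall t, normc (u t) <= B) ->
  normc (cint lam circ u) <= 2 * B * (2 * pi).
Proof.
move=> cu hB; have -> : 2 * B * (2 * pi) = 2 * B * (2 * pi - 0) by rewrite subr0.
apply: normc_cint_itv_le => //.
  exact: ltW two_pi_gt0.
exact: cintegrable_circ.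
Qed.

Lemma cint_circ_cst (z : R[i]) : cint lam circ (fun=> z) = z * (2 * pi)%:C.
Proof.
by rewrite cint_cst // fine_lebesgue_itv ?subr0 // ltW // two_pi_gt0.
Qed.

Lemma continuous_cisX n : continuous (fun t => cisC t ^+ n : R[i]).
Proof. by move=> t; exact: (ccontX (@continuous_cisC R t)). Qed.

Lemma continuous_cisV n : continuous (fun t => (cisC t)^-1 ^+ n : R[i]).
Proof. by move=> t; exact: (ccontX (ccontV (@continuous_cisC R t) (cisC_neq0 t))). Qed.

Lemma cder_exp n z : exists l, cder (fun w => w ^+ n) z l.
Proof.
elim: n => [|n [l IH]]; first by exists 0; exact: cder_cst.
exists (1 * z ^+ n + z * l); rewrite (_ : (fun w => _) = (fun w => id w * w ^+ n)).
  exact: cderM (cder_id z) IH.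
by apply/funext => w; rewrite exprS.
Qed.

(** The mean of a positive power over a circle about 0 is its value at the centre, which is 0; the
    radius 1/2 stays inside the unit disc, where [mean_value] applies. *)
Lemma cint_cisX n : cint lam circ (fun t => cisC t ^+ n) = if n is 0%N then (2 * pi)%:C else 0.
Proof.
case: n => [|n]; first by rewrite cint_circ_cst mul1r.
have h2 : 0 <= (2^-1 : R) < 1 by rewrite invr_ge0 ler0n invf_lt1 ?ltr0n // ltr1n.
have dH w : exists l, cder (fun w : R[i] => w ^+ n.+1) w l by exact: cder_exp.
have := @mean_value R (fun w => w ^+ n.+1) 0 2^-1 (lexx _) h2.
rewrite expr0n mul0r /circle_int.
rewrite (_ : cint _ _ _ = (2^-1)%:C ^+ n.+1 * cint lam circ (fun t => cisC t ^+ n.+1)); last first.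
  rewrite -cintZ //; first by apply: eq_cint => t _; rewrite exprMn.
  by apply: cintegrable_circ; exact: continuous_cisX.
move=> H; have /eqP := H (fun w _ => cder_continuous (projT2 (cid (dH w)))) (fun w _ _ => dH w).
rewrite mulf_eq0 expf_eq0 /= => /orP[/eqP[] /eqP|/eqP //].
by rewrite invr_eq0 pnatr_eq0.
Qed.

Lemma cisX_conj n t : conjc (cisC t ^+ n : R[i]) = (cisC t)^-1 ^+ n.
Proof. by rewrite cconjX cisC_conj. Qed.

Lemma cint_cisV n : cint lam circ (fun t => (cisC t)^-1 ^+ n) =
  if n is 0%N then (2 * pi)%:C else 0.
Proof.
rewrite (_ : cint _ _ _ = conjc (cint lam circ (fun t => cisC t ^+ n))).
  by rewrite cint_cisX; case: n => [|n]; rewrite ?conjc_real // conjc0.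
rewrite -cint_conj //; first by apply: eq_cint => t _; rewrite cisX_conj.
by apply: cintegrable_circ; exact: continuous_cisX.
Qed.

Lemma cint_cisXV n k : cint lam circ (fun t => cisC t ^+ n * (cisC t)^-1 ^+ k) =
  if n == k then (2 * pi)%:C else 0.
Proof.
have [kn|nk|->] := ltngtP n k.
- rewrite (_ : cint _ _ _ = cint lam circ (fun t => (cisC t)^-1 ^+ (k - n))).
    by rewrite cint_cisV -(ltn_predK (_ : 0 < k - n)%N) ?subn_gt0 //; case: (k - n)%N (subn_gt0 n k) => //; rewrite kn.
  apply: eq_cint => t _; rewrite -{1}(subnK (ltnW kn)) exprD mulrCA -exprMn mulfV ?cisC_neq0 //.
  by rewrite expr1n mulr1.
- rewrite (_ : cint _ _ _ = cint lam circ (fun t => cisC t ^+ (n - k))).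
    by rewrite cint_cisX; case: (n - k)%N (subn_gt0 k n) => //; rewrite nk.
  apply: eq_cint => t _; rewrite -{1}(subnK (ltnW nk)) exprD -mulrA -exprMn mulfV ?cisC_neq0 //.
  by rewrite expr1n mulr1.
- rewrite (_ : cint _ _ _ = cint lam circ (fun=> 1)); first by rewrite cint_circ_cst mul1r.
  by apply: eq_cint => t _; rewrite -exprMn mulfV ?cisC_neq0 // expr1n.
Qed.

Lemma continuous_trig_poly N c : continuous (fun t => \sum_(n < N) c n * cisC t ^+ n : R[i]).
Proof.
by move=> t; exact: (ccont_sum (fun n : 'I_N => ccontM ccont_cst (@continuous_cisX n t))).
Qed.

Lemma cint_trig_poly N c k : (k < N)%N ->
  cint lam circ (fun t => (\sum_(n < N) c n * cisC t ^+ n) * (cisC t)^-1 ^+ k) = c k * (2 * pi)%:C.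
Proof.
move=> kN.
have ci (n : 'I_N) : cintegrable lam circ (fun t => c n * (cisC t ^+ n * (cisC t)^-1 ^+ k)).
  apply: cintegrable_circ => t.
  exact: (ccontM ccont_cst (ccontM (@continuous_cisX n t) (@continuous_cisV k t))).
rewrite (_ : cint _ _ _ = cint lam circ
   (fun t => \sum_(n < N) c n * (cisC t ^+ n * (cisC t)^-1 ^+ k))); last first.
  by apply: eq_cint => t _; rewrite mulr_suml; apply: eq_bigr => n _; rewrite mulrA.
rewrite cint_sum // (bigD1 (Ordinal kN)) //= big1 ?addr0.
  rewrite cintZ // ?cint_cisXV ?eqxx //.
  apply: cintegrable_circ => t; exact: (ccontM (@continuous_cisX k t) (@continuous_cisV k t)).
move=> n nk; rewrite cintZ // ?cint_cisXV; last first.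
  apply: cintegrable_circ => t; exact: (ccontM (@continuous_cisX n t) (@continuous_cisV k t)).
by rewrite ifN ?mulr0 //; move: nk; rewrite -val_eqE.
Qed.

Lemma trig_poly_coef_le N c k B : (k < N)%N ->
  (forall t, normc (\sum_(n < N) c n * cisC t ^+ n) <= B) -> normc (c k) <= 2 * B.
Proof.
move=> kN hB; have p0 := two_pi_gt0.
rewrite -(ler_pM2r p0) -{1}(ger0_norm (ltW p0)) -normc_real -normcM -(cint_trig_poly c kN).
apply: normc_cint_circ => [t|t].
  exact: (ccontM (@continuous_trig_poly N c t) (@continuous_cisV k t)).
by rewrite normcM normcX normcV normc_cisC invr1 expr1n mulr1.
Qed.

(* For power series, uniform convergence on smaller discs is always geometric. *)
Definition has_ps f a := forall rho, 0 < rho < 1 -> exists K, exists q,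
  [/\ 0 <= K, 0 <= q < 1 & forall z, normc z <= rho ->
    forall N, normc (f z - \sum_(n < N) a n * z ^+ n) <= K * q ^+ N].

(** Once a partial sum has more than [k] terms, its k-th term on the circle of radius [r] is at most
    twice its supremum there, which tends to 0. *)
Lemma ps_coef_eq0 c r K q : 0 < r -> 0 <= q < 1 -> 0 <= K ->
  (forall z, normc z <= r -> forall N, normc (\sum_(n < N) c n * z ^+ n) <= K * q ^+ N) ->
  forall k, c k = 0.
Proof.
move=> r0 hq K0 hc k.
have h n : normc (c k * r%:C ^+ k) <= 2 * K * q ^+ k.+1 * q ^+ n.
  have kN : (k < k.+1 + n)%N by rewrite leq_addr.
  have := @trig_poly_coef_le _ (fun n => c n * r%:C ^+ n) k (K * q ^+ (k.+1 + n)) kN.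
  rewrite exprD !mulrA; apply => t.
  have := hc (r%:C * cisC t) _ (k.+1 + n)%N; rewrite normc_rcis gtr0_norm // lexx => /(_ isT).
  rewrite exprD mulrA; apply: le_trans; rewrite le_eqVlt; apply/orP; left; apply/eqP.
  by congr normc; apply: eq_bigr => j _; rewrite exprMn mulrA.
have Kk : 0 <= 2 * K * q ^+ k.+1.
  by rewrite !mulr_ge0 ?exprn_ge0 //; case/andP: hq.
have /eqP := le_geometric_eq0 hq Kk h.
rewrite mulf_eq0 expf_eq0 => /orP[/eqP //|/andP[_ /eqP[] /eqP]].
by rewrite gt_eqF.
Qed.

Lemma exprn_le_max q q' N : 0 <= q -> 0 <= q' -> q ^+ N <= Num.max q q' ^+ N.
Proof. by move=> q0 q'0; rewrite lerXn2r ?nnegrE ?le_max ?lexx ?q0. Qed.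

Lemma ps_coef_unique f a c r K q K' q' : 0 < r ->
  0 <= q < 1 -> 0 <= K -> 0 <= q' < 1 -> 0 <= K' ->
  (forall z, normc z <= r -> forall N, normc (f z - \sum_(n < N) a n * z ^+ n) <= K * q ^+ N) ->
  (forall z, normc z <= r -> forall N, normc (f z - \sum_(n < N) c n * z ^+ n) <= K' * q' ^+ N) ->
  a =1 c.
Proof.
move=> r0 /andP[q0 q1] K0 /andP[q'0 q'1] K'0 ha hc k.
apply/eqP; rewrite -subr_eq0; apply/eqP.
apply: (@ps_coef_eq0 (fun n => a n - c n) r (K + K') (Num.max q q')) => //.
- by rewrite le_max q0 gt_max q1 q'1.
- exact: addr_ge0.
move=> z zr N; have -> : \sum_(n < N) (a n - c n) * z ^+ n =
    (f z - \sum_(n < N) c n * z ^+ n) - (f z - \sum_(n < N) a n * z ^+ n).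
  rewrite (_ : \sum_(n < N) _ = \sum_(n < N) a n * z ^+ n - \sum_(n < N) c n * z ^+ n).
    by ring.
  by rewrite -sumrB; apply: eq_bigr => n _; rewrite mulrBl.
apply: (le_trans (ler_normcB _ _)); rewrite mulrDl addrC.
apply: lerD; [apply: (le_trans (ha z zr N))|apply: (le_trans (hc z zr N))]; rewrite ler_wpM2l //.
  exact: exprn_le_max.
by rewrite maxC; exact: exprn_le_max.
Qed.

Lemma has_ps_unique f a c : has_ps f a -> has_ps f c -> a =1 c.
Proof.
move=> ha hc; have h2 : 0 < (2^-1 : R) < 1 by rewrite invr_gt0 ltr0n invf_lt1 ?ltr0n // ltr1n.
have [K [q [K0 hq hK]]] := ha _ h2; have [K' [q' [K'0 hq' hK']]] := hc _ h2.
by apply: (ps_coef_unique (r := 2^-1)) hK hK' => //; case/andP: h2.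
Qed.

Lemma geometric_sum (z : R[i]) N : z != 1 ->
  (1 - z)^-1 - \sum_(n < N) z ^+ n = z ^+ N / (1 - z).
Proof.
move=> z1; have z1' : 1 - z != 0 by rewrite subr_eq0 eq_sym.
apply: (mulIf z1'); rewrite mulrBl mulVf // divfK //.
have := subrX1 z N; rewrite mulrC => H.
have -> : (\sum_(n < N) z ^+ n) * (1 - z) = - (z ^+ N - 1) by rewrite H; ring.
by ring.
Qed.

(** The geometric series of the Cauchy kernel is integrated together with its remainder. The density
    [u] is arbitrary because both sides of [cauchy_formula] get expanded, one with [f] and the other
    with the constant 1. *)
Lemma cauchy_kernel_expansion (u : R -> R[i]) B rho r z N : continuous u ->
  (forall t, normc (u t) <= B) -> 0 <= rho -> rho < r -> normc z <= rho ->
  normc (cint lam circ (fun t => u t / (1 - z / (r%:C * cisC t))) -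
    \sum_(n < N) z ^+ n * cint lam circ (fun t => u t * (r%:C * cisC t)^-1 ^+ n)) <=
  2 * B * (1 - rho / r)^-1 * (2 * pi) * (rho / r) ^+ N.
Proof.
move=> cu uB rho0 rr zr; have r0 := le_lt_trans rho0 rr.
have w0 t : r%:C * cisC t != 0 by rewrite -normc_eq0 normc_rcis normr_eq0 gt_eqF.
have nz t : normc (z / (r%:C * cisC t)) <= rho / r.
  by rewrite normcM normcV normc_rcis gtr0_norm // ler_wpM2r // invr_ge0 ltW.
have q1 : rho / r < 1 by rewrite ltr_pdivrMr // mul1r.
have n1 t : z / (r%:C * cisC t) != 1.
  by apply/eqP => h; have := nz t; rewrite h normc1 leNgt q1.
have n1' t : 1 - z / (r%:C * cisC t) != 0 by rewrite subr_eq0 eq_sym.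
have cw t : {for t, continuous (fun t => (r%:C * cisC t)^-1)}.
  exact: (ccontV (ccontM ccont_cst (@continuous_cisC R t)) (w0 t)).
have ck t : {for t, continuous (fun t => 1 - z / (r%:C * cisC t))}.
  exact: (ccontB ccont_cst (ccontM ccont_cst (cw t))).
have c1 : continuous (fun t => u t / (1 - z / (r%:C * cisC t))).
  move=> t; exact: (ccontM (cu t) (ccontV (ck t) (n1' t))).
have c2 n : continuous (fun t => u t * (r%:C * cisC t)^-1 ^+ n).
  by move=> t; exact: (ccontM (cu t) (ccontX (cw t))).
rewrite (_ : _ - _ = cint lam circ (fun t => u t * ((z / (r%:C * cisC t)) ^+ N /
    (1 - z / (r%:C * cisC t))))).
  have -> : 2 * B * (1 - rho / r)^-1 * (2 * pi) * (rho / r) ^+ N =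
    2 * (B * ((rho / r) ^+ N / (1 - rho / r))) * (2 * pi) by ring.
  apply: normc_cint_circ => [t|t].
    exact: (ccontM (cu t) (ccontM (ccontX (ccontM ccont_cst (cw t))) (ccontV (ck t) (n1' t)))).
  rewrite normcM; apply: ler_pM; rewrite ?normc_ge0 //.
  rewrite normcM; apply: ler_pM; rewrite ?normc_ge0 // ?normcX ?normcV.
    by rewrite lerXn2r ?nnegrE ?normc_ge0 // divr_ge0 // ltW.
  rewrite lef_pV2 ?posrE ?subr_gt0 // ?normc_gt0 //.
  by apply: le_trans (lerB_normc _ _); rewrite normc1 lerD2l lerN2.
have -> : \sum_(n < N) z ^+ n * cint lam circ (fun t => u t * (r%:C * cisC t)^-1 ^+ n) =
    cint lam circ (fun t => \sum_(n < N) z ^+ n * (u t * (r%:C * cisC t)^-1 ^+ n)).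
  rewrite cint_sum //.
    by apply: eq_bigr => n _; rewrite cintZ //; apply: cintegrable_circ; exact: c2.
  by move=> n; apply: cintegrableZ => //; apply: cintegrable_circ; exact: c2.
rewrite -cintB //; last 2 first.
- exact: cintegrable_circ.
- apply: cintegrable_circ => t; exact: (ccont_sum (fun n : 'I_N => ccontM ccont_cst (c2 n t))).
apply: eq_cint => t _; rewrite -(geometric_sum N (n1 t)) mulrBr; congr (_ - _).
by rewrite mulr_sumr; apply: eq_bigr => n _; rewrite exprMn mulrCA.
Qed.

(* The mean value property for [w |-> w (f w - f z) / (w - z)], which vanishes at 0 and is
   differentiable off the circle [|w| = |z|]. *)
Lemma cauchy_formula f rho r z : analytic f -> rho < r -> r < 1 -> normc z <= rho ->
  cint lam circ (fun t => f (r%:C * cisC t) / (1 - z / (r%:C * cisC t))) =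
  f z * cint lam circ (fun t => (1 - z / (r%:C * cisC t))^-1).
Proof.
move=> af rr r1 zr; have r0 : 0 < r := le_lt_trans (normc_ge0 z) (le_lt_trans zr rr).
have z1 : normc z < 1 := le_lt_trans zr (lt_trans rr r1).
have df w : normc w < 1 -> cder f w (derive1 f w).
  by move=> /discE/af/derivable_cder.
(* The derivative as value at [z] makes [Q] continuous there; differentiability is established only
   away from [z], whence the exceptional circle in [mean_value]. *)
pose Q w := if w == z then derive1 f z else (f w - f z) / (w - z).
pose H w := w * Q w.
have dQ w : normc w < 1 -> w != z -> exists l, cder Q w l.
  move=> w1 wz; have wz0 : w - z != 0 by rewrite subr_eq0.
  have D1 := cderD (df w w1) (cder_cst (- f z) w).
  have D2 := cder_comp (cderD (cder_id w) (cder_cst (- z) w)) (cder_inv wz0).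
  have D := cderM D1 D2; eexists.
  apply: (cder_local (r := normc (w - z)) _ _ D); first by rewrite normc_gt0; exact: wz0.
  by move=> v hv; rewrite /Q ifN //; apply/eqP => vz; move: hv; rewrite vz normcB ltxx.
have cQ w : normc w < 1 -> {for w, continuous Q}.
  move=> w1; have [->|/(dQ w w1)[l /cder_continuous //]] := eqVneq w z.
  apply/cvgc_atP => e e0; have [d d0 hd] := df z z1 (e / 2) (divr_gt0 e0 (ltr0Sn _ _)).
  exists d => // v vd; rewrite /Q eqxx; have [_|vz] := eqVneq v z.
    by rewrite subrr normc0.
  have vz0 : 0 < normc (v - z) by rewrite normc_gt0 subr_eq0.
  have := hd v vd; rewrite -(ler_pdivrMr _ _ vz0) -normcV -normcM mulrBl mulfK -?normc_gt0 //.
  by move=> h; apply: le_lt_trans h _; lra.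
have dH w : normc w < 1 -> normc w != normc z -> exists l, cder H w l.
  move=> w1 wz; have [|l Hl] := dQ w w1; first by apply/eqP => h; move: wz; rewrite h eqxx.
  by eexists; exact: cderM (cder_id w) Hl.
have cH w : normc w < 1 -> {for w, continuous H}.
  by move=> w1; exact: (ccontM cvg_id (cQ w w1)).
have := mean_value (normc_ge0 z) _ cH dH => /(_ r); rewrite (ltW r0) r1 => /(_ isT).
rewrite {2}/H mul0r mul0r /circle_int.
have w0 t : r%:C * cisC t != 0 by rewrite -normc_eq0 normc_rcis normr_eq0 gt_eqF.
have nw t : normc (r%:C * cisC t) = r by rewrite normc_rcis gtr0_norm.
have wz t : r%:C * cisC t != z.
  by apply/eqP => h; move: zr; rewrite -h nw leNgt rr.
have n1' t : 1 - z / (r%:C * cisC t) != 0.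
  rewrite -(mulfV (w0 t)) -mulrBl mulf_neq0 ?invr_eq0 ?w0 // subr_eq0; exact: wz.
have cw t : {for t, continuous (fun t => r%:C * cisC t)}.
  exact: (ccontM ccont_cst (@continuous_cisC R t)).
have ck t : {for t, continuous (fun t => (1 - z / (r%:C * cisC t))^-1)}.
  exact: (ccontV (ccontB ccont_cst (ccontM ccont_cst (ccontV (cw t) (w0 t)))) (n1' t)).
have cf t : {for t, continuous (fun t => f (r%:C * cisC t))}.
  by apply: (ccont_comp (cw t)); apply: cder_continuous (df _ _); rewrite nw.
rewrite -cintZ //; last by apply: cintegrable_circ; exact: ck.
move=> h0; apply/eqP; rewrite -subr_eq0 -cintB //; last 2 first.
- by apply: cintegrable_circ => t; exact: (ccontM (cf t) (ck t)).
- by apply: cintegrable_circ => t; exact: (ccontM ccont_cst (ck t)).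
rewrite -[X in _ == X]h0; apply/eqP/eq_cint => t _.
(* On the circle w / (w - z) is 1 / (1 - z / w), so the vanishing mean of [H] is the difference of
   the two sides. *)
rewrite /H /Q ifN ?wz //.
have := wz t; have := w0 t; rewrite -(subr_eq0 _ z); set w := r%:C * cisC t => hw hwz.
rewrite (_ : 1 - z / w = (w - z) / w); last by field.
by field; rewrite hw hwz.
Qed.

(** Cauchy's formula on the circle of radius halfway between [rho] and 1, with the kernel expanded.
    The coefficients found depend a priori on [rho]. *)
Lemma cauchy_local f rho : analytic f -> 0 < rho < 1 -> exists a, exists K, exists q,
  [/\ 0 <= K, 0 <= q < 1 & forall z, normc z <= rho ->
    forall N, normc (f z - \sum_(n < N) a n * z ^+ n) <= K * q ^+ N].
Proof.
move=> af /andP[rho0 rho1]; pose r := (1 + rho) / 2.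
have rr : rho < r by rewrite /r; lra.
have r1 : r < 1 by rewrite /r; lra.
have r0 := lt_trans rho0 rr; have pi0 := two_pi_gt0.
have nw t : normc (r%:C * cisC t) = r by rewrite normc_rcis gtr0_norm.
have cf w : normc w < 1 -> {for w, continuous f}.
  by move=> /discE/af/derivable_cder/cder_continuous.
have [B B0 hB] : exists2 B : R, 0 <= B & forall w, normc w <= r -> normc (f w) <= B.
  by apply: disc_bounded => w wr; apply: cf; apply: le_lt_trans wr r1.
have cu : continuous (fun t => f (r%:C * cisC t)).
  move=> t; apply: (ccont_comp (f := fun t => r%:C * cisC t) (ccontM ccont_cst (@continuous_cisC R t))).
  by apply: cf; rewrite nw.
have uB t : normc (f (r%:C * cisC t)) <= B by apply: hB; rewrite nw.
pose A n := cint lam circ (fun t => f (r%:C * cisC t) * (r%:C * cisC t)^-1 ^+ n).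
have pC0 := two_pi_neq0.
have q0 : 0 <= rho / r by rewrite divr_ge0 // ltW.
have q1 : rho / r < 1 by rewrite ltr_pdivrMr // mul1r.
exists (fun n => A n / (2 * pi)%:C), (2 * B * (1 - rho / r)^-1), (rho / r); split.
- by rewrite !mulr_ge0 // invr_ge0 subr_ge0 ltW.
- by rewrite q0 q1.
move=> z zr N.
(* Positive powers of the inverse of [r%:C * cisC t] integrate to 0; the truncation order [n.+1]
   ensures that the constant term is present. *)
have one : cint lam circ (fun t => (1 - z / (r%:C * cisC t))^-1) = (2 * pi)%:C.
  apply/eqP; rewrite -subr_eq0; apply/eqP.
  apply: (@le_geometric_eq0 _ (rho / r) (2 * 1 * (1 - rho / r)^-1 * (2 * pi) * (rho / r))).
  - by rewrite q0 q1.
  - apply: mulr_ge0 => //; apply: mulr_ge0; last exact: ltW.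
    by rewrite mulr1 mulr_ge0 // invr_ge0 subr_ge0 ltW.
  move=> n; have := @cauchy_kernel_expansion (fun=> 1) 1 rho r z n.+1
    (fun t => ccont_cst) _ (ltW rho0) rr zr.
  rewrite normc1 lexx exprS mulrA => /(_ (fun=> isT)); apply: le_trans.
  rewrite le_eqVlt; apply/orP; left; apply/eqP; congr (normc (_ - _)).
    by apply: eq_cint => t _; rewrite mul1r.
  have cV k : cint lam circ (fun t => 1 * (r%:C * cisC t)^-1 ^+ k) =
      r%:C^-1 ^+ k * cint lam circ (fun t => (cisC t)^-1 ^+ k).
    have ci : cintegrable lam circ (fun t => (cisC t)^-1 ^+ k).
      by apply: cintegrable_circ; exact: continuous_cisV.
    transitivity (cint lam circ (fun t => r%:C^-1 ^+ k * (cisC t)^-1 ^+ k)); last by rewrite cintZ.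
    by apply: eq_cint => t _; rewrite mul1r invfM exprMn.
  rewrite big_ord_recl big1 ?addr0; first by rewrite cV cint_cisV !mul1r.
  by move=> i _; rewrite cV cint_cisV !mulr0.
have := @cauchy_kernel_expansion _ B rho r z N cu uB (ltW rho0) rr zr.
rewrite (cauchy_formula af rr r1 zr) one.
rewrite (_ : _ - _ = (2 * pi)%:C * (f z - \sum_(n < N) A n / (2 * pi)%:C * z ^+ n)).
  rewrite normcM normc_real gtr0_norm // => h.
  by rewrite -(ler_pM2l pi0); apply: (le_trans h); rewrite le_eqVlt; apply/orP; left; apply/eqP; ring.
rewrite mulrBr mulrC; congr (_ - _); rewrite mulr_sumr; apply: eq_bigr => n _.
by rewrite -/(A n) mulrA (mulrC (2 * pi)%:C) divfK // mulrC.
Qed.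

(** The coefficients found for radius 1/2 serve every radius: both expansions hold on the smaller of
    the two discs, so they agree. *)
Lemma analytic_has_ps f : analytic f -> exists a, has_ps f a.
Proof.
move=> af; have h2 : 0 < (2^-1 : R) < 1 by rewrite invr_gt0 ltr0n invf_lt1 ?ltr0n // ltr1n.
have [a [K [q [K0 hq hK]]]] := cauchy_local af h2; exists a => rho hrho.
have [a' [K' [q' [K'0 hq' hK']]]] := cauchy_local af hrho.
exists K', q'; split => // z zr N.
suff -> : \sum_(n < N) a n * z ^+ n = \sum_(n < N) a' n * z ^+ n by exact: hK'.
apply: eq_bigr => n _; congr (_ * _).
apply: (ps_coef_unique (f := f) (r := Num.min rho 2^-1) (K := K) (q := q) (K' := K') (q' := q')) => //.
- by case/andP: h2 => ? _; case/andP: hrho => ? _; rewrite lt_min; apply/andP.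
- by move=> v; rewrite le_min => /andP[_ /hK].
- by move=> v; rewrite le_min => /andP[/hK' + _].
Qed.

End PowerSeries.

(** * Functions given by power series *)

Section PowerSeriesFunctions.
Context {R : realType}.
Local Notation lam := (@lebesgue_measure R).
Implicit Types (f h : R[i] -> R[i]) (a c : nat -> R[i]) (r rho q K B t : R) (z w : R[i]).

Lemma disc_radius z : normc z < 1 -> exists2 rho, 0 < rho < 1 & normc z <= rho.
Proof. by move=> z1; have := normc_ge0 z; exists ((1 + normc z) / 2); lra. Qed.

(** At the real point [rho] the n-th term is the difference of two consecutive remainders. *)
Lemma ps_coef_le f a rho K q : 0 <= rho ->
  (forall z, normc z <= rho -> forall N, normc (f z - \sum_(n < N) a n * z ^+ n) <= K * q ^+ N) ->
  0 <= K -> 0 <= q < 1 -> forall n, normc (a n) * rho ^+ n <= 2 * K * q ^+ n.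
Proof.
move=> rho0 hK K0 /andP[q0 q1] n.
have rz : normc rho%:C <= rho by rewrite normc_real ger0_norm.
have := hK _ rz n; have := hK _ rz n.+1; rewrite big_ord_recr /=.
set S := \sum_(i < n) _ => h1 h2.
have -> : normc (a n) * rho ^+ n = normc ((f rho%:C - S) - (f rho%:C - (S + a n * rho%:C ^+ n))).
  rewrite (_ : _ - _ = a n * rho%:C ^+ n); last by ring.
  by rewrite normcM normcX normc_real ger0_norm.
apply: (le_trans (ler_normcB _ _)).
have : q ^+ n.+1 <= q ^+ n by rewrite exprS ler_piMl ?exprn_ge0 // ltW.
move=> /(ler_wpM2l K0); lra.
Qed.

Lemma has_ps_coef f a rho : has_ps f a -> 0 < rho < 1 -> exists2 K, 0 <= K &
  forall n, normc (a n) * rho ^+ n <= K.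
Proof.
move=> ha hr; have [K [q [K0 hq hK]]] := ha _ hr.
have /andP[r0 _] := hr; have /andP[q0 q1] := hq.
exists (2 * K); first by rewrite mulr_ge0.
move=> n; apply: (le_trans (ps_coef_le (ltW r0) hK K0 hq n)).
by rewrite ler_piMr ?mulr_ge0 // exprn_ile1 // ltW.
Qed.

Lemma sum_geometric_le q N : 0 <= q < 1 -> \sum_(n < N) q ^+ n <= (1 - q)^-1.
Proof.
move=> /andP[q0 q1]; rewrite -[leRHS]mul1r ler_pdivlMr ?subr_gt0 //.
have := subrX1 q N; set S := \sum_(i < N) _ => hS.
have -> : S * (1 - q) = 1 - q ^+ N by rewrite -[RHS]opprB hS; ring.
by rewrite gerBl exprn_ge0.
Qed.

Lemma real_series_sum (u : nat -> R) K q : 0 <= q < 1 -> (forall n, `|u n| <= K * q ^+ n) ->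
  forall N, `|limn (series u) - \sum_(n < N) u n| <= K / (1 - q) * q ^+ N.
Proof.
move=> hq hu; have /andP[q0 q1] := hq.
have K0 : 0 <= K by have := hu 0%N; rewrite mulr1; apply: le_trans.
have part M N : `|\sum_(n < N + M) u n - \sum_(n < N) u n| <= K / (1 - q) * q ^+ N.
  rewrite big_split_ord /= addrAC subrr add0r.
  apply: (le_trans (ler_norm_sum _ _ _)).
  apply: (@le_trans _ _ (\sum_(i < M) K * q ^+ N * q ^+ i)).
    by apply: ler_sum => i _; rewrite -mulrA -exprD; exact: hu.
  rewrite -mulr_sumr -mulrA [K / _ * _]mulrAC -mulrA.
  by rewrite ler_wpM2l // ler_wpM2l ?exprn_ge0 // sum_geometric_le.
have cv : cvgn (series u).
  apply: normed_cvg; apply: (@series_le_cvg _ _ (geometric K q)) => //.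
  - by move=> n; exact: normr_ge0.
  - by move=> n; rewrite /geometric /= mulr_ge0 ?exprn_ge0.
  - by apply: is_cvg_geometric_series; rewrite ger0_norm.
move=> N; apply/ler_addgt0Pr => e e0.
have /cvgrPdist_lt /(_ e e0) [M _ hM] := cv.
have := hM (N + M)%N (leq_addl _ _); rewrite /series /= big_mkord => h.
rewrite -(subrK (\sum_(n < N + M) u n) (limn _)) -addrA.
apply: (le_trans (ler_normD _ _)); rewrite [leRHS]addrC; apply: lerD; [exact: ltW|exact: part].
Qed.

(** Bounded terms at the larger radius (1 + rho) / 2 give convergence on the disc of radius [rho],
    with the quotient of the two radii as ratio. *)
Lemma has_ps_exists a : (forall rho, 0 < rho < 1 -> exists2 K, 0 <= K &
    forall n, normc (a n) * rho ^+ n <= K) -> exists f, has_ps f a.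
Proof.
move=> ha; exists (fun z => limn (series (fun n => complex.Re (a n * z ^+ n))) +i*
  limn (series (fun n => complex.Im (a n * z ^+ n)))) => rho /andP[r0 r1].
pose r := (1 + rho) / 2.
have rr : rho < r by rewrite /r; lra.
have hr : 0 < r < 1 by rewrite /r; lra.
have [K K0 hK] := ha r hr; have /andP[r'0 _] := hr.
have hq : 0 <= rho / r < 1 by rewrite divr_ge0 ?ltW // ltr_pdivrMr // mul1r.
exists (2 * K / (1 - rho / r)), (rho / r); split => //.
  by case/andP: hq => ? ?; rewrite !mulr_ge0 // invr_ge0 subr_ge0 ltW.
move=> z zr N.
have hc n : normc (a n * z ^+ n) <= K * (rho / r) ^+ n.
  rewrite normcM normcX expr_div_n mulrA ler_pdivlMr ?exprn_gt0 // mulrAC.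
  apply: ler_pM; rewrite ?mulr_ge0 ?normc_ge0 ?exprn_ge0 ?normc_ge0 // ?(ltW r'0) //.
  by rewrite lerXn2r ?nnegrE ?normc_ge0 // ltW.
have h1 := real_series_sum hq (fun n => le_trans (abs_Re_le (a n * z ^+ n)) (hc n)) N.
have h2 := real_series_sum hq (fun n => le_trans (abs_Im_le (a n * z ^+ n)) (hc n)) N.
apply: (le_trans (normc_le_ReIm _)); rewrite cReB cImB cRe_sum cIm_sum /=.
have -> : 2 * K / (1 - rho / r) * (rho / r) ^+ N =
  K / (1 - rho / r) * (rho / r) ^+ N + K / (1 - rho / r) * (rho / r) ^+ N by ring.
exact: lerD.
Qed.

(** The second-order remainder of a power satisfies a recurrence with nonnegative terms. It supplies
    the bound n d x^(n-1) <= (x + d)^n, which absorbs linear factors into a larger radius. *)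
Lemma bernoulli_power (x d : R) n : 0 <= x -> 0 <= d ->
  0 <= (x + d) ^+ n - x ^+ n - n%:R * d * x ^+ n.-1.
Proof.
move=> x0 d0; elim: n => [|n IH]; first by rewrite !expr0 subrr mul0r mul0r subr0.
case: n IH => [|n] IH; first by rewrite !expr1 expr0 mulr1; lra.
have -> : (x + d) ^+ n.+2 - x ^+ n.+2 - n.+2%:R * d * x ^+ n.+2.-1 =
  (x + d) * ((x + d) ^+ n.+1 - x ^+ n.+1 - n.+1%:R * d * x ^+ n.+1.-1) + n.+1%:R * d ^+ 2 * x ^+ n.
  by rewrite /= -[n.+2%:R]natr1 !exprS; ring.
apply: addr_ge0; first exact: mulr_ge0 (addr_ge0 x0 d0) IH.
by rewrite !mulr_ge0 ?exprn_ge0.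
Qed.

(** Complex and real remainders obey the same recurrence, so the real one dominates, with the
    quadratic dependence on [w] factored out. Its growth in [n] is that of (|z| + d)^n, which the
    coefficients can sum. *)
Lemma power_increment_le z w (d : R) n : 0 < d -> normc w <= d ->
  normc ((z + w) ^+ n - z ^+ n - n%:R * w * z ^+ n.-1) <=
  (normc w / d) ^+ 2 * ((normc z + d) ^+ n - normc z ^+ n - n%:R * d * normc z ^+ n.-1).
Proof.
move=> d0 wd; set x := normc z; have x0 : 0 <= x by exact: normc_ge0.
elim: n => [|n IH].
  by rewrite !expr0 subrr !mul0r subr0 normc0 mulr_ge0 ?sqr_ge0 // subrr subr0.
case: n IH => [|n] IH.
  rewrite !expr1 expr0 /= (_ : _ - _ = 0) ?normc0; last by ring.
  by rewrite mulr_ge0 ?sqr_ge0 //; lra.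
have -> : (z + w) ^+ n.+2 - z ^+ n.+2 - n.+2%:R * w * z ^+ n.+2.-1 =
  (z + w) * ((z + w) ^+ n.+1 - z ^+ n.+1 - n.+1%:R * w * z ^+ n.+1.-1) + n.+1%:R * w ^+ 2 * z ^+ n.
  by rewrite /= -[n.+2%:R]natr1 !exprS; ring.
have -> : (x + d) ^+ n.+2 - x ^+ n.+2 - n.+2%:R * d * x ^+ n.+2.-1 =
  (x + d) * ((x + d) ^+ n.+1 - x ^+ n.+1 - n.+1%:R * d * x ^+ n.+1.-1) + n.+1%:R * d ^+ 2 * x ^+ n.
  by rewrite /= -[n.+2%:R]natr1 !exprS; ring.
rewrite [leRHS]mulrDr; apply: (le_trans (le_normcD _ _)); apply: lerD.
  rewrite normcM mulrCA; apply: ler_pM; rewrite ?normc_ge0 //.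
  by apply: (le_trans (le_normcD _ _)); rewrite lerD2l.
rewrite [normc (_ * z ^+ n)]normcM [normc (_ * w ^+ 2)]normcM !normcX -/x normc_nat.
rewrite le_eqVlt; apply/orP; left; apply/eqP.
by field; rewrite lt0r_neq0.
Qed.

(** Termwise differentiation by the quadratic estimate |f (z + w) - f z - f' z w| <= M |w|^2, proved
    on partial sums up to an arbitrarily small truncation error. *)
Lemma has_ps_derivative f a : has_ps f a -> exists f',
  has_ps f' (fun n => n.+1%:R * a n.+1) /\ forall z, normc z < 1 -> cder f z (f' z).
Proof.
move=> ha.
have coef' rho : 0 < rho < 1 -> exists2 K, 0 <= K &
    forall n, normc (n.+1%:R * a n.+1) * rho ^+ n <= K.
  move=> /andP[r0 r1]; pose d := (1 - rho) / 2.
  have d0 : 0 < d by rewrite /d; lra.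
  have [|K K0 hK] := has_ps_coef (rho := rho + d) ha; first by rewrite /d; lra.
  exists (K / d); first by rewrite divr_ge0 // ltW.
  move=> n; rewrite ler_pdivlMr //; apply: le_trans (hK n.+1).
  rewrite normcM normc_nat.
  have -> : n.+1%:R * normc (a n.+1) * rho ^+ n * d =
    normc (a n.+1) * (n.+1%:R * d * rho ^+ n) by ring.
  rewrite ler_wpM2l ?normc_ge0 //.
  have := bernoulli_power n.+1 (ltW r0) (ltW d0); rewrite /=.
  by have := exprn_ge0 n.+1 (ltW r0); lra.
have [f' hf'] := has_ps_exists coef'; exists f'; split => // z z1 e e0.
pose d := (1 - normc z) / 2.
have n0 := normc_ge0 z.
have d0 : 0 < d by rewrite /d; lra.
have hr : 0 < normc z + d < 1 by rewrite /d; lra.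
have /andP[r0 r1] := hr.
have [K [q [K0 hq hK]]] := ha _ hr; have [K' [q' [K'0 hq' hK']]] := hf' _ hr.
have /andP[q0 q1] := hq; have /andP[q'0 q'1] := hq'.
(* The sum over n of |a_n| (|z| + d)^n <= 2 K q^n, divided by the d^2 of [power_increment_le]. *)
pose M := 2 * K / (1 - q) / d ^+ 2.
have M0 : 0 <= M by rewrite !mulr_ge0 ?invr_ge0 ?subr_ge0 ?exprn_ge0 // ltW.
have bound w : normc w <= d -> normc (f (z + w) - f z - f' z * w) <= M * normc w ^+ 2.
  move=> wd; apply/ler_addgt0Pr => e1 e10.
  pose qq := Num.max q q'.
  have hqq : 0 <= qq < 1 by rewrite /qq le_max gt_max q0 q1 q'1.
  (* The constant collects three truncation errors: of f at z + w, of f at z, and of f' at z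
     multiplied by |w|. *)
  have [N hN] := geometric_small hqq (addr_ge0 (addr_ge0 K0 K0) (mulr_ge0 K'0 (normc_ge0 w))) e10.
  have := hN N (leqnn N) => {}hN.
  have A1 := hK (z + w) (le_trans (le_normcD _ _) (lerD (lexx _) wd)) N.+1.
  have A2 := hK z (ltac:(rewrite lerDl; exact: ltW)) N.+1.
  have A3 := hK' z (ltac:(rewrite lerDl; exact: ltW)) N.
  set S1 := \sum_(n < N.+1) _ in A1; set S2 := \sum_(n < N.+1) _ in A2.
  set S3 := \sum_(n < N) _ in A3.
  have S4 : S1 - S2 - S3 * w = \sum_(n < N.+1) a n * ((z + w) ^+ n - z ^+ n - n%:R * w * z ^+ n.-1).
    rewrite /S1 /S2 /S3 -sumrB mulr_suml.
    rewrite [\sum_(i < N.+1) (_ - _)]big_ord_recl [RHS]big_ord_recl /=.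
    rewrite !expr0 !mulr1 !subrr !mul0r subr0 mulr0 !add0r -sumrB; apply: eq_bigr => n _.
    by rewrite /bump /= add1n; ring.
  have -> : f (z + w) - f z - f' z * w = (S1 - S2 - S3 * w) +
     ((f (z + w) - S1) - (f z - S2) - (f' z - S3) * w) by ring.
  apply: (le_trans (le_normcD _ _)); apply: lerD.
    rewrite S4; apply: (le_trans (ler_normc_sum _ _ _)).
    apply: (@le_trans _ _ (\sum_(n < N.+1) (normc w / d) ^+ 2 * (2 * K * q ^+ n))).
      apply: ler_sum => n _; rewrite normcM.
      have h1 := power_increment_le z n d0 wd.
      have h2 := ps_coef_le (ltW r0) hK K0 hq n.
      apply: (le_trans (ler_wpM2l (normc_ge0 _) h1)).
      rewrite mulrCA ler_wpM2l ?sqr_ge0 //; apply: le_trans h2.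
      rewrite ler_wpM2l ?normc_ge0 //.
      have p2 : 0 <= n%:R * d * normc z ^+ n.-1.
        exact: mulr_ge0 (mulr_ge0 (ler0n _ _) (ltW d0)) (exprn_ge0 _ n0).
      by move: p2 (exprn_ge0 n n0); clear; lra.
    rewrite -mulr_sumr -mulr_sumr expr_div_n /M.
    have -> : 2 * K / (1 - q) / d ^+ 2 * normc w ^+ 2 =
       normc w ^+ 2 / d ^+ 2 * (2 * K * (1 - q)^-1) by ring.
    by rewrite ler_wpM2l ?divr_ge0 ?sqr_ge0 // ler_wpM2l ?mulr_ge0 // sum_geometric_le.
  apply: le_trans (ltW hN).
  apply: (le_trans (ler_normcB _ _)); rewrite normcM.
  rewrite mulrDl; apply: lerD.
    apply: (le_trans (ler_normcB _ _)); rewrite mulrDl.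
    have qN : K * q ^+ N.+1 <= K * qq ^+ N.
      rewrite ler_wpM2l // exprS; apply: (@le_trans _ _ (q ^+ N)).
        by rewrite ler_piMl ?exprn_ge0 // ltW.
      exact: exprn_le_max.
    by apply: lerD; [apply: le_trans A1 _|apply: le_trans A2 _].
  rewrite mulrAC ler_wpM2r ?normc_ge0 // (le_trans A3) // ler_wpM2l //.
  by rewrite /qq maxC; exact: exprn_le_max.
have M1 : 0 < M + 1 by rewrite ltr_wpDl.
exists (Num.min d (e / (M + 1))); first by rewrite lt_min d0 divr_gt0.
move=> w; rewrite lt_min => /andP[wd we].
have := bound (w - z) (ltW wd); rewrite subrKC => h; apply: (le_trans h).
rewrite expr2 mulrA ler_wpM2r ?normc_ge0 //.
apply: (@le_trans _ _ ((M + 1) * (e / (M + 1)))).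
  by apply: ler_pM; rewrite ?normc_ge0 // ?lerDl // ltW.
by rewrite mulrC divfK // lt0r_neq0.
Qed.

Lemma has_ps_cder f a z : has_ps f a -> normc z < 1 -> exists l, cder f z l.
Proof. by move=> /has_ps_derivative[f' [_ h]] /h; exists (f' z). Qed.

Lemma has_ps_continuous f a z : has_ps f a -> normc z < 1 -> {for z, continuous f}.
Proof. by move=> hf z1; have [l /cder_continuous] := has_ps_cder hf z1. Qed.

Lemma has_ps_analytic f a : has_ps f a -> analytic f.
Proof. by move=> hf z /discE z1; have [l /cderP[]] := has_ps_cder hf z1. Qed.

Lemma analytic_derive1 f : analytic f -> exists a, has_ps f a /\
  has_ps (derive1 f) (fun n => n.+1%:R * a n.+1).
Proof.
move=> /analytic_has_ps[a ha]; exists a; split => //.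
have [f' [hf' df]] := has_ps_derivative ha; move=> rho hr.
have [K [q [K0 hq hK]]] := hf' _ hr; exists K, q; split => // z zr N.
have /andP[_ r1] := hr.
by have /cderP[_ ->] := df z (le_lt_trans zr r1); exact: hK.
Qed.

Lemma integral_monomial n : cint lam `[0, 1] (fun t => t%:C ^+ n) = (n.+1%:R^-1)%:C.
Proof.
have -> : cint lam `[0, 1] (fun t => t%:C ^+ n) = (\int[lam]_(t in `[0, 1]) (t ^+ n))%:C.
  rewrite /cint; congr (_ +i* _); first by apply: eq_Rintegral => t _; rewrite -rmorphXn.
  under eq_Rintegral => t _ do rewrite -rmorphXn /=.
  by rewrite Rintegral_cst // mul0r.
congr (_%:C); rewrite /Rintegral.
pose F t := n.+1%:R^-1 * t ^+ n.+1.
have dF t : is_derive t (1 : R) F (t ^+ n).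
  rewrite (_ : F = n.+1%:R^-1 \*: ((@id R) ^+ n.+1)); last first.
    by apply/funext => x; rewrite /F /= !fctE.
  apply: is_derive_eq.
  by rewrite /= [_%:A]mulr1 [_ *: _]mulrA mulVf ?pnatr_eq0 // mul1r.
rewrite (@continuous_FTC2 _ _ F) //.
- by rewrite /= /F expr0n expr1n mulr1 mulr0 subr0.
- by apply: continuous_subspaceT => t; exact: exprn_continuous.
- split.
  + by move=> t _; have [] := dF t.
  + by apply: cvg_at_right_filter; apply: differentiable_continuous; apply/derivable1_diffP; have [] := dF 0.
  + by apply: cvg_at_left_filter; apply: differentiable_continuous; apply/derivable1_diffP; have [] := dF 1.
- by move=> t _; rewrite derive1E; have [_ ->] := dF t.
Qed.

Lemma normc_segment t z : 0 <= t <= 1 -> normc (t%:C * z) <= normc z.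
Proof.
by move=> /andP[t0 t1]; rewrite normcM normc_real ger0_norm // ler_piMl // normc_ge0.
Qed.

Lemma cintegrable_segment h z : (forall w, normc w <= normc z -> {for w, continuous h}) ->
  cintegrable lam `[0, 1] (fun t => h (t%:C * z)).
Proof.
move=> ch; apply/cintegrable_continuous/within_pointwise_continuous => t t01.
apply: (ccont_comp (f := fun t => t%:C * z) (ccontM (@continuous_real_complex R t) ccont_cst)).
by apply: ch; exact: normc_segment.
Qed.

Lemma analyticM f h : analytic f -> analytic h -> analytic (fun z => f z * h z).
Proof.
move=> af ah z dz.
by have /cderP[] := cderM (derivable_cder (af z dz)) (derivable_cder (ah z dz)).
Qed.

Lemma analytic_derive f : analytic f -> analytic (derive1 f).
Proof. by move=> /analytic_derive1[a [_ /has_ps_analytic]]. Qed.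

Lemma analytic_continuous f z : analytic f -> normc z < 1 -> {for z, continuous f}.
Proof. by move=> af /discE/af/derivable_cder/cder_continuous. Qed.

End PowerSeriesFunctions.

(** * Hahn-Banach extension by one real dimension *)

Section HahnBanach.
Context {R : realType} {V : Type}.
(* [N u B] reads "the seminorm of [u] is at most [B]". *)
Variables (add : V -> V -> V) (sc : R -> V -> V) (S : V -> Prop) (N : V -> R -> Prop).
Hypothesis (SD : forall u v, S u -> S v -> S (add u v)) (SZ : forall t u, S u -> S (sc t u)).
Hypothesis (ND : forall u v B C, N u B -> N v C -> N (add u v) (B + C)).
Hypothesis (NZ : forall t u B, 0 <= t -> N u B -> N (sc t u) (t * B)).
Hypothesis (Nex : forall u, exists B, N u B).
Variables (phi pi : V -> R).
Hypothesis (phiD : forall u v, phi (add u v) = phi u + phi v)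
  (phiZ : forall t u, phi (sc t u) = t * phi u)
  (piD : forall u v, pi (add u v) = pi u + pi v)
  (piZ : forall t u, pi (sc t u) = t * pi u).

(** Vectors with pi u = -1 bound [y] from below and those with pi u = 1 from above; [y] is the
    supremum of the lower constraints. Any other nonzero value of [pi] is rescaled to -1 or 1 by a
    positive factor. *)
Lemma hahn_banach_step : (forall u, S u -> pi u = 0 -> forall B, N u B -> phi u <= B) ->
  exists y, forall u, S u -> forall B, N u B -> phi u + y * pi u <= B.
Proof.
move=> dom.
have [[u0 Su0 p0]|nex] := pselect (exists2 u, S u & pi u != 0); last first.
  exists 0 => u Su B NB; rewrite mul0r addr0; apply: (dom u) => //.
  by apply/eqP/negPn/negP => h; apply: nex; exists u.
pose A : set R := [set x | exists u B, [/\ S u, pi u = -1, N u B & x = phi u - B]].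
have A0 : A !=set0.
  have [B NB] := Nex (sc (- (pi u0)^-1) u0); exists (phi (sc (- (pi u0)^-1) u0) - B).
  exists (sc (- (pi u0)^-1) u0), B; split => //; first exact: SZ.
  by rewrite piZ mulNr mulVf.
(* Compatibility of the two kinds of constraint: the sum of a vector with [pi] equal to 1 and one
   with [pi] equal to -1 lies in the kernel, where domination is known. *)
have ubA u B : S u -> pi u = 1 -> N u B -> ubound A (B - phi u).
  move=> Su pu NB _ [v [C [Sv pv NC ->]]].
  have := dom _ (SD Su Sv) _ _ (ND NB NC); rewrite piD pu pv subrr => /(_ erefl).
  by rewrite phiD; lra.
have bA : has_ubound A.
  have [B NB] := Nex (sc (pi u0)^-1 u0); exists (B - phi (sc (pi u0)^-1 u0)).
  by apply: ubA => //; [exact: SZ|rewrite piZ mulVf].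
exists (sup A) => u Su B NB; have [pu|pu|pu] := ltgtP (pi u) 0.
- have i0 : 0 < - (pi u)^-1 by rewrite oppr_gt0 invr_lt0.
  have : A (phi (sc (- (pi u)^-1) u) - - (pi u)^-1 * B).
    exists (sc (- (pi u)^-1) u), (- (pi u)^-1 * B); split => //.
    + exact: SZ.
    + by rewrite piZ mulNr mulVf // lt_eqF.
    + by apply: NZ => //; exact: ltW.
  move=> /(ub_le_sup bA); rewrite phiZ -mulrBr mulNr -mulrN ler_ndivrMl //.
  by rewrite mulrC; lra.
- have : sup A <= (pi u)^-1 * B - phi (sc (pi u)^-1 u).
    apply: ge_sup => //; apply: ubA; first exact: SZ.
      by rewrite piZ mulVf // gt_eqF.
    by apply: NZ => //; rewrite invr_ge0 ltW.
  by rewrite phiZ -mulrBr ler_pdivlMl // mulrC; lra.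
- by rewrite pu mulr0 addr0; exact: dom.
Qed.

End HahnBanach.

(** * Extension of moments to negative frequencies *)

Section MomentExtension.
Context {R : realType}.
Implicit Types (c b l : nat -> R[i]) (B C : R).

Lemma rotation (w : R[i]) : exists2 u : R[i], normc u = 1 & u * w = (normc w)%:C.
Proof.
have [->|w0] := eqVneq w 0; first by exists 1; rewrite ?normc1 // mulr0 normc0.
have n0 : normc w != 0 by rewrite normc_eq0.
have nC : (normc w)%:C != 0 :> R[i] by rewrite -normc_eq0 normc_real normr_eq0.
exists ((normc w)%:C / w); last by rewrite divfK.
by rewrite normcM normcV normc_real ger0_norm ?normc_ge0 // mulfV.
Qed.

(** A relation instead of a supremum: the form in which [hahn_banach_step] takes its seminorm. *)
Definition circle_bound (C : R) M c B := forall xi : R[i], normc xi = 1 ->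
  C * normc (\sum_(n < M) c n * xi ^+ n) <= B.

Definition dominated C M j l := forall c, (forall n, (n < j)%N -> c n = 0) ->
  forall B, circle_bound C M c B -> complex.Re (\sum_(n < M) c n * l n) <= B.

(** Admitting the coefficient c_j adds two real dimensions, hence two extensions: one for real c_j,
    the other for its imaginary part. *)
Lemma dominated_step C M j l : 0 <= C -> (j < M)%N -> dominated C M j.+1 l ->
  exists l', dominated C M j l' /\ forall n, (j < n)%N -> l' n = l n.
Proof.
move=> C0 jM dom.
pose add (c d : nat -> R[i]) n := c n + d n; pose sc (t : R) (c : nat -> R[i]) n := t%:C * c n.
pose val c m : R[i] := \sum_(n < M) c n * (m n : R[i]).
have valD c d m : val (add c d) m = val c m + val d m.
  by rewrite /val -big_split; apply: eq_bigr => n _; rewrite mulrDl.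
have valZ t c m : val (sc t c) m = t%:C * val c m.
  by rewrite /val mulr_sumr; apply: eq_bigr => n _; rewrite mulrA.
have ReZ t (z : R[i]) : complex.Re (t%:C * z) = t * complex.Re z by rewrite cReM mul0r subr0.
have ImZ t (z : R[i]) : complex.Im (t%:C * z) = t * complex.Im z by rewrite cImM mul0r addr0.
have ND c d A B : circle_bound C M c A -> circle_bound C M d B -> circle_bound C M (add c d) (A + B).
  move=> h1 h2 xi x1; have := h1 xi x1; have := h2 xi x1.
  rewrite -!/(val _ (fun n => xi ^+ n)) valD => k2 k1.
  by rewrite (le_trans _ (lerD k1 k2)) // -mulrDr ler_wpM2l // le_normcD.
have NZ t c B : 0 <= t -> circle_bound C M c B -> circle_bound C M (sc t c) (t * B).
  move=> t0 h xi x1; have := h xi x1; rewrite -!/(val _ (fun n => xi ^+ n)) valZ.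
  by rewrite normcM normc_real ger0_norm // mulrCA => k; rewrite ler_wpM2l.
have Nex c : exists B, circle_bound C M c B.
  exists (C * \sum_(n < M) normc (c n)) => xi x1; rewrite ler_wpM2l //.
  apply: (le_trans (ler_normc_sum _ _ _)); apply: ler_sum => n _.
  by rewrite normcM normcX x1 expr1n mulr1.
pose S1 c := (forall n, (n < j)%N -> c n = 0) /\ complex.Im (c j) = 0.
pose S2 c := forall n, (n < j)%N -> c n = 0 :> R[i].
have [y1 hy1] : exists y, forall c, S1 c -> forall B, circle_bound C M c B ->
    complex.Re (val c l) + y * complex.Re (c j) <= B.
  apply: (@hahn_banach_step R (nat -> R[i]) add sc) => //.
  - move=> c d [h1 h2] [h3 h4]; split; first by move=> n nj; rewrite /add h1 // h3 // addr0.
    by rewrite /add cImD h2 h4 addr0.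
  - move=> t c [h1 h2]; split; first by move=> n nj; rewrite /sc h1 // mulr0.
    by rewrite /sc ImZ h2 mulr0.
  - by move=> c d; rewrite valD cReD.
  - by move=> t c; rewrite valZ ReZ.
  - by move=> c d; rewrite /add cReD.
  - by move=> t c; rewrite /sc ReZ.
  - move=> c [h1 h2] h3 B; apply: dom => n; rewrite ltnS leq_eqVlt => /orP[/eqP ->|/h1 //].
    exact: complex_eqP.
have [y2 hy2] : exists y, forall c, S2 c -> forall B, circle_bound C M c B ->
    complex.Re (val c l) + y1 * complex.Re (c j) + y * complex.Im (c j) <= B.
  apply: (@hahn_banach_step R (nat -> R[i]) add sc) => //.
  - by move=> c d h1 h2 n nj; rewrite /add h1 // h2 // addr0.
  - by move=> t c h n nj; rewrite /sc h // mulr0.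
  - by move=> c d; rewrite valD !cReD; ring.
  - by move=> t c; rewrite valZ !ReZ; ring.
  - by move=> c d; rewrite /add cImD.
  - by move=> t c; rewrite /sc ImZ.
  - by move=> c h1 h2 B; apply: hy1.
(* The minus sign makes the real part of c_j times [bt] equal to y1 Re c_j + y2 Im c_j. *)
pose bt : R[i] := y1 -i* y2.
exists (fun n => if n == j then l n + bt else l n); split; last first.
  by move=> n jn; rewrite gtn_eqF.
move=> c hc B hB; apply: le_trans (hy2 c hc B hB).
have -> : \sum_(n < M) c n * (if n == j :> nat then l n + bt else l n) = val c l + c j * bt.
  rewrite /val (bigD1 (Ordinal jM)) //= eqxx [in RHS](bigD1 (Ordinal jM)) //= mulrDr -!addrA.
  congr (_ + _); rewrite addrC; congr (_ + _); apply: eq_bigr => n nj.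
  by rewrite ifN.
by rewrite cReD cReM /=; lra.
Qed.

Lemma dominated_extend C M K l : 0 <= C -> (K <= M)%N -> dominated C M K l ->
  exists l', dominated C M 0 l' /\ forall n, (K <= n)%N -> l' n = l n.
Proof.
move=> C0; elim: K l => [|K IH] l KM dom; first by exists l.
have [l1 [d1 e1]] := dominated_step C0 KM dom.
have [l2 [d2 e2]] := IH l1 (ltnW KM) d1.
by exists l2; split => // n Kn; rewrite e2 1?ltnW // e1.
Qed.

(* Hahn-Banach for the functional [c |-> \sum c n * b n] on analytic polynomials,
   extended to Laurent polynomials of degree at least [-K], shifted by [K]. *)
Lemma moment_extension C K L b : 0 <= C ->
  (forall c B, circle_bound C L c B -> normc (\sum_(n < L) c n * b n) <= B) ->
  exists2 l, (forall n, l (K + n)%N = b n) &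
    forall c B, circle_bound C (K + L) c B -> normc (\sum_(n < K + L) c n * l n) <= B.
Proof.
move=> C0 hb.
have [l [dl el]] : exists l, dominated C (K + L) 0 l /\
    forall n, (K <= n)%N -> l n = b (n - K)%N.
  apply: dominated_extend => //; first exact: leq_addr.
  move=> c hc B hB; apply: (le_trans (ler_norm _)); apply: (le_trans (abs_Re_le _)).
  (* Without coefficients below [K] the polynomial is xi^K times one with [L] coefficients, of the
     same modulus on the circle. *)
  have low (F : nat -> R[i]) : \sum_(n < K + L) c n * F n = \sum_(n < L) c (K + n)%N * F (K + n)%N.
    rewrite big_split_ord /= big1 ?add0r // => n _.
    by rewrite hc ?mul0r.
  rewrite (low (fun n => b (n - K)%N)).
  have -> : \sum_(n < L) c (K + n)%N * b (K + n - K)%N = \sum_(n < L) c (K + n)%N * b n.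
    by apply: eq_bigr => n _; rewrite addKn.
  apply: (hb (fun n => c (K + n)%N)) => xi x1; have := hB xi x1; rewrite (low (fun n => xi ^+ n)).
  have -> : \sum_(n < L) c (K + n)%N * xi ^+ (K + n) = xi ^+ K * \sum_(n < L) c (K + n)%N * xi ^+ n.
    by rewrite mulr_sumr; apply: eq_bigr => n _; rewrite exprD mulrCA.
  by rewrite normcM normcX x1 expr1n mul1r.
exists l; first by move=> n; rewrite el ?leq_addr // addKn.
(* A unimodular factor turns the bound on real parts into one on moduli without loss. *)
move=> c B hB; have [u u1 hu] := rotation (\sum_(n < K + L) c n * l n).
have -> : normc (\sum_(n < K + L) c n * l n) =
    complex.Re (\sum_(n < K + L) (u * c n) * l n).
  rewrite (_ : \sum_(n < K + L) (u * c n) * l n = u * \sum_(n < K + L) c n * l n).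
    by rewrite hu.
  by rewrite mulr_sumr; apply: eq_bigr => n _; rewrite mulrA.
apply: (dl (fun n => u * c n)) => // xi x1; have := hB xi x1.
have -> : \sum_(n < K + L) u * c n * xi ^+ n = u * \sum_(n < K + L) c n * xi ^+ n.
  by rewrite mulr_sumr; apply: eq_bigr => n _; rewrite mulrA.
by rewrite normcM u1 mul1r.
Qed.

(** The constant [A] disappears on taking k-th roots: if x > B, then A (B / x)^k falls below 1. *)
Lemma le_of_powers (x A B : R) : 0 <= x -> 0 <= A -> 0 <= B ->
  (forall k, x ^+ k <= A * B ^+ k) -> x <= B.
Proof.
move=> x0 A0 B0 h; rewrite leNgt; apply/negP => Bx.
have x1 : 0 < x := le_lt_trans B0 Bx.
have hq : 0 <= B / x < 1 by rewrite divr_ge0 //= ltr_pdivrMr // mul1r.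
have [k hk] := geometric_small hq A0 ltr01; have := hk k (leqnn k).
by rewrite ltNge expr_div_n mulrA ler_pdivlMr ?exprn_gt0 // mul1r h.
Qed.

(* The coefficients of [p ^ k] are at most [2 B ^ k], so that
   [|p z| ^ k <= 2 B ^ k / (1 - |z|)] for every [k]. *)
Lemma poly_maximum c N B : (forall xi : R[i], normc xi = 1 -> normc (\sum_(n < N) c n * xi ^+ n) <= B) ->
  forall z, normc z <= 1 -> normc (\sum_(n < N) c n * z ^+ n) <= B.
Proof.
move=> hB z; rewrite le_eqVlt => /orP[/eqP z1|z1]; first exact: hB.
have B0 : 0 <= B by apply: le_trans (hB 1 (normc1 R)); exact: normc_ge0.
pose p := \poly_(n < N) c n.
have pE w : \sum_(n < N) c n * w ^+ n = p.[w] by rewrite horner_poly.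
have d0 : 0 < 1 - normc z by rewrite subr_gt0.
apply: (@le_of_powers _ (2 / (1 - normc z))); rewrite ?normc_ge0 //.
  by rewrite divr_ge0 // ltW.
move=> k; rewrite pE -normcX -horner_exp horner_coef.
have pk t : normc (\sum_(n < size (p ^+ k)) (p ^+ k)`_n * cisC t ^+ n) <= B ^+ k.
  rewrite -horner_coef horner_exp normcX lerXn2r ?nnegrE ?normc_ge0 //.
  by rewrite -pE hB ?normc_cisC.
apply: (le_trans (ler_normc_sum _ _ _)).
apply: (@le_trans _ _ (\sum_(n < size (p ^+ k)) 2 * B ^+ k * normc z ^+ n)).
  apply: ler_sum => n _; rewrite normcM normcX ler_wpM2r ?exprn_ge0 ?normc_ge0 //.
  exact: (@trig_poly_coef_le R _ (fun n => (p ^+ k)`_n) n _ (ltn_ord n) pk).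
have -> : \sum_(n < size (p ^+ k)) 2 * B ^+ k * normc z ^+ n =
    2 * B ^+ k * \sum_(n < size (p ^+ k)) normc z ^+ n by rewrite mulr_sumr.
have -> : 2 / (1 - normc z) * B ^+ k = 2 * B ^+ k * (1 - normc z)^-1 by ring.
rewrite ler_wpM2l //; first by rewrite mulr_ge0 // exprn_ge0.
by rewrite sum_geometric_le // normc_ge0.
Qed.

End MomentExtension.

(** * Integration against charges with a density *)

Section BoundedCharges.
Context d {T : measurableType d} {R : realType}.
Implicit Types (nu : {charge set T -> \bar R}) (u f g : T -> R).
Local Open Scope ereal_scope.

(** Equality of integrals over all measurable sets identifies the Radon-Nikodym derivative of [nu]
    with [h] on [D] almost everywhere; the change of variables formula does the rest. *)
Lemma integral_density (nu : {finite_measure set T -> \bar R})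
    (mu : {sigma_finite_measure set T -> \bar R}) (D : set T) (h g : T -> R) :
  measurable D -> mu.-integrable D (EFin \o h) -> measurable_fun setT g ->
  nu.-integrable setT (EFin \o g) -> mu.-integrable D (EFin \o (fun x => g x * h x)%R) ->
  (forall A, measurable A -> nu A = \int[mu]_(x in A `&` D) (h x)%:E) ->
  \int[nu]_x (g x)%:E = \int[mu]_(x in D) (g x * h x)%:E.
Proof.
move=> mD ih mg ig igh nuE.
have nud : nu `<< mu.
  apply/null_content_dominatesP => A mA muA; rewrite nuE //.
  apply: null_set_integral; first exact: measurableI.
  - by apply: measurable_funS (measurable_int _ ih) => //; exact: subIsetr.
  - apply/eqP; rewrite eq_le measure_ge0 andbT -muA le_measure ?inE //; exact: measurableI.
rewrite -(Radon_Nikodym_change_of_variables nud measurableT ig).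
have aeE : ae_eq mu setT (Radon_Nikodym (charge_of_finite_measure nu) mu) ((EFin \o h) \_ D).
  apply: integral_ae_eq => //.
  - exact: Radon_Nikodym_integrable.
  - by apply: (measurable_int mu); apply/(integrable_mkcond _ mD).
  - move=> A _ mA; rewrite -Radon_Nikodym_integral //= /charge_of_finite_measure nuE //.
    by rewrite integral_mkcondr.
rewrite [RHS]integral_mkcond.
apply: ae_eq_integral => //.
- by apply: emeasurable_funM => //; exact/measurable_EFinP.
- by apply: (measurable_int mu); apply/(integrable_mkcond _ mD).
- apply: filterS aeE => x /(_ I) -> _; rewrite /patch /=.
  by case: ifP => _; rewrite ?mule0 // -EFinM.
Qed.

(** [charge_integral] picks its Hahn decomposition by choice, so an arbitrary one is treated: the
    positive part has density f on P, the negative part -f on N, and the two integrals recombine. *)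
Lemma integral_charge_jordan (mu : {finite_measure set T -> \bar R}) f (P N : set T)
    (mf : mu.-integrable setT (EFin \o f))
    (PN : hahn_decomposition (induced_charge mf) P N) g (M : R) :
  measurable_fun setT f -> measurable_fun setT g -> (forall x, `|g x| <= M)%R ->
  (\int[jordan_pos PN]_x g x - \int[jordan_neg PN]_x g x = \int[mu]_x (g x * f x))%R.
Proof.
move=> mmf mg gM.
have [[mP _] [mN _] PNT PN0] := PN.
have fgi : mu.-integrable setT (EFin \o (fun x => g x * f x)%R).
  apply: (le_integrable measurableT _ _ (integrableZl measurableT M mf)) => //.
  - exact/measurable_EFinP/measurable_funM.
  - move=> x _ /=; rewrite lee_fin !normrM ler_wpM2r //.
    exact: le_trans (gM x) (ler_norm M).
have jg (nu' : {finite_measure set T -> \bar R}) : nu'.-integrable setT (EFin \o g).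
  apply: (@integrable_bounded _ _ _ nu' setT g M) => //.
  exact: fin_num_fun_lty (fin_num_measure nu').
have jpE A : measurable A -> jordan_pos PN A = \int[mu]_(x in A `&` P) (f x)%:E.
  by move=> mA; rewrite jordan_posE cjordan_posE /crestr0 mem_set.
have jnE A : measurable A -> jordan_neg PN A = \int[mu]_(x in A `&` N) (- f x)%:E.
  move=> mA; rewrite jordan_negE cjordan_negE /crestr0 mem_set // /crestr /= /induced_charge.
  have mAN : measurable (A `&` N) by exact: measurableI.
  rewrite -integralN //=; apply: integrable_add_def => //.
  exact: (integrableS measurableT mAN (@subsetT _ _) mf).
have iP : mu.-integrable P (EFin \o (fun x => g x * f x)%R) by exact: integrableS fgi.
have iN : mu.-integrable N (EFin \o (fun x => g x * f x)%R) by exact: integrableS fgi.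
have iN' : mu.-integrable N (EFin \o (fun x => g x * - f x)%R).
  by apply: eq_integrable (integrableN iN) => // x _ /=; rewrite mulrN EFinN.
have fN : mu.-integrable N (EFin \o (fun x => - f x)%R).
  by apply: (integrableN (integrableS measurableT mN _ mf)).
rewrite /Rintegral (integral_density mP (integrableS measurableT mP (@subsetT _ _) mf) mg (jg _) iP jpE).
rewrite (integral_density mN fN mg (jg _) iN' jnE).
rewrite -[setT]PNT integral_setU //=; last 2 first.
- by rewrite PNT; exact: measurable_int fgi.
- by apply/disj_setPS; rewrite PN0.
have f1 := integrable_fin_num mP iP; have f2 := integrable_fin_num mN iN.
rewrite [in RHS]fineD //.
congr (_ + _)%R.
under eq_integral do rewrite mulrN EFinN.
rewrite integralN; last exact: integrable_add_def.
by rewrite fineN opprK.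
Qed.

End BoundedCharges.

(** * Arc length as a finite measure *)

Section ArcMeasure.
Context {R : realType}.
Local Notation lam := (@lebesgue_measure R).
Local Notation T := (borel_circle R).
Local Notation arc_dom := (`[0%R, (2 * pi)%R[%classic : set R).

Lemma measurable_cis : measurable_fun setT (cis : R -> T).
Proof.
apply: (@measurability _ _ R T setT cis (@open (circle R)) erefl).
move=> _ [A oA <-]; apply: open_measurable; rewrite setTI.
case: oA => B oB <-.
have -> : cis @^-1` (val @^-1` B) = (@cisC R) @^-1` B by [].
by apply: open_comp => // x _; exact: continuous_cisC.
Qed.

Lemma measurable_circle_fun (f : circle R -> R) : continuous f ->
  measurable_fun setT (f : T -> R).
Proof.
move=> cf; apply: (measurability _ (RGenOInfty.measurableE R)).
move=> _ [_ [a ->] <-]; apply: sub_sigma_algebra; rewrite setTI.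
by apply: open_comp => [x _|]; [exact: cf|exact: interval_open].
Qed.

Lemma continuous_circle_val : continuous (val : circle R -> R[i]).
Proof. exact: initial_continuous. Qed.

Lemma arc_dom_fin : (lam arc_dom < +oo)%E.
Proof. by rewrite lebesgue_measure_itv /=; case: ifPn => //; rewrite -EFinB ltry. Qed.

Let measurable_arc_dom : (@measurable _ (measurableTypeR R)) arc_dom.
Proof. exact: measurable_itv. Qed.

Let arc_restr : {finite_measure set (measurableTypeR R) -> \bar R} :=
  mfrestr measurable_arc_dom arc_dom_fin.

(** Arc length rebuilt as a push-forward, so that it carries the structure of a finite measure and
    can be the base measure of charges; [arc_measureE] identifies it with [arc_length]. *)
Definition arc_measure : set T -> \bar R :=
  @pushforward _ _ (measurableTypeR R) T R arc_restr (cis : R -> T).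

Let arc_measure' : {measure set T -> \bar R} :=
  measure_function_pushforward__canonical__measure_function_Measure arc_restr measurable_cis.

Let arc0 : arc_measure set0 = 0%E.
Proof. exact: (measure0 arc_measure'). Qed.

Let arc_ge0 A : (0 <= arc_measure A)%E.
Proof. exact: (measure_ge0 arc_measure'). Qed.

Let arc_sigma : semi_sigma_additive arc_measure.
Proof. exact: (@measure_semi_sigma_additive _ _ _ arc_measure'). Qed.

HB.instance Definition _ := isMeasure.Build _ _ _ arc_measure arc0 arc_ge0 arc_sigma.

Let arc_fin : fin_num_fun arc_measure.
Proof.
move=> A mA; apply: fin_num_measure.
by rewrite -[X in measurable X]setTI; exact: measurable_cis.
Qed.

HB.instance Definition _ := Measure_isFinite.Build _ _ _ arc_measure arc_fin.

Lemma arc_measureE : arc_measure = arc_length.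
Proof. by apply/funext => A; rewrite /arc_length setIC. Qed.

Lemma arc_measure_fin A : measurable A -> (arc_measure A < +oo)%E.
Proof. by move=> mA; rewrite ltey_eq arc_fin. Qed.

(** Three changes: from the circle to restricted Lebesgue measure, from that to Lebesgue measure by
    the density 1 on the half-open interval, and from the half-open to the closed interval. *)
Lemma integral_arc (g : R -> R) (u : circle R -> R) (M : R) :
  measurable_fun setT (u : T -> R) -> (forall x, `|u x| <= M) ->
  (forall t, g t = u (cis t)) ->
  \int[arc_measure]_x u x = \int[lam]_(t in `[0, 2 * pi]) g t.
Proof.
move=> mu_ uM gu.
have mg : measurable_fun setT g.
  by rewrite (_ : g = u \o cis); [exact: measurableT_comp measurable_cis|apply/funext].
have gM t : `|g t| <= M by rewrite gu.
have ig (D : set R) : measurable D -> (lam D < +oo)%E -> lam.-integrable D (EFin \o g).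
  move=> mD Dfin; apply: (@integrable_bounded _ _ _ lam D g M) => //.
  exact: measurable_funTS.
have igr : arc_restr.-integrable setT (EFin \o g).
  apply: (@integrable_bounded _ _ _ arc_restr setT g M) => //.
  exact: fin_num_fun_lty (fin_num_measure arc_restr).
have i1 : lam.-integrable arc_dom (EFin \o (fun=> 1 : R)).
  apply: (@integrable_bounded _ _ _ lam _ _ 1) => //; first exact: arc_dom_fin.
  by move=> t _; rewrite normr1.
rewrite -Rintegral_itv_bndo_bndc; last by apply: ig => //; exact: arc_dom_fin.
rewrite /Rintegral; congr fine.
transitivity (\int[arc_restr]_t (g t)%:E)%E.
  have := @integral_pushforward _ _ (measurableTypeR R) T R cis measurable_cis arc_restr setT (EFin \o u).
  rewrite preimage_setT => H; rewrite [LHS]H //.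
  - by apply: eq_integral => t _ /=; rewrite gu.
  - exact/measurable_EFinP.
  - by apply: eq_integrable igr => // t _ /=; rewrite gu.
rewrite (@integral_density _ (measurableTypeR R) R arc_restr lam arc_dom (fun=> 1) g) //.
- by apply: eq_integral => t _; rewrite mulr1.
- by apply: eq_integrable (ig _ _ arc_dom_fin) => // t _ /=; rewrite mulr1.
- move=> A mA; rewrite integral_cst ?mul1e //; exact: measurableI.
Qed.

End ArcMeasure.

(** * Complex measures on the circle and their moments *)

Section CircleMeasures.
Context {R : realType}.
Local Notation lam := (@lebesgue_measure R).
Local Notation T := (borel_circle R).
Implicit Types (mu : @complex_measure R) (phi psi : R[i] -> R[i]) (u : circle R -> R) (z w : R[i]).

(** Continuity in the plane at each point of the closed disc gives boundedness by compactness and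
    composes with [val]; it also admits w |-> conj w, which is not analytic. *)
Definition disc_cont phi := forall w, normc w <= 1 -> {for w, continuous phi}.

Lemma normc_circle (x : circle R) : normc (val x) = 1.
Proof.
have := set_valP x; rewrite /= norm_normc => h.
by have := congr1 (@complex.Re R) h.
Qed.

Lemma measurable_disc_cont (P : R[i] -> R) phi : continuous P -> disc_cont phi ->
  measurable_fun setT ((fun x => P (phi (val x))) : T -> R).
Proof.
move=> cP cphi; apply: measurable_circle_fun => x.
apply: (@continuous_comp _ _ _ (fun x : circle R => phi (val x)) P); last exact: cP.
apply: (@continuous_comp _ _ _ (val : circle R -> R[i]) phi); first exact: continuous_circle_val.
by apply: cphi; rewrite normc_circle.
Qed.

Lemma disc_cont_bounded phi : disc_cont phi -> exists2 B : R, 0 <= B &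
  forall w, normc w <= 1 -> normc (phi w) <= B.
Proof. by move=> cphi; exact: disc_bounded. Qed.

Lemma disc_contD phi psi : disc_cont phi -> disc_cont psi -> disc_cont (fun w => phi w + psi w).
Proof. by move=> h1 h2 w w1; exact: (ccontD (h1 w w1) (h2 w w1)). Qed.

Lemma disc_contM phi psi : disc_cont phi -> disc_cont psi -> disc_cont (fun w => phi w * psi w).
Proof. by move=> h1 h2 w w1; exact: (ccontM (h1 w w1) (h2 w w1)). Qed.

Lemma disc_cont_cst (c : R[i]) : disc_cont (fun=> c).
Proof. by move=> w _; exact: ccont_cst. Qed.

Lemma disc_cont_conj : disc_cont (fun w => conjc w).
Proof. by move=> w _; exact: continuous_conj. Qed.

Lemma disc_cont_id : disc_cont (fun w => w).
Proof. by move=> w _; exact: cvg_id. Qed.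

Lemma disc_contX phi n : disc_cont phi -> disc_cont (fun w => phi w ^+ n).
Proof. by move=> h w w1; exact: (ccontX (h w w1)). Qed.

Lemma disc_cont_sum (I : Type) (r : seq I) (F : I -> R[i] -> R[i]) :
  (forall i, disc_cont (F i)) -> disc_cont (fun w => \sum_(i <- r) F i w).
Proof. by move=> h w w1; exact: (ccont_sum (fun i => h i w w1)). Qed.

Lemma disc_cont_cauchy z : normc z < 1 -> disc_cont (fun w => (1 - conjc w * z)^-1).
Proof.
move=> z1 w w1; apply: (ccontV (ccontB ccont_cst (ccontM (@continuous_conj R w) ccont_cst))).
rewrite subr_eq0; apply/eqP => h; have := congr1 (@ComplexField.Normc.normc R) h.
rewrite normc1 normcM normc_conj => h1.
have : normc w * normc z <= 1 * normc z by rewrite ler_wpM2r ?normc_ge0.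
by rewrite -h1 mul1r leNgt z1.
Qed.

Lemma integrable_arc phi (P : R[i] -> R) : continuous P -> (forall w, `|P w| <= normc w) ->
  disc_cont phi -> (arc_measure : set T -> \bar R).-integrable setT
    (EFin \o (fun x : T => P (phi (val x)))).
Proof.
move=> cP hP cphi; have [B B0 hB] := disc_cont_bounded cphi.
apply: (@integrable_bounded _ _ _ arc_measure setT _ B) => //.
- exact: arc_measure_fin.
- exact: (measurable_disc_cont cP cphi).
- by move=> x _; apply: (le_trans (hP _)); apply: hB; rewrite normc_circle.
Qed.

Lemma cintegrable_arc phi : disc_cont phi ->
  cintegrable arc_measure setT (fun x : T => phi (val x)).
Proof.
move=> cphi; split; apply: integrable_arc => //.
- exact: continuous_Re.
- exact: abs_Re_le.
- exact: continuous_Im.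
- exact: abs_Im_le.
Qed.

Lemma continuous_disc_cis phi : disc_cont phi -> continuous (fun t => phi (cisC t)).
Proof.
move=> cphi t; apply: (ccont_comp (f := @cisC R) (@continuous_cisC R t)).
by apply: cphi; rewrite normc_cisC.
Qed.

Lemma cint_arc phi : disc_cont phi ->
  cint arc_measure setT (fun x : T => phi (val x)) =
  cint lam `[0, 2 * pi] (fun t => phi (cisC t)).
Proof.
move=> cphi; have [B B0 hB] := disc_cont_bounded cphi.
have nx x : normc (phi (val (x : circle R))) <= B by apply: hB; rewrite normc_circle.
rewrite /cint; congr (_ +i* _).
- apply: (@integral_arc _ _ _ B) => //.
  + by apply: measurable_disc_cont => //; exact: continuous_Re.
  + by move=> x; apply: le_trans (nx x); exact: abs_Re_le.
- apply: (@integral_arc _ _ _ B) => //.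
  + by apply: measurable_disc_cont => //; exact: continuous_Im.
  + by move=> x; apply: le_trans (nx x); exact: abs_Im_le.
Qed.

Lemma charge_integralE (nu : {charge set T -> \bar R}) :
  exists P N (PN : hahn_decomposition nu P N), forall u,
    charge_integral nu u = \int[jordan_pos PN]_x u x - \int[jordan_neg PN]_x u x.
Proof.
by exists (projT1 (cid (Hahn_decomposition nu))), _, (projT2 (cid (projT2 (cid (Hahn_decomposition nu))))).
Qed.

Lemma charge_integral_induced (f : T -> R) (mf : (arc_measure : set T -> \bar R).-integrable setT (EFin \o f))
    u (M : R) : measurable_fun setT f -> measurable_fun setT (u : T -> R) -> (forall x, `|u x| <= M) ->
  charge_integral (induced_charge mf) u = \int[arc_measure]_x (u x * f x).
Proof.
move=> mmf mu_ uM; have [A [N [PN E]]] := charge_integralE (induced_charge mf).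
exact: (etrans (E u) (integral_charge_jordan PN mmf mu_ uM)).
Qed.

(** The two charges are induced by the real and imaginary parts of the density; splitting the
    product of [phi] and [dn] in the same way reproduces the four terms of [cm_integral]. All
    measures constructed below arise from here. *)
Lemma density_measure dn : disc_cont dn -> exists mu, [/\ abs_continuous mu,
  forall E, measurable E -> cm_value mu E = cint arc_measure E (fun x : T => dn (val x)) &
  forall phi, disc_cont phi -> cm_integral mu (fun x => phi (val x)) =
    cint lam `[0, 2 * pi] (fun t => phi (cisC t) * dn (cisC t))].
Proof.
move=> cdn; have [ire iim] := cintegrable_arc cdn.
have [B B0 hB] := disc_cont_bounded cdn.
pose re : {charge set T -> \bar R} := induced_charge ire.
pose im : {charge set T -> \bar R} := induced_charge iim.
exists (ComplexMeasure re im); split.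
- split; rewrite -arc_measureE; apply/null_content_dominatesP => A mA A0.
    apply: null_set_integral => //; apply/measurable_EFinP/measurable_funTS.
    by apply: measurable_disc_cont => //; exact: continuous_Re.
  apply: null_set_integral => //; apply/measurable_EFinP/measurable_funTS.
  by apply: measurable_disc_cont => //; exact: continuous_Im.
- by [].
move=> phi cphi; have [M M0 hM] := disc_cont_bounded cphi.
have nx x : normc (phi (val (x : circle R))) <= M by apply: hM; rewrite normc_circle.
have key (P Q : R[i] -> R) (iQ : (arc_measure : set T -> \bar R).-integrable setT
     (EFin \o (fun x : T => Q (dn (val x))))) : continuous P -> (forall w, `|P w| <= normc w) ->
    continuous Q -> (forall w, `|Q w| <= normc w) ->
    charge_integral (induced_charge iQ) (fun x => P (phi (val x))) =
    \int[lam]_(t in `[0, 2 * pi]) (P (phi (cisC t)) * Q (dn (cisC t))).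
  move=> cP hP cQ hQ.
  have mP := measurable_disc_cont cP cphi; have mQ := measurable_disc_cont cQ cdn.
  apply: (etrans (charge_integral_induced iQ mQ mP (fun x => le_trans (hP _) (nx x)))).
  apply: (@integral_arc _ _ (fun x => P (phi (val x)) * Q (dn (val x))) (M * B)) => //.
  + exact: measurable_funM.
  + move=> x; rewrite normrM; apply: ler_pM => //; first exact: le_trans (hP _) (nx x).
    by apply: (le_trans (hQ _)); apply: hB; rewrite normc_circle.
have iD (P Q : R[i] -> R) : continuous P -> continuous Q ->
    lam.-integrable `[0, 2 * pi] (EFin \o (fun t => P (phi (cisC t)) * Q (dn (cisC t)))).
  move=> cP cQ; apply: continuous_compact_integrable (@segment_compact _ _ _) _.
  apply: continuous_subspaceT.
  have c1 : continuous (fun t : R => P (phi (cisC t))).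
    by move=> t; apply: (@continuous_comp _ _ _ (fun t => phi (cisC t)) P); [exact: (continuous_disc_cis cphi)|exact: cP].
  have c2 : continuous (fun t : R => Q (dn (cisC t))).
    by move=> t; apply: (@continuous_comp _ _ _ (fun t => dn (cisC t)) Q); [exact: (continuous_disc_cis cdn)|exact: cQ].
  by move=> t; exact: (cvgM (c1 t) (c2 t)).
have cR := @continuous_Re R; have cI := @continuous_Im R.
have hR := @abs_Re_le R; have hI := @abs_Im_le R.
rewrite /cm_integral /= /re /im !key // /cint; congr (_ +i* _).
- transitivity (\int[lam]_(t in `[0, 2 * pi])
    (1 * (complex.Re (phi (cisC t)) * complex.Re (dn (cisC t))) +
     (-1) * (complex.Im (phi (cisC t)) * complex.Im (dn (cisC t))))).
    by rewrite Rintegral_lin ?mul1r ?mulN1r //; exact: iD.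
  by apply: eq_Rintegral => t _; rewrite cReM mul1r mulN1r.
- transitivity (\int[lam]_(t in `[0, 2 * pi])
    (1 * (complex.Im (phi (cisC t)) * complex.Re (dn (cisC t))) +
     1 * (complex.Re (phi (cisC t)) * complex.Im (dn (cisC t))))).
    by rewrite Rintegral_lin ?mul1r //; exact: iD.
  by apply: eq_Rintegral => t _; rewrite cImM !mul1r addrC.
Qed.

Section ChargeIntegral.
Variable nu : {charge set T -> \bar R}.

Lemma integrable_finite_measure (m : {finite_measure set T -> \bar R}) u (M : R) :
  measurable_fun setT (u : T -> R) -> (forall x, `|u x| <= M) ->
  m.-integrable setT (EFin \o (u : T -> R)).
Proof.
move=> mu_ uM; apply: (@integrable_bounded _ _ _ m setT u M) => //.
exact: fin_num_fun_lty (fin_num_measure m).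
Qed.

Lemma charge_integral_lin u (v : circle R -> R) (M a b : R) :
  measurable_fun setT (u : T -> R) -> measurable_fun setT (v : T -> R) ->
  (forall x, `|u x| <= M) -> (forall x, `|v x| <= M) ->
  charge_integral nu (fun x => a * u x + b * v x) =
  a * charge_integral nu u + b * charge_integral nu v.
Proof.
move=> mu_ mv uM vM; have [P [N [PN E]]] := charge_integralE nu; rewrite !E.
have hu (m : {finite_measure set T -> \bar R}) := integrable_finite_measure m mu_ uM.
have hv (m : {finite_measure set T -> \bar R}) := integrable_finite_measure m mv vM.
rewrite (Rintegral_lin a b measurableT (hu (jordan_pos PN)) (hv (jordan_pos PN))).
by rewrite (Rintegral_lin a b measurableT (hu (jordan_neg PN)) (hv (jordan_neg PN))); ring.
Qed.

(** The Jordan parts have total masses nu P and - nu N, so control of [nu] on two-set partitions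
    suffices. *)
Lemma charge_integral_le u (M V : R) : measurable_fun setT (u : T -> R) ->
  (forall x, `|u x| <= M) -> 0 <= M ->
  (forall P N : set T, measurable P -> measurable N -> P `|` N = setT -> P `&` N = set0 ->
    `|fine (nu P)| + `|fine (nu N)| <= V) ->
  `|charge_integral nu u| <= M * V.
Proof.
move=> mu_ uM M0 hV; have [P [N [PN E]]] := charge_integralE nu; rewrite !E.
have [[mP _] [mN _] PNT PN0] := PN.
apply: (le_trans (ler_normB _ _)).
have hu (m : {finite_measure set T -> \bar R}) :
    `|\int[m]_x u x| <= M * fine (m setT).
  apply: normc_Rintegral_le => //; first exact: fin_num_fun_lty (fin_num_measure m).
  exact: integrable_finite_measure mu_ uM.
apply: (le_trans (lerD (hu (jordan_pos PN)) (hu (jordan_neg PN)))).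
rewrite -mulrDr ler_wpM2l // (le_trans _ (hV P N mP mN PNT PN0)) //.
have jp : jordan_pos PN setT = nu P.
  by rewrite jordan_posE cjordan_posE /crestr0 mem_set // /crestr setTI.
have jn : jordan_neg PN setT = (- nu N)%E.
  by rewrite jordan_negE cjordan_negE /crestr0 mem_set // /crestr setTI.
have eqle (x y z : R) : x = y -> y <= z -> x <= z by move=> ->.
apply: lerD; first exact: (eqle _ _ _ (congr1 fine jp) (ler_norm _)).
apply: (eqle _ _ _ (etrans (congr1 fine jn) (fineN _))).
by rewrite -normrN ler_norm.
Qed.

End ChargeIntegral.

Lemma total_variation_two mu (V : R) (P N : set T) : (Defs.total_variation mu <= V%:E)%E ->
  measurable P -> measurable N -> P `|` N = setT -> P `&` N = set0 ->
  normc (cm_value mu P) + normc (cm_value mu N) <= V.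
Proof.
move=> hV mP mN PNT PN0; rewrite -lee_fin; apply: le_trans hV.
apply: ereal_sup_ubound; exists 2, (fun i : 'I_2 => if i == ord0 then P else N); split.
- by move=> i; case: ifP.
- move=> i j _ _; case: ifP => [/eqP ->|i0]; case: ifP => [/eqP ->|j0] //.
  + by rewrite PN0 => -[].
  + by rewrite setIC PN0 => -[].
  + move=> _; apply/val_inj; case: i j i0 j0 => [[|[|i]] //= ?] [[|[|j]] //= ?] //.
- apply/seteqP; split => // x _; have : (P `|` N) x by rewrite PNT.
  by case=> h; [exists ord0|exists (Ordinal (ltnSn 1))].
- by rewrite big_ord_recl big_ord1 /=.
Qed.

Lemma cm_integral_lin mu phi psi (a : R[i]) : disc_cont phi -> disc_cont psi ->
  cm_integral mu (fun x => a * phi (val x) + psi (val x)) =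
  a * cm_integral mu (fun x => phi (val x)) + cm_integral mu (fun x => psi (val x)).
Proof.
move=> cphi cpsi; have [B B0 hB] := disc_cont_bounded cphi.
have [B' B'0 hB'] := disc_cont_bounded cpsi.
have cR := @continuous_Re R; have cI := @continuous_Im R.
have nphi (P : R[i] -> R) : (forall w, `|P w| <= normc w) ->
    forall x : circle R, `|P (phi (val x))| <= B + B'.
  by move=> hP x; apply: (le_trans (hP _)); rewrite ler_wpDr // hB // normc_circle.
have npsi (P : R[i] -> R) : (forall w, `|P w| <= normc w) ->
    forall x : circle R, `|P (psi (val x))| <= B + B'.
  by move=> hP x; apply: (le_trans (hP _)); rewrite ler_wpDl // hB' // normc_circle.
have hR := @abs_Re_le R; have hI := @abs_Im_le R.
have key (nu : {charge set T -> \bar R}) (c d : R) (P Q S : R[i] -> R) :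
    continuous P -> continuous Q -> continuous S ->
    (forall w, `|P w| <= normc w) -> (forall w, `|Q w| <= normc w) -> (forall w, `|S w| <= normc w) ->
    charge_integral nu (fun x => c * P (phi (val x)) + d * Q (phi (val x)) + S (psi (val x))) =
    c * charge_integral nu (fun x => P (phi (val x))) + d * charge_integral nu (fun x => Q (phi (val x)))
     + charge_integral nu (fun x => S (psi (val x))).
  move=> cP cQ cS hP hQ hS.
  have mP := measurable_disc_cont cP cphi; have mQ := measurable_disc_cont cQ cphi.
  have mS := measurable_disc_cont cS cpsi.
  rewrite -(charge_integral_lin nu c d mP mQ (nphi P hP) (nphi Q hQ)).
  rewrite -[X in X + _]mul1r -[X in _ + X]mul1r.
  rewrite -(@charge_integral_lin nu _ _ ((`|c| + `|d| + 1) * (B + B'))) //.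
  - by congr charge_integral; apply/funext => x; rewrite !mul1r.
  - by apply: measurable_funD; apply: measurable_funM.
  - move=> x; apply: (le_trans (ler_normD _ _)); rewrite !normrM !mulrDl mul1r.
    apply: (@le_trans _ _ (`|c| * (B + B') + `|d| * (B + B'))); last by rewrite lerDl addr_ge0.
    by apply: lerD; rewrite ler_wpM2l // ?nphi.
  - move=> x; apply: (le_trans (npsi S hS x)); rewrite ler_peMl ?addr_ge0 //.
    by rewrite lerDr addr_ge0.
have reE nu : charge_integral nu (fun x : circle R => complex.Re (a * phi (val x) + psi (val x))) =
    complex.Re a * charge_integral nu (fun x => complex.Re (phi (val x)))
    + (- complex.Im a) * charge_integral nu (fun x => complex.Im (phi (val x)))
    + charge_integral nu (fun x => complex.Re (psi (val x))).
  rewrite -key //; congr charge_integral; apply/funext => x.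
  by rewrite cReD cReM mulNr.
have imE nu : charge_integral nu (fun x : circle R => complex.Im (a * phi (val x) + psi (val x))) =
    complex.Re a * charge_integral nu (fun x => complex.Im (phi (val x)))
    + complex.Im a * charge_integral nu (fun x => complex.Re (phi (val x)))
    + charge_integral nu (fun x => complex.Im (psi (val x))).
  rewrite -key //; congr charge_integral; apply/funext => x.
  by rewrite cImD cImM.
rewrite /cm_integral !reE !imE.
set x1 := charge_integral _ _; set x2 := charge_integral _ _; set x3 := charge_integral _ _.
set x4 := charge_integral _ _; set x5 := charge_integral _ _; set x6 := charge_integral _ _.
set x7 := charge_integral _ _; set x8 := charge_integral _ _.
clearbody x1 x2 x3 x4 x5 x6 x7 x8; clear.
by apply: complex_eqP; rewrite ?cReD ?cImD ?cReM ?cImM /=; ring.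
Qed.

(** Four real charge integrals, each at most M V, give the factor 4. *)
Lemma cm_integral_le mu phi (M V : R) : disc_cont phi -> 0 <= M ->
  (forall w, normc w = 1 -> normc (phi w) <= M) -> (Defs.total_variation mu <= V%:E)%E ->
  normc (cm_integral mu (fun x => phi (val x))) <= 4 * M * V.
Proof.
move=> cphi M0 hM hV.
have cR := @continuous_Re R; have cI := @continuous_Im R.
have nx x : normc (phi (val (x : circle R))) <= M by apply: hM; rewrite normc_circle.
have key (nu : {charge set T -> \bar R}) (P : R[i] -> R) :
    (forall A, `|fine (nu A)| <= normc (cm_value mu A)) ->
    continuous P -> (forall w, `|P w| <= normc w) ->
    `|charge_integral nu (fun x => P (phi (val x)))| <= M * V.
  move=> hnu cP hP; apply: charge_integral_le => //.
  - exact: (measurable_disc_cont cP cphi).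
  - by move=> x; apply: le_trans (hP _) (nx x).
  - move=> Q N mQ mN QN QN0; apply: le_trans (total_variation_two hV mQ mN QN QN0).
    by apply: lerD.
have h1 A : `|fine (re_part mu A)| <= normc (cm_value mu A) by exact: (abs_Re_le (cm_value mu A)).
have h2 A : `|fine (im_part mu A)| <= normc (cm_value mu A) by exact: (abs_Im_le (cm_value mu A)).
apply: (le_trans (normc_le_ReIm _)) => /=.
have -> : 4 * M * V = (M * V + M * V) + (M * V + M * V) by ring.
by apply: lerD; [apply: (le_trans (ler_normB _ _))|apply: (le_trans (ler_normD _ _))];
  apply: lerD; apply: key => //; (exact: abs_Re_le || exact: abs_Im_le).
Qed.

(** Expanding the Cauchy kernel in powers of conj x times z shows that these are the Taylor
    coefficients of the Cauchy transform. *)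
Definition cm_moment mu n := cm_integral mu (fun x => conjc (val x) ^+ n).

Lemma cm_integral0 mu : cm_integral mu (fun=> 0) = 0.
Proof.
have h := @cm_integral_lin mu (fun=> 0) (fun=> 0) (-1) (@disc_cont_cst 0) (@disc_cont_cst 0).
have z0 (x : R[i]) : -1 * x + x = 0 by rewrite mulN1r addNr.
apply: (etrans _ (etrans h (z0 _))); congr cm_integral; apply/funext => x.
by rewrite mulr0 addr0.
Qed.

Lemma disc_cont_conj_poly (c : nat -> R[i]) N :
  disc_cont (fun w => \sum_(n < N) c n * conjc w ^+ n).
Proof.
apply: (@disc_cont_sum _ _ (fun (n : 'I_N) w => c n * conjc w ^+ n)) => n.
exact: (@disc_contM (fun=> c n) _ (@disc_cont_cst (c n)) (@disc_contX (fun w => conjc w) n disc_cont_conj)).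
Qed.

Lemma cm_integral_conj_poly mu (c : nat -> R[i]) N :
  cm_integral mu (fun x => \sum_(n < N) c n * conjc (val x) ^+ n) =
  \sum_(n < N) c n * cm_moment mu n.
Proof.
elim: N => [|N IH].
  by rewrite big_ord0 -[RHS](cm_integral0 mu); congr cm_integral; apply/funext => x; rewrite big_ord0.
rewrite big_ord_recr /= -IH addrC.
rewrite -(@cm_integral_lin mu (fun w => conjc w ^+ N) (fun w => \sum_(n < N) c n * conjc w ^+ n)).
- by congr cm_integral; apply/funext => x; rewrite big_ord_recr /= addrC.
- exact: (@disc_contX (fun w => conjc w) N disc_cont_conj).
- exact: (@disc_cont_conj_poly c N).
Qed.

(** The N-th remainder of the geometric series of the kernel is at most rho^N / (1 - rho) on the
    circle and is integrated against [mu]. *)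
Lemma cauchy_transform_ps mu (V : R) : (Defs.total_variation mu <= V%:E)%E ->
  has_ps (cauchy_transform mu) (cm_moment mu).
Proof.
move=> hV rho /andP[r0 r1].
(* From the partition of the circle into itself and the empty set. *)
have V0 : 0 <= V.
  have := total_variation_two hV (@measurableT _ T) (@measurable0 _ T) (setU0 _) (setI0 _).
  by apply: le_trans; rewrite addr_ge0 ?normc_ge0.
exists (4 * (1 - rho)^-1 * V), rho; split.
- by rewrite !mulr_ge0 // invr_ge0 subr_ge0 ltW.
- by rewrite ltW.
move=> z zr N; have z1 := le_lt_trans zr r1.
have cc := disc_cont_cauchy z1.
have cz : disc_cont (fun w => conjc w * z) by exact: (disc_contM disc_cont_conj (@disc_cont_cst z)).
have nz w : normc w = 1 -> normc (conjc w * z) <= rho by move=> w1; rewrite normcM normc_conj w1 mul1r.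
pose psi w := (conjc w * z) ^+ N * (1 - conjc w * z)^-1.
have cpsi : disc_cont psi by exact: (@disc_contM (fun w => (conjc w * z) ^+ N) _ (@disc_contX (fun w => conjc w * z) N cz) cc).
pose pol w := \sum_(n < N) z ^+ n * conjc w ^+ n.
have cpol : disc_cont pol := @disc_cont_conj_poly (fun n => z ^+ n) N.
have -> : cauchy_transform mu z - \sum_(n < N) cm_moment mu n * z ^+ n =
    cm_integral mu (fun x => psi (val x)).
  have -> : \sum_(n < N) cm_moment mu n * z ^+ n = cm_integral mu (fun x => pol (val x)).
    by rewrite /pol cm_integral_conj_poly; apply: eq_bigr => n _; rewrite mulrC.
  apply/eqP; rewrite subr_eq -[X in _ == X + _]mul1r -cm_integral_lin //; apply/eqP.
  rewrite /cauchy_transform; congr cm_integral; apply/funext => x.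
  rewrite mul1r /psi /pol -geometric_sum ?subrK //.
  rewrite (_ : \sum_(n < N) _ = \sum_(n < N) (conjc (val x) * z) ^+ n); last first.
    by apply: eq_bigr => n _; rewrite exprMn mulrC.
  by rewrite subrK.
  apply/eqP => h; have := nz _ (normc_circle x).
  by rewrite h normc1 leNgt r1.
have -> : 4 * (1 - rho)^-1 * V * rho ^+ N = 4 * (rho ^+ N * (1 - rho)^-1) * V by ring.
apply: cm_integral_le => //.
  by rewrite mulr_ge0 ?exprn_ge0 // ?(ltW r0) // invr_ge0 subr_ge0 ltW.
move=> w w1; rewrite /psi normcM; apply: ler_pM; rewrite ?normc_ge0 //.
  by rewrite normcX lerXn2r ?nnegrE ?normc_ge0 ?nz // ltW.
have n1 : 0 < 1 - normc (conjc w * z) by rewrite subr_gt0 (le_lt_trans (nz w w1)).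
have n2 : 1 - normc (conjc w * z) <= normc (1 - conjc w * z).
  by apply: le_trans (lerB_normc _ _); rewrite normc1.
rewrite normcV lef_pV2 ?posrE ?subr_gt0 //; last exact: lt_le_trans n1 n2.
by apply: le_trans n2; rewrite lerD2l lerN2; exact: nz.
Qed.

End CircleMeasures.

(** * Polynomials as analytic functions *)

Section Polynomials.
Context {R : realType}.

Lemma poly_cder (a : nat -> R[i]) N z : exists l, cder (fun z => \sum_(n < N) a n * z ^+ n) z l.
Proof.
elim: N => [|N [l IH]].
  exists 0; rewrite (_ : (fun _ => _) = fun=> 0); first exact: cder_cst.
  by apply/funext => w; rewrite big_ord0.
have [k hk] := cder_exp N z.
exists (l + (0 * z ^+ N + a N * k)).
rewrite (_ : (fun _ => _) = fun w => (\sum_(n < N) a n * w ^+ n) + a N * w ^+ N).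
  exact: (cderD IH (cderM (cder_cst (a N) z) hk)).
by apply/funext => w; rewrite big_ord_recr.
Qed.

Lemma poly_analytic (a : nat -> R[i]) N : analytic (fun z => \sum_(n < N) a n * z ^+ n).
Proof. by move=> z _; have [l /cderP[]] := poly_cder a N z. Qed.

Lemma poly_continuous (a : nat -> R[i]) N : continuous (fun z : R[i] => \sum_(n < N) a n * z ^+ n).
Proof. by move=> w; have [l /cder_continuous] := poly_cder a N w. Qed.

Lemma pow_continuous n : continuous (fun z : R[i] => z ^+ n).
Proof. by move=> w; have [l /cder_continuous] := cder_exp n w. Qed.

End Polynomials.

(** * Moments along a segment, and the expansions of [Tg] and [GH2] *)

Section PathMoments.
Context {R : realType}.
Local Notation lam := (@lebesgue_measure R).
Implicit Types (f g h F : R[i] -> R[i]) (a : nat -> R[i]) (z w : R[i]).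

(** For [h] the derivative of [g] these are the numbers b_n of the overview. *)
Definition path_moment h n z := path_integral (fun u => h u * u ^+ n) z.

(** The passage from path integrals to moments: [F] is replaced by a polynomial uniformly along the
    segment. With e = 0 the formula is exact. *)
Lemma path_integral_approx h F a N (e B : R) z : normc z <= 1 ->
  (forall w, normc w <= normc z -> {for w, continuous h}) ->
  (forall w, normc w <= normc z -> {for w, continuous F}) ->
  (forall w, normc w <= normc z -> normc (h w) <= B) ->
  (forall w, normc w <= normc z -> normc (F w - \sum_(n < N) a n * w ^+ n) <= e) ->
  normc (path_integral (fun u => F u * h u) z - \sum_(n < N) a n * path_moment h n z) <= 2 * (e * B).
Proof.
move=> z1 ch cF hB hF.
have mD : @measurable _ (measurableTypeR R) `[0, 1] by exact: measurable_itv.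
have i1 (n : 'I_N) : cintegrable lam `[0, 1] (fun t => h (t%:C * z) * (t%:C * z) ^+ n).
  apply: (@cintegrable_segment R (fun u => h u * u ^+ n) z) => w wz.
  exact: (ccontM (ch w wz) (@pow_continuous R n w)).
have i2 : cintegrable lam `[0, 1] (fun t => F (t%:C * z) * h (t%:C * z)).
  apply: (@cintegrable_segment R (fun u => F u * h u) z) => w wz.
  exact: (ccontM (cF w wz) (ch w wz)).
have i3 (n : 'I_N) := @cintegrableZ _ _ _ lam _ (a n) _ mD (i1 n).
have i4 := @cintegrable_sum _ _ _ lam _ _ (index_enum 'I_N)
  (fun (n : 'I_N) (t : R) => a n * (h (t%:C * z) * (t%:C * z) ^+ n)) mD i3.
have -> : path_integral (fun u => F u * h u) z - \sum_(n < N) a n * path_moment h n z =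
    z * cint lam `[0, 1] (fun t => F (t%:C * z) * h (t%:C * z) -
      \sum_(n < N) a n * (h (t%:C * z) * (t%:C * z) ^+ n)).
  rewrite (@cintB _ _ _ lam _ _ _ mD i2 i4) mulrBr (path_integralE (fun u => F u * h u)); congr (_ - _).
  rewrite (@cint_sum _ _ _ lam _ _ _ (fun (n : 'I_N) (t : R) => a n * (h (t%:C * z) * (t%:C * z) ^+ n)) mD i3).
  rewrite mulr_sumr; apply: eq_bigr => n _.
  by rewrite (@cintZ _ _ _ lam _ (a n) _ mD (i1 n)) /path_moment path_integralE mulrCA.
have i5 := @cintegrableB _ _ _ lam _ _ _ mD i2 i4.
have bnd : normc (cint lam `[0, 1] (fun t => F (t%:C * z) * h (t%:C * z) -
      \sum_(n < N) a n * (h (t%:C * z) * (t%:C * z) ^+ n))) <= 2 * (e * B) * (1 - 0).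
  apply: (@normc_cint_itv_le R 0 1 _ _ ler01 i5) => t t01; have tz := normc_segment z t01.
  rewrite (_ : _ - _ = (F (t%:C * z) - \sum_(n < N) a n * (t%:C * z) ^+ n) * h (t%:C * z)).
    by rewrite normcM; apply: ler_pM; rewrite ?normc_ge0 ?hF ?hB.
  by rewrite mulrBl mulr_suml; congr (_ - _); apply: eq_bigr => n _; ring.
rewrite subr0 mulr1 in bnd; rewrite normcM; apply: le_trans bnd.
by rewrite ler_piMl // normc_ge0.
Qed.

Lemma path_moment_le h (B : R) n z : normc z <= 1 ->
  (forall w, normc w <= normc z -> {for w, continuous h}) ->
  (forall w, normc w <= normc z -> normc (h w) <= B) ->
  normc (path_moment h n z) <= 2 * B * normc z ^+ n.
Proof.
move=> z1 ch hB.
have i1 : cintegrable lam `[0, 1] (fun t => h (t%:C * z) * (t%:C * z) ^+ n).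
  apply: (@cintegrable_segment R (fun u => h u * u ^+ n) z) => w wz.
  exact: (ccontM (ch w wz) (@pow_continuous R n w)).
have bnd : normc (cint lam `[0, 1] (fun t => h (t%:C * z) * (t%:C * z) ^+ n)) <=
    2 * (B * normc z ^+ n) * (1 - 0).
  apply: (@normc_cint_itv_le R 0 1 _ _ ler01 i1) => t t01; have tz := normc_segment z t01.
  rewrite normcM normcX; apply: ler_pM; rewrite ?exprn_ge0 ?normc_ge0 ?hB //.
  by rewrite lerXn2r ?nnegrE ?normc_ge0.
rewrite subr0 mulr1 mulrA in bnd; rewrite /path_moment path_integralE normcM; apply: le_trans bnd.
by rewrite ler_piMl // normc_ge0.
Qed.

Lemma path_moment_monomial n j (z : R[i]) :
  path_moment (fun u => u ^+ n) j z = z ^+ (n + j).+1 / (n + j).+1%:R.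
Proof.
have mD : @measurable _ (measurableTypeR R) `[0, 1] by exact: measurable_itv.
have ic : cintegrable lam `[0, 1] (fun t => t%:C ^+ (n + j)).
  apply: cintegrable_continuous; apply: continuous_subspaceT => t.
  exact: (ccontX (n := (n + j)%N) (@continuous_real_complex R t)).
rewrite /path_moment path_integralE.
transitivity (z * cint lam `[0, 1] (fun t => z ^+ (n + j) * t%:C ^+ (n + j))).
  by congr (_ * _); apply: eq_cint => t _; rewrite -exprD -exprMn mulrC.
rewrite (@cintZ _ _ _ lam _ _ _ mD ic) integral_monomial exprS -mulrA.
by congr (_ * (_ * _)); rewrite fmorphV rmorph_nat.
Qed.

(** Here [h] is the approximated factor and u^0 the other one, so the moments are explicit by
    [path_moment_monomial]. *)
Lemma path_integral_analytic h a : has_ps h a -> analytic (path_integral h).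
Proof.
move=> ha; suff hp : has_ps (path_integral h) (fun n => if n is m.+1 then a m / m.+1%:R else 0).
  exact: has_ps_analytic hp.
move=> rho hr; have [K [q [K0 hq hK]]] := ha _ hr.
have /andP[r0 r1] := hr; have /andP[q0 q1] := hq.
(* Integration shifts the coefficients by one, so the bound loses one power of the ratio; the
   maximum with 1/2 allows dividing by [p] even when [q] is 0. *)
pose p := Num.max q (1 / 2).
have p0 : 0 < p by rewrite lt_max; apply/orP; right; lra.
have qp : q <= p by rewrite le_max lexx.
exists (2 * K / p), p; split.
- by rewrite divr_ge0 ?mulr_ge0 // ltW.
- by rewrite ltW //= gt_max q1; lra.
move=> z zr N; have z1 := le_lt_trans zr r1.
have main n : normc (path_integral h z - \sum_(i < n) a i / i.+1%:R * z ^+ i.+1) <= 2 * K * q ^+ n.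
  have -> : path_integral h z = path_integral (fun u => h u * u ^+ 0) z.
    by rewrite (_ : (fun u => h u * u ^+ 0) = h) //; apply/funext => u; exact: mulr1.
  have -> : \sum_(i < n) a i / i.+1%:R * z ^+ i.+1 = \sum_(i < n) a i * path_moment (fun u => u ^+ 0) i z.
    by apply: eq_bigr => i _; rewrite path_moment_monomial mulrAC mulrA.
  have -> : 2 * K * q ^+ n = 2 * (K * q ^+ n * 1) by ring.
  apply: (path_integral_approx (ltW z1)) => w wz; have wr := le_trans wz zr.
  - exact: pow_continuous.
  - by apply: (has_ps_continuous ha); exact: le_lt_trans wr r1.
  - by rewrite normc1.
  - exact: hK.
case: N => [|n].
  have := main 0%N; rewrite !big_ord0 !expr0 !mulr1 => /le_trans; apply.
  by rewrite ler_pdivlMr // ler_piMr ?mulr_ge0 //= ltW // gt_max q1; lra.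
rewrite big_ord_recl mul0r add0r; apply: (le_trans (main n)).
rewrite exprS mulrA divfK ?lt0r_neq0 // ler_wpM2l ?mulr_ge0 //.
by rewrite lerXn2r ?nnegrE // ltW.
Qed.

Lemma analytic_Tg g f : analytic g -> analytic f -> analytic (Tg g f).
Proof.
move=> ag af; have [a ha] := analytic_has_ps (analyticM af (analytic_derive ag)).
exact: path_integral_analytic ha.
Qed.

Section AnalyticSymbol.
Variable g : R[i] -> R[i].
Hypothesis ag : analytic g.
Let h := derive1 g.

Lemma derivative_bounded z : normc z < 1 -> exists2 B : R, 0 <= B &
  (forall w, normc w <= normc z -> {for w, continuous h}) /\
  forall w, normc w <= normc z -> normc (h w) <= B.
Proof.
move=> z1; have ch w : normc w <= normc z -> {for w, continuous h}.
  by move=> wz; apply: (analytic_continuous (analytic_derive ag)); exact: le_lt_trans wz z1.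
by have [B B0 hB] := disc_bounded ch; exists B.
Qed.

Lemma path_moment_decay z : normc z < 1 -> exists2 M : R, 0 <= M &
  forall n, normc (path_moment h n z) <= M * normc z ^+ n.
Proof.
move=> z1; have [B B0 [ch hB]] := derivative_bounded z1; exists (2 * B); first by rewrite mulr_ge0.
by move=> n; apply: path_moment_le (ltW z1) ch hB.
Qed.

Lemma Tg_poly a N z : normc z < 1 ->
  Tg g (fun u => \sum_(n < N) a n * u ^+ n) z = \sum_(n < N) a n * path_moment h n z.
Proof.
move=> z1; have [B B0 [ch hB]] := derivative_bounded z1.
apply/eqP; rewrite -subr_eq0 -normc_eq0 eq_le normc_ge0 andbT.
have -> : 0 = 2 * (0 * B) :> R by rewrite mul0r mulr0.
apply: (path_integral_approx (ltW z1) ch _ hB) => [w _|w _]; first exact: poly_continuous.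
by rewrite subrr normc0.
Qed.

(** The constant [B] is chosen before [f] and its coefficients, so that in [Tg_bound] it serves all
    dilates of a function at once. *)
Lemma Tg_series (rho : R) z : normc z <= rho -> rho < 1 -> exists2 B : R, 0 <= B &
  forall f a (K q : R),
  (forall w, normc w <= rho -> forall N, normc (f w - \sum_(n < N) a n * w ^+ n) <= K * q ^+ N) ->
  (forall w, normc w <= rho -> {for w, continuous f}) ->
  forall N, normc (Tg g f z - \sum_(n < N) a n * path_moment h n z) <= B * K * q ^+ N.
Proof.
move=> zr r1; have z1 := le_lt_trans zr r1.
have [B B0 [ch hB]] := derivative_bounded z1.
exists (2 * B); first by rewrite mulr_ge0.
move=> f a K q hK cf N; have -> : 2 * B * K * q ^+ N = 2 * (K * q ^+ N * B) by ring.
apply: (path_integral_approx (ltW z1) ch _ hB) => w wz.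
  by apply: cf; exact: le_trans wz zr.
by apply: hK; exact: le_trans wz zr.
Qed.

(** After conjugation the kernel is a geometric series in conj w u, whose ratio has modulus at most
    [rho] along the segment because |u| <= |z| < 1. *)
Lemma GH2_has_ps z : normc z < 1 -> has_ps (GH2 g z) (fun n => conjc (path_moment h n z)).
Proof.
move=> z1 rho /andP[r0 r1]; have [B B0 [ch hB]] := derivative_bounded z1.
exists (2 * B / (1 - rho)), rho; split.
- by rewrite divr_ge0 ?mulr_ge0 // subr_ge0 ltW.
- by rewrite ltW.
move=> w wr N.
have wu u : normc u <= normc z -> normc (conjc w * u) <= rho.
  move=> uz; rewrite normcM normc_conj -[leRHS]mulr1; apply: ler_pM; rewrite ?normc_ge0 //.
  exact: le_trans uz (ltW z1).
have nz u : normc u <= normc z -> 1 - rho <= normc (1 - conjc w * u).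
  move=> uz; apply: (le_trans _ (lerB_normc _ _)); rewrite normc1 lerD2l lerN2; exact: wu.
have d0 : 0 < 1 - rho by rewrite subr_gt0.
have n0 u : normc u <= normc z -> 1 - conjc w * u != 0.
  by move=> uz; rewrite -normc_gt0; exact: lt_le_trans d0 (nz u uz).
have := @path_integral_approx h (fun u => (1 - conjc w * u)^-1) (fun n => conjc w ^+ n) N
  (rho ^+ N / (1 - rho)) B z (ltW z1) ch.
have -> : 2 * (rho ^+ N / (1 - rho) * B) = 2 * B / (1 - rho) * rho ^+ N by ring.
move=> key; have {key} := key _ hB _.
have -> : normc (GH2 g z w - \sum_(n < N) conjc (path_moment h n z) * w ^+ n) =
  normc (path_integral (fun u => (1 - conjc w * u)^-1 * h u) z -
    \sum_(n < N) conjc w ^+ n * path_moment h n z).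
  rewrite -[RHS]normc_conj cconjB cconj_sum; congr (normc (_ - _)).
    transitivity (conjc (path_integral (fun u => h u * (1 - conjc w * u)^-1) z)); first by [].
    rewrite (_ : (fun u => h u * _) = (fun u => (1 - conjc w * u)^-1 * h u)) //.
    by apply/funext => u; exact: mulrC.
  by apply: eq_bigr => n _; rewrite [RHS]cconjM cconjX conjcK mulrC.
apply => u uz.
  exact: (ccontV (ccontB ccont_cst (ccontM ccont_cst cvg_id)) (n0 u uz)).
have -> : (1 - conjc w * u)^-1 - \sum_(n < N) conjc w ^+ n * u ^+ n = (conjc w * u) ^+ N / (1 - conjc w * u).
  rewrite -geometric_sum; last first.
    by have := n0 u uz; rewrite subr_eq0 eq_sym.
  by congr (_ - _); apply: eq_bigr => n _; rewrite exprMn.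
rewrite normcM normcX normcV; apply: ler_pM; rewrite ?exprn_ge0 ?invr_ge0 ?normc_ge0 //.
  by rewrite lerXn2r ?nnegrE ?normc_ge0 ?(ltW r0) // wu.
by rewrite lef_pV2 ?posrE ?nz // (lt_le_trans d0) // nz.
Qed.

End AnalyticSymbol.
End PathMoments.

(** * Boundedness of operators in terms of real constants *)

Section Operators.
Context {R : realType}.
Implicit Types (f g : R[i] -> R[i]) (S : set R[i]) (T : (R[i] -> R[i]) -> R[i] -> R[i])
  (X : set (R[i] -> R[i])) (nX : (R[i] -> R[i]) -> \bar R).

Lemma sup_norm_le S f (B : R) : (sup_norm S f <= B%:E)%E <-> forall z, S z -> normc (f z) <= B.
Proof.
split=> [h z Sz|h].
  by rewrite -lee_fin; apply: le_trans h; apply: ereal_sup_ubound; exists z.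
by apply: ge_ereal_sup => _ [z Sz <-]; rewrite lee_fin; exact: h.
Qed.

Lemma sup_norm_ge0 S f z : S z -> (0 <= sup_norm S f)%E.
Proof.
move=> Sz; apply: (@le_trans _ _ (normc (f z))%:E); first by rewrite lee_fin normc_ge0.
by apply: ereal_sup_ubound; exists z.
Qed.

(** Passing from [c] to its absolute value makes the estimate monotone in the norm, so any real
    upper bound [B] of the norm can be inserted. *)
Lemma bounded_into_Hinfty T X nX : bounded_operator T X nX Hinfty (sup_norm disc) ->
  exists2 C, 0 <= C & forall f (B : R), X f -> (0 <= nX f)%E -> (nX f <= B%:E)%E ->
    forall z, normc z < 1 -> normc (T f z) <= C * B.
Proof.
move=> [_ [c hc]]; exists `|c|; first exact: normr_ge0.
move=> f B Xf; have := hc f Xf; case: (nX f) => [x| |] // h x0 xB z /discE dz.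
rewrite lee_fin in x0; rewrite lee_fin in xB; rewrite -EFinM in h.
have /(sup_norm_le _ _ _).1/(_ z dz)/le_trans := h; apply.
apply: (le_trans (ler_norm _)); rewrite normrM ler_wpM2l // ger0_norm //.
Qed.

Lemma Hinfty_bounded T X nX (C : R) : 0 <= C -> (forall f, X f -> analytic (T f)) ->
  (forall f, X f -> exists2 B, nX f = B%:E & forall z, normc z < 1 -> normc (T f z) <= C * B) ->
  bounded_operator T X nX Hinfty (sup_norm disc).
Proof.
move=> C0 aT hT; split=> [f Xf|].
  split; first exact: aT.
  have [B _ hB] := hT f Xf; apply: (@le_lt_trans _ _ (C * B)%:E); last exact: ltry.
  by apply/sup_norm_le => z /discE; exact: hB.
exists C => f Xf; have [B -> hB] := hT f Xf; rewrite -EFinM.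
by apply/sup_norm_le => z /discE; exact: hB.
Qed.

Lemma disc0 : @disc R 0.
Proof. by apply/discE; rewrite normc0. Qed.

Lemma sup_norm_fin S f z : S z -> (sup_norm S f < +oo)%E -> exists2 B, sup_norm S f = B%:E & 0 <= B.
Proof.
move=> Sz; have := sup_norm_ge0 f Sz; case: (sup_norm S f) => [B| |] //; rewrite lee_fin => B0 _.
by exists B.
Qed.

Lemma has_ps_ext f g (a : nat -> R[i]) : (forall z, disc z -> f z = g z) -> has_ps f a -> has_ps g a.
Proof.
move=> fg ha rho hr; have [K [q [K0 hq hK]]] := ha rho hr; exists K, q; split => // z zr N.
have /andP[_ r1] := hr; rewrite -fg ?hK //.
by apply/discE; exact: le_lt_trans zr r1.
Qed.

Lemma has_ps_eq f g (a : nat -> R[i]) z : has_ps f a -> has_ps g a -> normc z < 1 -> f z = g z.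
Proof.
move=> hf hg /disc_radius[rho hr zr].
have [K [q [K0 hq hK]]] := hf _ hr; have [K' [q' [K'0 hq' hK']]] := hg _ hr.
apply/eqP; rewrite -subr_eq0; apply/eqP.
apply: (@le_geometric_eq0 _ (Num.max q q') (K + K')).
- have /andP[? ?] := hq; have /andP[? ?] := hq'.
  by rewrite le_max gt_max; apply/andP; split; [apply/orP; left|apply/andP].
- exact: addr_ge0.
move=> N; apply: (le_trans (ler_normc_trans _ (\sum_(n < N) a n * z ^+ n) _)).
have /andP[? ?] := hq; have /andP[? ?] := hq'.
rewrite mulrDl; apply: lerD.
  apply: (le_trans (hK z zr N)); rewrite ler_wpM2l // lerXn2r ?nnegrE ?le_max ?lexx //.
  by apply/orP; left.
rewrite normcB; apply: (le_trans (hK' z zr N)); rewrite ler_wpM2l // lerXn2r ?nnegrE ?le_max ?lexx ?orbT //.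
by apply/orP; left.
Qed.

Lemma poly_abel_limit (c : nat -> R[i]) N (A : R) :
  (forall r : R, 0 < r < 1 -> normc (\sum_(n < N) c n * r%:C ^+ n) <= A) ->
  normc (\sum_(n < N) c n) <= A.
Proof.
move=> h; apply/ler_addgt0Pr => e e0.
have /cvgc_atP/(_ _ e0)[d d0 hd] := @poly_continuous R c N 1.
pose r := 1 - Num.min d 1 / 2.
have m0 : 0 < Num.min d 1 by rewrite lt_min d0 ltr01.
have m1 : Num.min d 1 <= 1 by rewrite ge_min lexx orbT.
have md : Num.min d 1 <= d by rewrite ge_min lexx.
have hr : 0 < r < 1 by rewrite /r; lra.
have rd : normc (r%:C - 1) < d.
  rewrite (_ : r%:C - 1 = (r - 1)%:C); last first.
    by apply: complex_eqP; [rewrite cReB|rewrite cImB /= subr0].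
  by rewrite normc_real ler0_norm; rewrite /r; lra.
have := hd _ rd; rewrite (_ : \sum_(n < N) c n * 1 ^+ n = \sum_(n < N) c n); last first.
  by apply: eq_bigr => n _; rewrite expr1n mulr1.
rewrite normcB => h1; have := h r hr => h2.
have := le_normcD (\sum_(n < N) c n - \sum_(n < N) c n * r%:C ^+ n) (\sum_(n < N) c n * r%:C ^+ n).
by rewrite subrK; lra.
Qed.

End Operators.

(** * Measures built from Fejer means *)

Section FejerMeasures.
Context {R : realType}.
Local Notation lam := (@lebesgue_measure R).
Local Notation T := (borel_circle R).
Local Notation arc := (@arc_measure R).
Implicit Types (phi psi : R[i] -> R[i]) (z w zt xi : R[i]).

Lemma sum_Rintegral_partition n (E : 'I_n -> set T) (u : T -> R) :
  (forall i, measurable (E i)) -> trivIset setT E -> \bigcup_i E i = setT ->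
  (arc : set T -> \bar R).-integrable setT (EFin \o u) ->
  \sum_(i < n) \int[arc]_(x in E i) u x = \int[arc]_x u x.
Proof.
move=> mE tE uE iu; rewrite /Rintegral.
rewrite sum_fine; last first.
  by move=> i _; apply: integrable_fin_num => //; exact: integrableS iu.
rewrite -(@integral_bigsetU_EFin _ _ _ arc _ E u (index_enum 'I_n)) //.
- by rewrite -bigcup_seq (_ : [set` _] = setT) ?uE //; apply/seteqP; split => // i _ /=; rewrite mem_index_enum.
- exact: index_enum_uniq.
- exact: sub_trivIset tE.
- rewrite -bigcup_seq (_ : [set` _] = setT) ?uE; first exact: measurable_int iu.
  by apply/seteqP; split => // i _ /=; rewrite mem_index_enum.
Qed.

Lemma cintegrable_arc_on phi (E : set T) : measurable E -> disc_cont phi ->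
  cintegrable arc E (fun x : T => phi (val x)).
Proof.
move=> mE cphi; apply: (cintegrableS (E := setT)) => //; exact: (cintegrable_arc cphi).
Qed.

Lemma sum_normc_cint_le n (E : 'I_n -> set T) phi (e : R) :
  (forall i, measurable (E i)) -> trivIset setT E -> \bigcup_i E i = setT ->
  disc_cont phi -> (forall w, normc w <= 1 -> normc (phi w) <= e) ->
  \sum_(i < n) normc (cint arc (E i) (fun x : T => phi (val x))) <= 2 * e * (2 * pi).
Proof.
move=> mE tE uE cphi he.
have a1 A : measurable A -> fine (arc A) = \int[arc]_(x in A) (1 : R).
  by move=> mA; rewrite Rintegral_cst // mul1r.
have -> : 2 * pi = \sum_(i < n) fine (arc (E i)) :> R.
  transitivity (\sum_(i < n) \int[arc]_(x in E i) (1 : R)); last first.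
    by apply: eq_bigr => i _; rewrite a1.
  rewrite (@sum_Rintegral_partition n E (fun=> 1)) //; last first.
    apply: (@integrable_bounded _ _ _ arc setT _ 1) => //; first exact: arc_measure_fin.
    by move=> x _; rewrite normr1.
  rewrite (@integral_arc _ (fun=> 1) (fun=> 1) 1) //; last by move=> x; rewrite normr1.
  by rewrite Rintegral_cst // mul1r fine_lebesgue_itv ?subr0 // ltW // two_pi_gt0.
rewrite mulr_sumr; apply: ler_sum => i _.
apply: (normc_cint_le (mE i)); first exact: arc_measure_fin.
  exact: (cintegrable_arc_on (mE i) cphi).
by move=> x _; apply: he; rewrite normc_circle.
Qed.

(** For a nonnegative function modulus and integral commute. Used for the Fejer kernel on the pieces
    of a partition and on the whole circle, so that the pieces add up exactly. *)
Lemma normc_cint_nonneg (E : set T) phi : measurable E -> disc_cont phi ->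
  (forall w, phi w = (normc (phi w))%:C) ->
  normc (cint arc E (fun x : T => phi (val x))) =
  \int[arc]_(x in E) normc (phi (val (x : circle R))).
Proof.
move=> mE cphi hphi; rewrite -[RHS]ger0_norm; last first.
  by apply: Rintegral_ge0 => x _; exact: normc_ge0.
rewrite -normc_real; congr normc; rewrite /cint; apply: complex_eqP => /=.
  by apply: eq_Rintegral => x _; rewrite hphi /= normc_real ger0_norm // normc_ge0.
transitivity (\int[arc]_(x in E) (0 : R)); last by rewrite Rintegral_cst // mul0r.
by apply: eq_Rintegral => x _; rewrite hphi.
Qed.

Definition mono (j k : nat) w := w ^+ j * conjc w ^+ k.

Lemma disc_cont_mono j k : disc_cont (mono j k).
Proof.
exact: (@disc_contM _ (fun w => w ^+ j) (fun w => conjc w ^+ k) (@disc_contX _ (fun w => w) j (@disc_cont_id R))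
  (@disc_contX _ (fun w => conjc w) k (@disc_cont_conj R))).
Qed.

Lemma cint_circ_mono j k : cint lam `[0, 2 * pi] (fun t => mono j k (cisC t)) =
  if j == k then (2 * pi)%:C else 0 :> R[i].
Proof. by rewrite -cint_cisXV; apply: eq_cint => t _; rewrite /mono cisC_conj. Qed.

(** On the circle w^j conj w^k depends only on j - k; keeping all N^2 pairs makes the Cesaro weight
    N - m appear as a number of pairs. *)
Definition bipoly N (q : nat -> nat -> R[i]) w := \sum_(p : 'I_N * 'I_N) q p.1 p.2 * mono p.1 p.2 w.

Lemma disc_cont_bipoly N q : disc_cont (bipoly N q).
Proof.
apply: (@disc_cont_sum _ _ _ (fun (p : 'I_N * 'I_N) w => q p.1 p.2 * mono p.1 p.2 w)) => p.
exact: (@disc_contM _ (fun=> q p.1 p.2) (mono p.1 p.2) (@disc_cont_cst R (q p.1 p.2)) (@disc_cont_mono p.1 p.2)).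
Qed.

Lemma cint_arc_bipoly N q (E : set T) : measurable E ->
  cint arc E (fun x : T => bipoly N q (val x)) =
  \sum_(p : 'I_N * 'I_N) q p.1 p.2 * cint arc E (fun x : T => mono p.1 p.2 (val x)).
Proof.
move=> mE; have im (p : 'I_N * 'I_N) : cintegrable arc E (fun x : T => mono p.1 p.2 (val x)).
  exact: (cintegrable_arc_on mE (@disc_cont_mono p.1 p.2)).
rewrite /bipoly (cint_sum _ mE (F := fun (p : 'I_N * 'I_N) (x : T) => q p.1 p.2 * mono p.1 p.2 (val x))).
  by apply: eq_bigr => p _; exact: (cintZ _ mE (im p)).
by move=> p; exact: (cintegrableZ _ mE (im p)).
Qed.

(** The expansion of D conj D over pairs of indices: for unimodular [zt] and [w], N times the Fejer
    kernel centred at [zt]. Positivity is expressed as equality with its own modulus. *)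
Lemma fejer_kernelE N zt w : normc (\sum_(j < N) (conjc zt * w) ^+ j) ^+ 2 =
  complex.Re (bipoly N (fun j k => conjc zt ^+ j * zt ^+ k) w) /\
  bipoly N (fun j k => conjc zt ^+ j * zt ^+ k) w =
  (normc (bipoly N (fun j k => conjc zt ^+ j * zt ^+ k) w))%:C.
Proof.
pose D := \sum_(j < N) (conjc zt * w) ^+ j.
have DD : bipoly N (fun j k => conjc zt ^+ j * zt ^+ k) w = D * conjc D.
  rewrite /D cconj_sum big_distrlr /= pair_big /=; apply: eq_bigr => p _.
  by rewrite cconjX cconjM conjcK !exprMn /mono; ring.
have DE : D * conjc D = (normc D ^+ 2)%:C.
  have := @normCK R[i] D; rewrite norm_normc => <-.
  by rewrite -rmorphXn.
rewrite -/D DD DE; split => //.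
by rewrite normc_real ger0_norm // exprn_ge0 // normc_ge0.
Qed.

(** Each k < N - m has exactly one partner j; truncated subtraction covers m >= N. *)
Lemma fejer_count N m : \sum_(p : 'I_N * 'I_N) (p.1 == p.2 + m :> nat)%N%:R = (N - m)%:R :> R[i].
Proof.
transitivity (\sum_(k < N) \sum_(j < N) (j == k + m :> nat)%N%:R : R[i]).
  by rewrite exchange_big pair_big.
transitivity (\sum_(k < N) (k < N - m)%N%:R : R[i]).
  apply: eq_bigr => k _; have -> : (k < N - m)%N = (k + m < N)%N by rewrite ltn_subRL addnC.
  have [kN|kN] := ltnP (k + m) N.
    rewrite (bigD1 (Ordinal kN)) //= eqxx big1 ?addr0 // => j jk.
    by rewrite (_ : (_ == _) = false) //; apply: contraNF jk => /eqP h; apply/eqP/val_inj.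
  rewrite big1 // => j _; rewrite (_ : (_ == _) = false) //; apply/eqP => h.
  by have := ltn_ord j; rewrite h ltnNge kN.
rewrite -natr_sum; congr (_%:R).
rewrite -[in RHS](card_ord (N - m)) -sum1_card (big_ord_widen N (fun=> 1%N)) ?leq_subr // [in RHS]big_mkcond /=.
by apply: eq_bigr => i _; case: (_ < _)%N.
Qed.

(* The density is the Cesaro mean of [sum_n conj (l_n) xi^(n - N + 1)] plus [corr].  Its variation
   over a partition is the functional [l] evaluated at an average of Fejer kernels with
   unimodular weights, and the positivity of the kernel bounds the norm of this average. *)
Lemma fejer_measure (C e : R) N (l : nat -> R[i]) corr : 0 <= C -> (0 < N)%N ->
  (forall c B, circle_bound C (N.-1 + N) c B -> normc (\sum_(n < N.-1 + N) c n * l n) <= B) ->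
  disc_cont corr -> (forall w, normc w <= 1 -> normc (corr w) <= e) ->
  exists mu : complex_measure, [/\ abs_continuous mu,
    (Defs.total_variation mu <= (C + 2 * e * (2 * pi))%:E)%E &
    forall m, cm_moment mu m = (N - m)%:R / N%:R * conjc (l (N.-1 + m)%N) +
      cint lam `[0, 2 * pi] (fun t => conjc (cisC t) ^+ m * corr (cisC t))].
Proof.
move=> C0 N0 dom ccorr he; have p0 : 0 < 2 * pi :> R := two_pi_gt0.
set K := N.-1.
have KN : K.+1 = N by rewrite /K prednK.
(* The frequency j - k, shifted by K = N - 1 to be a natural number; the subtraction is exact
   because k <= K. *)
pose idx (j k : nat) := (j + (K - k))%N.
pose q (j k : nat) := conjc (l (idx j k)).
(* Normalisation by 2 pi N, the integral of the kernel [U] below. *)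
pose a : R[i] := ((2 * pi * N%:R)^-1)%:C.
pose main w := a * bipoly N q w.
have cmain : disc_cont main.
  exact: (@disc_contM _ (fun=> a) (bipoly N q) (@disc_cont_cst R a) (@disc_cont_bipoly N q)).
pose dn w := main w + corr w.
have cdn : disc_cont dn by exact: (@disc_contD _ main corr cmain ccorr).
have [mu [amu vmu imu]] := density_measure cdn.
have N0' : 0 < N%:R :> R by rewrite ltr0n.
have NC : N%:R != 0 :> R[i] by rewrite pnatr_eq0 -lt0n.
have pC := @two_pi_neq0 R.
exists mu; split => //.
- apply: ge_ereal_sup => _ [n [E [mE tE uE ->]]]; rewrite lee_fin.
  have vE i : normc (cm_value mu (E i)) <= normc a * normc (cint arc (E i) (fun x : T => bipoly N q (val x)))
      + normc (cint arc (E i) (fun x : T => corr (val x))).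
    rewrite vmu //.
    have i1 := cintegrable_arc_on (mE i) (@disc_cont_bipoly N q).
    rewrite (cintD (mE i) (cintegrableZ a (mE i) i1) (cintegrable_arc_on (mE i) ccorr)).
    by rewrite (cintZ a (mE i) i1) -normcM; exact: le_normcD.
  apply: (le_trans (ler_sum _ (fun i _ => vE i))); rewrite big_split /=.
  apply: lerD; last exact: sum_normc_cint_le.
  rewrite -mulr_sumr.
  pose x i := cint arc (E i) (fun x : T => bipoly N q (val x)).
  (* The unimodular [s i] rotates the integral over [E i] onto the positive axis. *)
  have [s hs] : exists s : 'I_n -> R[i], forall i, normc (s i) = 1 /\ s i * x i = (normc (x i))%:C.
    have /choice[s hs] : forall i : 'I_n, exists s : R[i], normc s = 1 /\ s * x i = (normc (x i))%:C.
      by move=> i; have [u u1 u2] := rotation (x i); exists u.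
    by exists s.
  pose Q (j k : nat) := \sum_(i < n) conjc (s i) * conjc (cint arc (E i) (fun x : T => mono j k (val x))).
  (* Grouping the pairs by frequency makes the sum of the moduli |x i| the modulus of the functional
     [l] at the polynomial with coefficients [c]. *)
  pose c m := \sum_(p : 'I_N * 'I_N) (if idx p.1 p.2 == m then Q p.1 p.2 else 0).
  have idxlt (p : 'I_N * 'I_N) : (idx p.1 p.2 < K + N)%N.
    by rewrite /idx addnC -addnS; apply: leq_add; [exact: leq_subr|exact: ltn_ord].
  have collect (F : nat -> R[i]) :
      \sum_(m < K + N) c m * F m = \sum_(p : 'I_N * 'I_N) Q p.1 p.2 * F (idx p.1 p.2).
    transitivity (\sum_(m < K + N) \sum_(p : 'I_N * 'I_N) (if idx p.1 p.2 == m then Q p.1 p.2 else 0) * F m).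
      by apply: eq_bigr => m _; rewrite mulr_suml.
    rewrite exchange_big /=; apply: eq_bigr => p _.
    rewrite (bigD1 (Ordinal (idxlt p))) //= eqxx big1 ?addr0 // => m mp.
    rewrite (_ : (_ == _) = false) ?mul0r //.
    by apply: contraNF mp => /eqP h; apply/eqP/val_inj.
  have sumx : \sum_(i < n) normc (x i) = normc (\sum_(m < K + N) c m * l m).
    rewrite collect -[LHS]ger0_norm; last by apply: sumr_ge0 => i _; exact: normc_ge0.
    rewrite -normc_real.
    rewrite -[RHS]normc_conj; congr normc; rewrite cconj_sum.
    rewrite (_ : (\sum_(i < n) normc (x i))%:C = \sum_(i < n) s i * x i); last first.
      by rewrite (rmorph_sum (real_complex R)); apply: eq_bigr => i _; rewrite (hs i).2.
    transitivity (\sum_(i < n) \sum_(p : 'I_N * 'I_N) s i *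
       (q p.1 p.2 * cint arc (E i) (fun x : T => mono p.1 p.2 (val x)))).
      by apply: eq_bigr => i _; rewrite /x cint_arc_bipoly // mulr_sumr.
    rewrite exchange_big /=; apply: eq_bigr => p _; rewrite cconjM /Q cconj_sum mulr_suml.
    by apply: eq_bigr => i _; rewrite cconjM !conjcK /q; ring.
  rewrite sumx.
  have na : normc a = (2 * pi * N%:R)^-1.
    by rewrite /a normc_real ger0_norm // invr_ge0 mulr_ge0 // ltW.
  rewrite na ler_pdivrMl; last by rewrite mulr_gt0.
  rewrite mulrC.
  (* It remains to bound this polynomial by 2 pi N at each point [zt] of the circle. *)
  apply: dom => zt z1; rewrite ler_wpM2l //.
  pose U := bipoly N (fun j k => conjc zt ^+ j * zt ^+ k).
  have cU : disc_cont U := @disc_cont_bipoly N _.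
  have UE w : U w = (normc (U w))%:C := (fejer_kernelE N zt w).2.
  have zz : conjc zt * zt = 1.
    by have := @normCK R[i] zt; rewrite norm_normc z1 expr1n mulrC => <-.
  (* Evaluation at [zt] recombines the monomials into the kernel [U]; the factor [zt ^+ K], of
     modulus 1, comes from the shift in [idx]. *)
  have -> : \sum_(m < K + N) c m * zt ^+ m =
      zt ^+ K * \sum_(i < n) conjc (s i) * conjc (cint arc (E i) (fun x : T => U (val x))).
    rewrite collect.
    transitivity (\sum_(p : 'I_N * 'I_N) zt ^+ K * (Q p.1 p.2 * (zt ^+ p.1 * conjc zt ^+ p.2))).
      apply: eq_bigr => p _; rewrite /idx exprD.
      have pK : (p.2 <= K)%N by rewrite -ltnS KN.
      rewrite -[in zt ^+ K](subnK pK) exprD.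
      have h : zt ^+ p.2 * conjc zt ^+ p.2 = 1 by rewrite -exprMn mulrC zz expr1n.
      transitivity (Q p.1 p.2 * (zt ^+ p.1 * zt ^+ (K - p.2)) * (zt ^+ p.2 * conjc zt ^+ p.2)).
        by rewrite h mulr1.
      by ring.
    rewrite -mulr_sumr; congr (_ * _).
    transitivity (\sum_(p : 'I_N * 'I_N) \sum_(i < n) conjc (s i) * (zt ^+ p.1 * conjc zt ^+ p.2 *
        conjc (cint arc (E i) (fun x : T => mono p.1 p.2 (val x))))).
      by apply: eq_bigr => p _; rewrite mulr_suml; apply: eq_bigr => i _; ring.
    rewrite exchange_big; apply: eq_bigr => i _; rewrite -mulr_sumr; congr (_ * _).
    have -> := @cint_arc_bipoly N (fun j k => conjc zt ^+ j * zt ^+ k) _ (mE i).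
    rewrite cconj_sum; apply: eq_bigr => p _.
    by rewrite !cconjM !cconjX conjcK.
  rewrite normcM normcX z1 expr1n mul1r; apply: (le_trans (ler_normc_sum _ _ _)).
  apply: (@le_trans _ _ (\sum_(i < n) \int[arc]_(x in E i) normc (U (val (x : circle R))))).
    apply: ler_sum => i _; rewrite normcM !normc_conj (hs i).1 mul1r.
    by rewrite (normc_cint_nonneg (mE i) cU UE).
  have iU : (arc : set T -> \bar R).-integrable setT (EFin \o (fun x : T => normc (U (val x)))).
    have [iR _] := cintegrable_arc cU; apply: eq_integrable iR => // y _ /=.
    by rewrite {1}UE.
  rewrite (sum_Rintegral_partition mE tE uE iU).
  rewrite -(normc_cint_nonneg measurableT cU UE).
  rewrite cint_arc_bipoly //.
  rewrite (_ : \sum_p _ = \sum_(p : 'I_N * 'I_N) (2 * pi)%:C * (p.1 == p.2 + 0 :> nat)%N%:R).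
    by rewrite -mulr_sumr fejer_count subn0 normcM normc_real normc_nat ger0_norm // ltW.
  apply: eq_bigr => p _; rewrite (cint_arc (@disc_cont_mono p.1 p.2)) cint_circ_mono addn0.
  case: eqP => [->|_]; last by rewrite !mulr0.
  by rewrite -exprMn zz expr1n mul1r mulr1.
- move=> m; pose cm w := conjc w ^+ m.
  have ccm : disc_cont cm := @disc_contX _ (fun w => conjc w) m (@disc_cont_conj R).
  rewrite /cm_moment (imu _ ccm).
  have cc phi : disc_cont phi -> cintegrable lam `[0, 2 * pi] (fun t => phi (cisC t)).
    by move=> cphi; apply: cintegrable_circ; exact: (continuous_disc_cis cphi).
  have i2 := cc _ (@disc_contM _ cm corr ccm ccorr).
  have i1 (p : 'I_N * 'I_N) := cc _ (@disc_cont_mono p.1 (p.2 + m)%N).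
  have mD : @measurable _ (measurableTypeR R) `[0, 2 * pi] by exact: measurable_itv.
  have i4 (p : 'I_N * 'I_N) := @cintegrableZ _ _ _ lam _ (q p.1 p.2) _ mD (i1 p).
  transitivity (cint lam `[0, 2 * pi] (fun t => a * \sum_(p : 'I_N * 'I_N) q p.1 p.2 * mono p.1 (p.2 + m)%N (cisC t)
      + cm (cisC t) * corr (cisC t))).
    apply: eq_cint => t _; rewrite /dn mulrDr; congr (_ + _).
    rewrite /main mulrCA; congr (_ * _); rewrite /bipoly mulr_sumr; apply: eq_bigr => p _.
    by rewrite /mono /cm exprD; ring.
  have i3 : cintegrable lam `[0, 2 * pi] (fun t => \sum_(p : 'I_N * 'I_N) q p.1 p.2 * mono p.1 (p.2 + m)%N (cisC t)).
    apply: (@cintegrable_sum _ _ _ lam _ _ _ (fun (p : 'I_N * 'I_N) (t : R) => q p.1 p.2 * mono p.1 (p.2 + m)%N (cisC t)) mD) => p.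
    exact: (i4 p).
  rewrite (@cintD _ _ _ lam _ _ _ mD (@cintegrableZ _ _ _ lam _ a _ mD i3) i2).
  rewrite (@cintZ _ _ _ lam _ a _ mD i3); congr (_ + _).
  rewrite (@cint_sum _ _ _ lam _ _ _ (fun (p : 'I_N * 'I_N) (t : R) => q p.1 p.2 * mono p.1 (p.2 + m)%N (cisC t)) mD); last first.
    by move=> p; exact: (i4 p).
  (* Orthogonality keeps the pairs with j = k + m, on which [idx] is constantly K + m; [fejer_count]
     finds N - m of them. *)
  transitivity (a * \sum_(p : 'I_N * 'I_N) conjc (l (K + m)%N) * (2 * pi)%:C * (p.1 == p.2 + m :> nat)%N%:R).
    congr (_ * _); apply: eq_bigr => p _; rewrite (@cintZ _ _ _ lam _ _ _ mD (i1 p)) cint_circ_mono /q /idx.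
    case: eqP => [->|_]; last by rewrite !mulr0.
    rewrite mulr1; congr (conjc (l _) * _).
    have pK : (p.2 <= K)%N by rewrite -ltnS KN.
    by rewrite addnC addnA subnK.
  rewrite -mulr_sumr fejer_count.
  have -> : a = ((2 * pi)%:C * N%:R)^-1.
    by rewrite /a fmorphV rmorphM rmorph_nat.
  rewrite invfM; transitivity ((2 * pi)%:C^-1 * (2 * pi)%:C * ((N - m)%:R / N%:R * conjc (l (K + m)%N))).
    by ring.
  by rewrite mulVf // mul1r.
Qed.

End FejerMeasures.

(** * Solving the moment problem with bounded variation *)

Section MomentProblem.
Context {R : realType}.
Local Notation lam := (@lebesgue_measure R).
Implicit Types (f g : R[i] -> R[i]) (a b : nat -> R[i]) (z w : R[i]).

(** Partial sums of length N + m + 1 contain the m-th term, which orthogonality extracts; the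
    remainder is at most a multiple of q^N for every N. *)
Lemma cint_has_ps f a (s : R) m : has_ps f a -> 0 < s < 1 ->
  cint lam `[0, 2 * pi] (fun t => conjc (cisC t) ^+ m * f (s%:C * cisC t)) =
  a m * s%:C ^+ m * (2 * pi)%:C.
Proof.
move=> ha hs; have /andP[s0 s1] := hs.
have [K [q [K0 hq hK]]] := ha _ hs; have /andP[q0 q1] := hq.
have p0 : 0 < 2 * pi :> R := two_pi_gt0.
have ns t : normc (s%:C * cisC t) <= s by rewrite normc_rcis gtr0_norm.
have c1 : continuous (fun t => conjc (cisC t) ^+ m : R[i]).
  rewrite (_ : (fun t => _) = (fun t => (cisC t)^-1 ^+ m)); first exact: continuous_cisV.
  by apply/funext => t; rewrite cisC_conj.
have c2 : continuous (fun t => f (s%:C * cisC t)).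
  move=> t; apply: (ccont_comp (f := fun t => s%:C * cisC t) (ccontM ccont_cst (@continuous_cisC R t))).
  by apply: (has_ps_continuous ha); exact: le_lt_trans (ns t) s1.
have mD : @measurable _ (measurableTypeR R) `[0, 2 * pi] by exact: measurable_itv.
apply/eqP; rewrite -subr_eq0; apply/eqP.
apply: (@le_geometric_eq0 _ q (2 * K * (2 * pi))) => //; first exact: (mulr_ge0 (mulr_ge0 (ler0n _ 2) K0) (ltW p0)).
move=> N; apply: (@le_trans _ _ (2 * (K * q ^+ (N + m.+1)) * (2 * pi))); last first.
  have -> : 2 * (K * q ^+ (N + m.+1)) * (2 * pi) = 2 * K * (2 * pi) * q ^+ (N + m.+1) by ring.
  apply: (ler_wpM2l (mulr_ge0 (mulr_ge0 (ler0n _ 2) K0) (ltW p0))).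
  by rewrite exprD ler_piMr ?exprn_ge0 // exprn_ile1 // ltW.
set J := (N + m.+1)%N.
have mJ : (m < J)%N by rewrite /J addnS ltnS leq_addl.
pose P t := \sum_(n < J) (a n * s%:C ^+ n) * cisC t ^+ n.
have cP : continuous P := @continuous_trig_poly R J (fun n => a n * s%:C ^+ n).
have i1 : cintegrable lam `[0, 2 * pi] (fun t => conjc (cisC t) ^+ m * f (s%:C * cisC t)).
  by apply: cintegrable_circ => t; exact: (ccontM (c1 t) (c2 t)).
have i2 : cintegrable lam `[0, 2 * pi] (fun t => P t * (cisC t)^-1 ^+ m).
  by apply: cintegrable_circ => t; exact: (ccontM (cP t) (@continuous_cisV R m t)).
rewrite -(cint_trig_poly (fun n => a n * s%:C ^+ n) mJ).
rewrite -(@cintB _ _ _ lam _ _ _ mD i1 i2).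
apply: normc_cint_circ => t.
  exact: (ccontB (ccontM (c1 t) (c2 t)) (ccontM (cP t) (@continuous_cisV R m t))).
rewrite cisC_conj [X in _ - X]mulrC -mulrBr normcM normcX normcV normc_cisC invr1 expr1n mul1r.
rewrite /P (_ : \sum_(n < J) _ = \sum_(n < J) a n * (s%:C * cisC t) ^+ n); first exact: hK.
by apply: eq_bigr => n _; rewrite exprMn mulrA.
Qed.

(** [bernoulli_power] gives n d rho^n <= (rho + d)^n with rho + d < 1, which leaves a geometric
    series. *)
Lemma sum_arith_geometric (rho : R) : 0 <= rho < 1 -> exists2 S, 0 <= S &
  forall J, \sum_(n < J) n%:R * rho ^+ n <= S.
Proof.
move=> /andP[r0 r1]; pose d := (1 - rho) / 2; have d0 : 0 < d by rewrite /d; lra.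
have s01 : 0 <= rho + d < 1 by rewrite /d; lra.
exists (d^-1 * (1 - (rho + d))^-1).
  by rewrite mulr_ge0 // invr_ge0; [exact: ltW|have /andP[_ /ltW] := s01; rewrite subr_ge0].
move=> J; apply: (@le_trans _ _ (d^-1 * \sum_(n < J) (rho + d) ^+ n)); last first.
  by apply: ler_wpM2l; [rewrite invr_ge0 ltW|exact: sum_geometric_le].
rewrite mulr_sumr; apply: ler_sum => n _; rewrite ler_pdivlMl //.
have := bernoulli_power n r0 (ltW d0).
have -> : n%:R * d * rho ^+ n.-1 = d * (n%:R * rho ^+ n.-1) by ring.
move=> hb.
have h2 : n%:R * rho ^+ n <= n%:R * rho ^+ n.-1.
  rewrite ler_wpM2l //; case: (n : nat) => [|k] //=.
  by rewrite exprS ler_piMl ?exprn_ge0 // ltW.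
have : d * (n%:R * rho ^+ n) <= d * (n%:R * rho ^+ n.-1) by rewrite ler_wpM2l // ltW.
have : 0 <= rho ^+ n by rewrite exprn_ge0.
by lra.
Qed.

Lemma has_ps_le f a (s A : R) w : has_ps f a -> 0 < s < 1 -> normc w <= s ->
  (forall J, \sum_(n < J) normc (a n) * s ^+ n <= A) -> normc (f w) <= A.
Proof.
move=> ha hs ws hA; have [K [q [K0 hq hK]]] := ha _ hs.
apply/ler_addgt0Pr => e e0; have [N hN] := geometric_small hq K0 e0.
have h1 := hK w ws N; have h2 := hN N (leqnn N).
have h3 : normc (\sum_(n < N) a n * w ^+ n) <= A.
  apply: le_trans (hA N); apply: (le_trans (ler_normc_sum _ _ _)); apply: ler_sum => n _.
  rewrite normcM normcX ler_wpM2l ?normc_ge0 // lerXn2r ?nnegrE ?normc_ge0 //.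
  by case/andP: hs => /ltW.
have := le_normcD (f w - \sum_(n < N) a n * w ^+ n) (\sum_(n < N) a n * w ^+ n).
by rewrite subrK; lra.
Qed.

(* The correction supplies the missing part [min(n, N) / N] of the n-th moment. *)
Lemma dominated_moments (C M rho : R) b : 0 <= C -> 0 <= M -> 0 <= rho < 1 ->
  (forall n, normc (b n) <= M * rho ^+ n) ->
  (forall N c B, circle_bound C N c B -> normc (\sum_(n < N) c n * b n) <= B) ->
  exists2 mu : @complex_measure R, (Defs.total_variation mu <= (C + 2 * 1 * (2 * pi))%:E)%E &
    cm_moment mu =1 (fun n => conjc (b n)).
Proof.
move=> C0 M0 hr hb dom; have /andP[r0 r1] := hr.
have p0 : 0 < 2 * pi :> R := two_pi_gt0.
have pC := @two_pi_neq0 R.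
pose s := (1 + rho) / 2.
have hs : 0 < s < 1 by rewrite /s; lra.
have /andP[s0 s1] := hs.
have rs : rho <= s by rewrite /s; lra.
have [S S0 hS] := sum_arith_geometric hr.
pose M' := M / (2 * pi).
have M'0 : 0 <= M' by rewrite divr_ge0 // ltW.
(* Large enough for the correction, bounded by M' / N times the sum of n rho^n, to be at most 1 on
   the closed disc. *)
have [N [N0 SN]] : exists N : nat, (0 < N)%N /\ M' * S <= N%:R.
  exists (Num.trunc (M' * S)).+1; split => //; apply/ltW.
  by rewrite truncnS_gt.
have N0' : 0 < N%:R :> R by rewrite ltr0n.
have NC : N%:R != 0 :> R[i] by rewrite pnatr_eq0 -lt0n.
(* Division by 2 pi and s^n anticipates [cint_has_ps], which reads the m-th Fourier coefficient of
   [corr] as e_m s^m 2 pi. Since rho <= s the e_n stay bounded, and since s < 1 the dilate [corr] is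
   continuous on the closed disc. *)
pose e n : R[i] := ((2 * pi)%:C)^-1 * conjc (b n) * ((minn n N)%:R / N%:R) / s%:C ^+ n.
have sC : s%:C != 0 :> R[i] by rewrite -normc_eq0 normc_real normr_eq0 gt_eqF.
have ne n : normc (e n) = normc (b n) / (2 * pi) * ((minn n N)%:R / N%:R) / s ^+ n.
  rewrite /e !(normcM, normcV, normcX) !normc_nat !normc_real normc_conj.
  by rewrite (gtr0_norm p0) (gtr0_norm s0); ring.
have nes n : normc (e n) * s ^+ n <= M' * rho ^+ n * ((minn n N)%:R / N%:R).
  rewrite ne divfK; last by rewrite expf_neq0 // gt_eqF.
  rewrite ler_wpM2r ?divr_ge0 // /M' mulrAC ler_wpM2r // invr_ge0 ltW //.
have [E hE] : exists E, has_ps E e.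
  apply: has_ps_exists => r /andP[rr0 rr1]; exists M' => // n.
  have := nes n; rewrite -ler_pdivlMr ?exprn_gt0 // => /le_trans h.
  apply: (@le_trans _ _ (normc (e n))); first by rewrite ler_piMr ?normc_ge0 // exprn_ile1 // ltW.
  apply: h; rewrite ler_pdivrMr ?exprn_gt0 //.
  apply: (@le_trans _ _ (M' * rho ^+ n)).
    apply: (ler_piMr (mulr_ge0 M'0 (exprn_ge0 n r0))).
    rewrite ler_pdivrMr // mul1r ler_nat; exact: geq_minr.
  by rewrite ler_wpM2l // lerXn2r ?nnegrE // ltW.
pose corr w := E (s%:C * w).
have ws w : normc w <= 1 -> normc (s%:C * w) <= s.
  by move=> w1; rewrite normcM normc_real gtr0_norm // ler_piMr // ltW.
have ccorr : disc_cont corr.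
  move=> w w1; apply: (ccont_comp (f := fun w => s%:C * w) (ccontM ccont_cst cvg_id)).
  by apply: (has_ps_continuous hE); exact: le_lt_trans (ws w w1) s1.
have hcorr w : normc w <= 1 -> normc (corr w) <= 1.
  move=> w1; apply: (has_ps_le hE hs (ws w w1)) => J.
  apply: (@le_trans _ _ (\sum_(n < J) (M' / N%:R) * (n%:R * rho ^+ n))).
    apply: ler_sum => n _; apply: (le_trans (nes n)).
    have -> : M' / N%:R * (n%:R * rho ^+ n) = M' * rho ^+ n * (n%:R / N%:R) by ring.
    apply: (ler_wpM2l (mulr_ge0 M'0 (exprn_ge0 n r0))).
    apply: ler_wpM2r; first by rewrite invr_ge0 ltW.
    rewrite ler_nat; exact: geq_minl.
  rewrite -mulr_sumr; apply: (@le_trans _ _ (M' / N%:R * S)).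
    by rewrite ler_wpM2l ?hS // divr_ge0.
  by rewrite mulrAC ler_pdivrMr // mul1r.
have [l l1 l2] := @moment_extension R C N.-1 N b C0 (dom N).
have [mu [_ TV hmu]] := fejer_measure C0 N0 l2 ccorr hcorr.
exists mu => // m; rewrite hmu l1 /corr (cint_has_ps m hE hs) /e.
have sm : s%:C ^+ m != 0 :> R[i] by rewrite expf_neq0.
have mn : (N - m)%:R + (minn m N)%:R = N%:R :> R[i].
  by rewrite -natrD; congr (_%:R); case: (leqP m N) => h; [exact: subnK|move: (ltnW h); rewrite -subn_eq0 => /eqP ->].
transitivity (conjc (b m) * (((N - m)%:R + (minn m N)%:R) / N%:R)).
  move: pC sm; move: ((2 * pi)%:C) (s%:C ^+ m) => x y x0 y0; clear - NC x0 y0.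
  by field; rewrite y0 NC x0.
by rewrite mn mulfV // mulr1.
Qed.

End MomentProblem.

(** * The equivalence of (a), (b) and (c) *)

Section BoundedAnalytic.
Context {R : realType}.
Variable g : R[i] -> R[i].
Hypothesis ag : analytic g.
Local Notation h := (derive1 g).
Local Notation Hinfty_bounded_Tg := (bounded_operator (Tg g) Hinfty (sup_norm disc) Hinfty (sup_norm disc)).
Local Notation disc_algebra_bounded_Tg :=
  (bounded_operator (Tg g) disc_algebra (sup_norm closed_disc) Hinfty (sup_norm disc)).
Local Notation GH2_bounded := (ereal_sup [set cauchy_norm (GH2 g z) | z in disc] < +oo)%E.

Lemma disc_algebra_sup_norm (f : R[i] -> R[i]) : disc_algebra f ->
  exists2 B : R, sup_norm closed_disc f = B%:E & Hinfty f /\ (sup_norm disc f <= B%:E)%E.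
Proof.
move=> [af cf].
have cdE : closed_disc = [set w : R[i] | normc w <= 1].
  by apply/seteqP; split => w /closed_discE.
have [B B0 hB] : exists2 B : R, 0 <= B & forall w, closed_disc w -> normc (f w) <= B.
  by apply: compact_bounded_normc => //; rewrite cdE; exact: compact_disc.
have fin : (sup_norm closed_disc f < +oo)%E.
  by apply: le_lt_trans (ltry B); apply/sup_norm_le.
have cd0 : closed_disc (0 : R[i]) by apply/closed_discE; rewrite normc0.
have [B' e B'0] := sup_norm_fin cd0 fin.
have le : (sup_norm disc f <= B'%:E)%E.
  apply/sup_norm_le => z /discE z1; have [/(_ _)hle _] := sup_norm_le closed_disc f B'.
  by apply: hle; [rewrite e|apply/closed_discE; exact: ltW].
by exists B' => //; split => //; split => //; exact: le_lt_trans le (ltry _).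
Qed.

Lemma Hinfty_to_disc_algebra : Hinfty_bounded_Tg -> disc_algebra_bounded_Tg.
Proof.
move=> /bounded_into_Hinfty[C C0 hC]; apply: (Hinfty_bounded C0) => f Af.
  exact: (analytic_Tg ag (proj1 Af)).
have [B e [Hf le]] := disc_algebra_sup_norm Af; exists B => // z z1.
exact: (hC f B Hf (sup_norm_ge0 f (@disc0 R)) le).
Qed.

(** Polynomials lie in the disc algebra, and [poly_maximum] passes from the circle to the closed
    disc. The constant C + 1 is positive, so [B] can be divided by it. *)
Lemma disc_algebra_dominates : disc_algebra_bounded_Tg -> exists2 C : R, 0 <= C &
  forall z, normc z < 1 -> forall N c B, circle_bound C N c B ->
    normc (\sum_(n < N) c n * path_moment h n z) <= B.
Proof.
move=> /bounded_into_Hinfty[C C0 hC]; exists (C + 1); first by rewrite addr_ge0.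
move=> z z1 N c B hB; have C1 : 0 < C + 1 by rewrite ltr_wpDl.
rewrite -(Tg_poly ag c N z1).
have hp w : normc w <= 1 -> normc (\sum_(n < N) c n * w ^+ n) <= B / (C + 1).
  by apply: poly_maximum => xi x1; rewrite ler_pdivlMr // mulrC; exact: hB.
have B0 : 0 <= B / (C + 1).
  by apply: le_trans (hp 0 _); rewrite ?normc_ge0 // normc0.
have cd0 : closed_disc (0 : R[i]) by apply/closed_discE; rewrite normc0.
apply: (@le_trans _ _ (C * (B / (C + 1)))).
  have Ap : disc_algebra (fun u : R[i] => \sum_(n < N) c n * u ^+ n).
    split; first exact: poly_analytic.
    by apply: continuous_subspaceT; exact: poly_continuous.
  have le : (sup_norm closed_disc (fun u : R[i] => (\sum_(n < N) c n * u ^+ n)%R) <= (B / (C + 1))%:E)%E.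
    by apply/sup_norm_le => w /closed_discE; exact: hp.
  exact: (hC _ _ Ap (sup_norm_ge0 _ cd0) le z z1).
rewrite -[leRHS](divfK (lt0r_neq0 C1)) [leRHS]mulrC ler_wpM2r //.
by rewrite lerDl.
Qed.

Lemma disc_algebra_to_GH2 : disc_algebra_bounded_Tg -> GH2_bounded.
Proof.
move=> /disc_algebra_dominates[C C0 dom].
apply: (@le_lt_trans _ _ (C + 2 * 1 * (2 * pi))%:E); last exact: ltry.
apply: ge_ereal_sup => _ [z /discE z1 <-].
have [M M0 hM] := path_moment_decay ag z1.
have z01 : 0 <= normc z < 1 by rewrite normc_ge0.
have [mu TV hmu] := dominated_moments C0 M0 z01 hM (dom z z1).
apply: (le_trans _ TV); apply: ereal_inf_lbound; exists mu => // w /discE w1.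
apply: (has_ps_eq (GH2_has_ps ag z1) _ w1).
have <- : cm_moment mu = (fun n => conjc (path_moment h n z)) by apply/funext.
exact: cauchy_transform_ps TV.
Qed.

(** Uniqueness of Taylor coefficients turns the representation by [mu] into equality of moments, and
    a linear combination of moments is the integral of a polynomial against [mu]. *)
Lemma cauchy_moments z (mu : complex_measure) (M : R) : normc z < 1 ->
  (Defs.total_variation mu <= M%:E)%E -> represents mu (GH2 g z) ->
  forall N (c : nat -> R[i]) (A : R), (forall w, normc w = 1 -> normc (\sum_(n < N) c n * w ^+ n) <= A) ->
    normc (\sum_(n < N) c n * path_moment h n z) <= 4 * A * M.
Proof.
move=> z1 TV rep N c A hA.
have A0 : 0 <= A by apply: le_trans (hA 1 (normc1 R)); exact: normc_ge0.
have psG : has_ps (GH2 g z) (cm_moment mu).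
  by apply: has_ps_ext (cauchy_transform_ps TV) => w dw; rewrite rep.
have mE := has_ps_unique (GH2_has_ps ag z1) psG.
have -> : normc (\sum_(n < N) c n * path_moment h n z) =
    normc (cm_integral mu (fun x => \sum_(n < N) conjc (c n) * conjc (val x) ^+ n)).
  rewrite (@cm_integral_conj_poly R mu (fun n => conjc (c n)) N) -[LHS]normc_conj cconj_sum.
  by congr normc; apply: eq_bigr => n _; rewrite -mE cconjM.
apply: (@cm_integral_le _ mu (fun w => \sum_(n < N) conjc (c n) * conjc w ^+ n)) => //.
  exact: (@disc_cont_conj_poly _ (fun n => conjc (c n))).
move=> w w1; rewrite -normc_conj cconj_sum.
rewrite (_ : \sum_(n < N) _ = \sum_(n < N) c n * w ^+ n); first exact: hA.
by apply: eq_bigr => n _; rewrite cconjM cconjX !conjcK.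
Qed.

(** [cauchy_moments] needs partial sums that are controlled on the whole circle, hence the dilates w
    |-> f (r w). The limits are taken in the order J to infinity, r to 1, N to infinity. *)
Lemma Tg_bound z (mu : complex_measure) (M B : R) f : normc z < 1 -> 0 <= M -> 0 <= B ->
  (Defs.total_variation mu <= M%:E)%E -> represents mu (GH2 g z) ->
  analytic f -> (forall w, normc w < 1 -> normc (f w) <= B) -> normc (Tg g f z) <= 4 * M * B.
Proof.
move=> z1 M0 B0 TV rep af fB; have [a ha] := analytic_has_ps af.
have pb := cauchy_moments z1 TV rep.
have [rho hr zr] := disc_radius z1.
have /andP[_ r1] := hr.
have [K [q [K0 hq hK]]] := ha _ hr; have /andP[q0 q1] := hq.
have [B1 B10 hB1] := Tg_series ag zr r1.
have cf w : normc w < 1 -> {for w, continuous f} := @analytic_continuous R f w af.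
have D0 : 0 <= B1 * K by exact: mulr_ge0.
(* The error term is independent of the dilation factor, so for fixed [N] that factor can tend to
   1. *)
have SN N : normc (\sum_(n < N) a n * path_moment h n z) <= 4 * M * B + B1 * K * q ^+ N.
  apply: (@poly_abel_limit R (fun n => a n * path_moment h n z)) => r hr1.
  have /andP[r0 r1'] := hr1.
  have rw w : normc w <= rho -> normc (r%:C * w) <= rho.
    move=> wr; rewrite normcM normc_real gtr0_norm //; apply: le_trans wr.
    by rewrite ler_piMl ?normc_ge0 // ltW.
  pose fr w := f (r%:C * w).
  have cfr w : normc w <= rho -> {for w, continuous fr}.
    move=> wr; apply: (ccont_comp (f := fun w => r%:C * w) (ccontM ccont_cst cvg_id)).
    by apply: cf; exact: le_lt_trans (rw w wr) r1.
  have hfr w : normc w <= rho -> forall N, normc (fr w - \sum_(n < N) (a n * r%:C ^+ n) * w ^+ n) <= K * q ^+ N.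
    move=> wr J; rewrite (_ : \sum_(n < J) _ = \sum_(n < J) a n * (r%:C * w) ^+ n).
      by apply: hK; exact: rw.
    by apply: eq_bigr => n _; rewrite exprMn mulrA.
  have hT := hB1 fr (fun n => a n * r%:C ^+ n) K q hfr cfr.
  have [K' [q' [K'0 hq' hK']]] := ha _ hr1; have /andP[q'0 q'1] := hq'.
  apply/ler_addgt0Pr => e e0; have e2 : 0 < e / 2 by rewrite divr_gt0.
  have [N1 hN1] := geometric_small hq D0 e2.
  have D'0 : 0 <= 4 * M * K' by rewrite mulr_ge0 // mulr_ge0.
  have [N2 hN2] := geometric_small hq' D'0 e2.
  pose J := maxn N1 N2.
  have h1 := hN1 J (leq_maxl _ _); have h2 := hN2 J (leq_maxr _ _).
  (* On the circle of radius [r] the partial sum is within K' q'^J of f, hence at most B + K' q'^J;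
     [K'] and [q'] depend on [r], which stays fixed while [J] grows. *)
  have hS : normc (\sum_(n < J) (a n * r%:C ^+ n) * path_moment h n z) <= 4 * M * B + 4 * M * K' * q' ^+ J.
    have -> : 4 * M * B + 4 * M * K' * q' ^+ J = 4 * (B + K' * q' ^+ J) * M by ring.
    apply: (pb J (fun n => a n * r%:C ^+ n)) => w w1.
    have nr : normc (r%:C * w) = r by rewrite normcM w1 mulr1 normc_real gtr0_norm.
    rewrite (_ : \sum_(n < J) _ = \sum_(n < J) a n * (r%:C * w) ^+ n); last first.
      by apply: eq_bigr => n _; rewrite exprMn mulrA.
    have eqle (x y : R) : x = y -> x <= y by move=> ->.
    have k1 := hK' (r%:C * w) (eqle _ _ nr) J.
    have k2 : normc (f (r%:C * w)) <= B by apply: fB; rewrite nr.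
    have := ler_normcB (f (r%:C * w)) (f (r%:C * w) - \sum_(n < J) a n * (r%:C * w) ^+ n).
    by rewrite subKr; lra.
  have t1 := hT N; have t2 := hT J.
  rewrite (_ : \sum_(n < N) _ = \sum_(n < N) (a n * r%:C ^+ n) * path_moment h n z); last first.
    by apply: eq_bigr => n _; rewrite mulrAC.
  move: hS t1 t2; set S1 := \sum_(n < J) _; set S2 := \sum_(n < N) _; set TT := Tg g fr z.
  move=> hS t1 t2.
  have s1 := ler_normc_trans S2 TT 0; have s2 := ler_normc_trans TT S1 0.
  rewrite !subr0 in s1 s2; rewrite normcB in t1.
  clear - s1 s2 t1 t2 hS h1 h2; lra.
apply/ler_addgt0Pr => e e0; have e2 : 0 < e / 2 by rewrite divr_gt0.
have [N hN] := geometric_small hq D0 e2; have h1 := hN N (leqnn N).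
have h2 := SN N; have h3 := hB1 f a K q hK (fun w wr => cf w (le_lt_trans wr r1)) N.
have s1 := ler_normc_trans (Tg g f z) (\sum_(n < N) a n * path_moment h n z) 0.
rewrite !subr0 in s1; clear - s1 h1 h2 h3; lra.
Qed.

Lemma GH2_to_Hinfty : GH2_bounded -> Hinfty_bounded_Tg.
Proof.
move=> fin.
(* The strict inequality lets an actual measure of variation below [M] be drawn from the infimum in
   [cauchy_norm]. *)
have [M M0 hM] : exists2 M : R, 0 <= M & forall z : R[i], disc z -> (cauchy_norm (GH2 g z) < M%:E)%E.
  have [x hx] : exists x : R, (ereal_sup [set cauchy_norm (GH2 g z) | z in disc] <= x%:E)%E.
    move: fin; case: (ereal_sup _) => [x| |] // _; first by exists x.
    by exists 0; rewrite leNye.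
  exists (`|x| + 1); first by rewrite addr_ge0.
  move=> z dz; apply: (@le_lt_trans _ _ x%:E).
    by apply: le_trans hx; apply: ereal_sup_ubound; exists z.
  by rewrite lte_fin (le_lt_trans (ler_norm x)) // ltrDl.
have M4 : 0 <= 4 * M by rewrite mulr_ge0.
apply: (Hinfty_bounded M4) => [f [af _]|f [af ff]]; first exact: analytic_Tg.
have [B e B0] := sup_norm_fin (@disc0 R) ff; exists B => // z z1.
have dz : disc z by apply/discE.
have [_ [mu rep <-] /ltW TV] := ereal_inf_lt (hM z dz).
apply: (Tg_bound z1 M0 B0 TV rep af) => w /discE dw.
have [hle _] := sup_norm_le disc f B.
by apply: hle => //; rewrite e.
Qed.

End BoundedAnalytic.

(** * The operator on Cauchy transforms of absolutely continuous measures *)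

Section CauchyTransforms.
Context {R : realType}.
Implicit Types (g f : R[i] -> R[i]).

Lemma total_variation_ge0 (mu : @complex_measure R) : (0 <= Defs.total_variation mu)%E.
Proof.
apply: (@le_trans _ _ (\sum_(i < 1) normc (cm_value mu (setT : set (borel_circle R))))%:E).
  by rewrite lee_fin sumr_ge0 // => i _; exact: normc_ge0.
apply: ereal_sup_ubound; exists 1%N, (fun=> setT); split => //.
- by move=> i j _ _ _; rewrite (ord1 i) (ord1 j).
- by apply/seteqP; split => // x _; exists ord0.
Qed.

Lemma cauchy_norm_ge0 f : (0 <= cauchy_norm f)%E.
Proof. by apply: le_ereal_inf_tmp => _ [mu _ <-]; exact: total_variation_ge0. Qed.

(* The Cauchy transform of the Fejer kernel at [eta]. *)
Lemma fejer_test_function N (eta : R[i]) : (0 < N)%N -> normc eta = 1 ->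
  exists f, [/\ Ka f, (cauchy_norm f <= 1%:E)%E &
    has_ps f (fun m => (N - m)%:R / N%:R * conjc eta ^+ m)].
Proof.
move=> N0 e1; have ee : eta * conjc eta = 1.
  by have := @normCK R[i] eta; rewrite norm_normc e1 expr1n => <-.
(* This is eta to the power n - N + 1: the functional is evaluation at [eta] up to a unimodular
   factor, so it is dominated with constant 1. *)
pose l n : R[i] := eta ^+ n * conjc eta ^+ N.-1.
have dom (c : nat -> R[i]) (B : R) : circle_bound 1 (N.-1 + N) c B ->
    normc (\sum_(n < N.-1 + N) c n * l n) <= B.
  move=> /(_ eta e1); rewrite mul1r; apply: le_trans.
  rewrite (_ : \sum_(n < _) _ = (\sum_(n < N.-1 + N) c n * eta ^+ n) * conjc eta ^+ N.-1).
    by rewrite normcM normcX normc_conj e1 expr1n mulr1.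
  by rewrite mulr_suml; apply: eq_bigr => n _; rewrite /l mulrA.
have h0 (w : R[i]) : normc w <= 1 -> normc ((fun=> 0) w : R[i]) <= 0 by rewrite normc0.
have [mu [amu TV hmu]] := fejer_measure ler01 N0 dom (@disc_cont_cst R 0) h0.
have TV1 : (Defs.total_variation mu <= 1%:E)%E.
  by apply: le_trans TV _; rewrite lee_fin mulr0 mul0r addr0.
exists (cauchy_transform mu); split.
- by exists mu => // z _.
- by apply: (le_trans _ TV1); apply: ereal_inf_lbound; exists mu => // z _.
- rewrite (_ : (fun m => _) = cm_moment mu); first exact: cauchy_transform_ps TV1.
  apply/funext => m; rewrite hmu.
  rewrite (_ : cint _ _ _ = 0) ?addr0; last first.
    by rewrite -[RHS](@cint0 _ _ R (@lebesgue_measure R) `[0, 2 * pi]); apply: eq_cint => t _; rewrite mulr0.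
  rewrite /l cconjM !cconjX conjcK exprD.
  have h : conjc eta ^+ N.-1 * eta ^+ N.-1 = 1 by rewrite -exprMn mulrC ee expr1n.
  transitivity ((N - m)%:R / N%:R * conjc eta ^+ m * (conjc eta ^+ N.-1 * eta ^+ N.-1)); first by rewrite h mulr1.
  by ring.
Qed.

Lemma path_moment_series (g' : R[i] -> R[i]) (c : nat -> R[i]) (r K q : R) n z : r < 1 -> normc z <= r ->
  (forall w, normc w <= r -> {for w, continuous g'}) ->
  (forall w, normc w <= r -> forall J, normc (g' w - \sum_(j < J) c j * w ^+ j) <= K * q ^+ J) ->
  forall J, normc (path_moment g' n z - \sum_(j < J) c j * (z ^+ (n + j).+1 / (n + j).+1%:R)) <=
    2 * K * q ^+ J.
Proof.
move=> r1 zr cg hK J; have z1 := le_lt_trans zr r1.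
have -> : \sum_(j < J) c j * (z ^+ (n + j).+1 / (n + j).+1%:R) =
    \sum_(j < J) c j * path_moment (fun u => u ^+ n) j z.
  by apply: eq_bigr => j _; rewrite path_moment_monomial.
have -> : 2 * K * q ^+ J = 2 * (K * q ^+ J * 1) by ring.
apply: (@path_integral_approx R (fun u => u ^+ n) g' c J (K * q ^+ J) 1 z (ltW z1)) => w wz.
- exact: pow_continuous.
- by apply: cg; exact: le_trans wz zr.
- by rewrite normcX exprn_ile1 ?normc_ge0 // (le_trans wz) // ltW.
- by apply: hK; exact: le_trans wz zr.
Qed.

Lemma harmonic_unbounded (A : R) : exists P, A < \sum_(n < P) n.+1%:R^-1.
Proof.
apply: contrapT => h; apply: (@dvg_harmonic R); apply: nondecreasing_is_cvgn.
  by apply: nondecreasing_series => n _; rewrite invr_ge0.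
exists A => _ [P _ <-]; rewrite /series /= big_mkord leNgt; apply/negP => AP.
by apply: h; exists P.
Qed.

(** The bound at r eta holds for every unimodular [eta], so [trig_poly_coef_le] in the variable
    [eta] isolates the contribution of c_j; its factor 2 is the one in the conclusion. *)
Lemma Tg_fejer_coef g (c : nat -> R[i]) (C r : R) N j : analytic g -> has_ps (derive1 g) c -> 0 < r < 1 -> (0 < N)%N ->
  (forall f, Ka f -> (cauchy_norm f <= 1%:E)%E -> forall z, normc z < 1 -> normc (Tg g f z) <= C) ->
  normc (\sum_(n < N) c j * ((N - n)%:R / N%:R / (n + j).+1%:R) * r%:C ^+ (n + j).+1) <= 2 * C.
Proof.
move=> ag hc hr N0 hC; have /andP[r0 r1] := hr.
have N0' : 0 < N%:R :> R by rewrite ltr0n.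
have [K [q [K0 hq hK]]] := hc _ hr; have /andP[q0 q1] := hq.
have cg w : normc w <= r -> {for w, continuous (derive1 g)}.
  by move=> wr; apply: (analytic_continuous (analytic_derive ag)); exact: le_lt_trans wr r1.
pose k n : R[i] := (N - n)%:R / N%:R.
have nk n : normc (k n) <= 1.
  rewrite /k normcM normcV !normc_nat ler_pdivrMr // mul1r ler_nat; exact: leq_subr.
have test (eta : R[i]) : normc eta = 1 ->
    normc (\sum_(n < N) k n * conjc eta ^+ n * path_moment (derive1 g) n (r%:C * eta)) <= C.
  move=> e1; have [f [Kf nf hf]] := fejer_test_function N0 e1.
  have zr : normc (r%:C * eta) <= r by rewrite normcM e1 mulr1 normc_real gtr0_norm.
  have z1 := le_lt_trans zr r1.
  suff -> : \sum_(n < N) k n * conjc eta ^+ n * path_moment (derive1 g) n (r%:C * eta) =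
    Tg g f (r%:C * eta) by exact: hC.
  have [K' [q' [K'0 hq' hK']]] := hf _ hr.
  have [B B0 hB] := Tg_series ag zr r1.
  have cf w : normc w <= r -> {for w, continuous f}.
    by move=> wr; apply: (has_ps_continuous hf); exact: le_lt_trans wr r1.
  apply/eqP; rewrite eq_sym -subr_eq0; apply/eqP.
  apply: (le_geometric_eq0 hq' (mulr_ge0 B0 K'0)) => J.
  have /andP[q'0 q'1] := hq'.
  apply: (@le_trans _ _ (B * K' * q' ^+ (N + J))); last first.
    apply: (ler_wpM2l (mulr_ge0 B0 K'0)).
    by rewrite exprD ler_piMl ?exprn_ge0 // exprn_ile1 // ltW.
  (* Beyond [N] the truncated difference [N - n] is 0, so every longer partial sum equals the one of
     length [N]. *)
  have := hB f (fun n => (N - n)%:R / N%:R * conjc eta ^+ n) K' q' hK' cf (N + J)%N; rewrite big_split_ord /= [X in _ - (_ + X)]big1 ?addr0 // => n _.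
  by rewrite (_ : (N - (N + n))%N = 0%N) ?mul0r // subnDA subnn.
have D0 : 0 <= 4 * (N%:R * K) by rewrite mulr_ge0 // mulr_ge0.
apply/ler_addgt0Pr => e e0; have [J0 hJ0] := geometric_small hq D0 e0.
(* Larger than [j], so that the coefficient of index [j] is present, and large enough for truncating
   g' to cost less than e. *)
pose J := maxn J0 j.+1; have hJ := hJ0 J (leq_maxl _ _).
have jJ : (j < J)%N by rewrite leq_max leqnn orbT.
pose A i := \sum_(n < N) c i * (k n / (n + i).+1%:R) * r%:C ^+ (n + i).+1.
have trig t : normc (\sum_(i < J) A i * cisC t ^+ i) <= C + N%:R * (2 * K * q ^+ J).
  pose eta := cisC t : R[i]; have e1 : normc eta = 1 by exact: normc_cisC.
  have e0' : eta != 0 by exact: cisC_neq0.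
  have zr : normc (r%:C * eta) <= r by rewrite normcM e1 mulr1 normc_real gtr0_norm.
  have ps n := @path_moment_series _ _ _ K q n _ r1 zr cg hK J.
  (* conj eta^n cancels eta^n, and the leading eta^-1 removes the one surplus factor. *)
  have -> : \sum_(i < J) A i * eta ^+ i = eta^-1 * \sum_(n < N) k n * conjc eta ^+ n *
      \sum_(i < J) c i * ((r%:C * eta) ^+ (n + i).+1 / (n + i).+1%:R).
    rewrite mulr_sumr.
    transitivity (\sum_(i < J) \sum_(n < N) c i * (k n / (n + i).+1%:R) * r%:C ^+ (n + i).+1 * eta ^+ i).
      by apply: eq_bigr => i _; rewrite /A mulr_suml.
    rewrite exchange_big; apply: eq_bigr => n _; rewrite !mulr_sumr; apply: eq_bigr => i _.
    rewrite cisC_conj exprMn exprS exprD [eta ^+ (n + i).+1]exprS [eta ^+ (n + i)]exprD exprVn.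
    have en0 : eta ^+ n != 0 by rewrite expf_neq0.
    have v1 : eta^-1 * eta = 1 by rewrite mulVf.
    have v2 : (eta ^+ n)^-1 * eta ^+ n = 1 by rewrite mulVf.
    transitivity (c i * (k n / (n + i).+1%:R) * (r%:C * (r%:C ^+ n * r%:C ^+ i)) * eta ^+ i *
      (eta^-1 * eta) * ((eta ^+ n)^-1 * eta ^+ n)); first by rewrite v1 v2 !mulr1.
    by clear; ring.
  rewrite normcM normcV e1 invr1 mul1r.
  set S := \sum_(n < N) _; pose S' := \sum_(n < N) k n * conjc eta ^+ n * path_moment (derive1 g) n (r%:C * eta).
  have hS' : normc S' <= C := test eta e1.
  have hSS : normc (S' - S) <= N%:R * (2 * K * q ^+ J).
    rewrite /S' /S -sumrB; apply: (le_trans (ler_normc_sum _ _ _)).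
    apply: (@le_trans _ _ (\sum_(n < N) (2 * K * q ^+ J))); last by rewrite sumr_const card_ord [leRHS]mulr_natl.
    apply: ler_sum => n _; rewrite -mulrBr normcM -[leRHS]mul1r; apply: ler_pM; rewrite ?normc_ge0 //.
    by rewrite normcM normcX normc_conj e1 expr1n mulr1.
  have s1 := ler_normc_trans S S' 0; rewrite !subr0 normcB in s1.
  clear - s1 hS' hSS; lra.
have := trig_poly_coef_le jJ trig; rewrite -/(A j) => /le_trans; apply.
have -> : 2 * (C + N%:R * (2 * K * q ^+ J)) = 2 * C + 4 * (N%:R * K) * q ^+ J by ring.
by rewrite lerD2l ltW.
Qed.

Lemma Tg_Ka_constant g : analytic g ->
  bounded_operator (Tg g) Ka cauchy_norm Hinfty (sup_norm disc) ->
  exists c : R[i], forall z, disc z -> g z = c.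
Proof.
move=> ag /bounded_into_Hinfty[C C0 hC0].
have hC f : Ka f -> (cauchy_norm f <= 1%:E)%E -> forall z, normc z < 1 -> normc (Tg g f z) <= C.
  by move=> Kf nf z z1; rewrite -[leRHS]mulr1; exact: (hC0 f 1 Kf (cauchy_norm_ge0 f) nf z z1).
have [a [ha hd]] := analytic_derive1 ag.
have a0 j : a j.+1 = 0.
  apply/eqP/negPn/negP => aj; pose c : R[i] := j.+1%:R * a j.+1.
  have c0 : 0 < normc c by rewrite normc_gt0 mulf_neq0 // pnatr_eq0.
  (* This threshold makes |c| / (2 (j + 1)) times the harmonic sum exceed 2 C, the bound of
     [Tg_fejer_coef]. *)
  have [P hP] := harmonic_unbounded (4 * C * j.+1%:R / normc c).
  have P0 : (0 < P)%N.
    case: P hP => // ; rewrite big_ord0 ltNge => /negP[].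
    by rewrite divr_ge0 ?normc_ge0 // mulr_ge0 // mulr_ge0.
  (* Twice [P], so that the weights (N - n) / N are at least 1/2 for n < P. *)
  pose N := (P + P)%N; have N0 : (0 < N)%N by rewrite addn_gt0 P0.
  have N0' : 0 < N%:R :> R by rewrite ltr0n.
  (* Shifting indices by j + 1 writes the sum as a polynomial in [r], so that [poly_abel_limit]
     reaches r = 1. *)
  pose d i : R[i] := if (i < j.+1)%N then 0 else
    c * ((N - (i - j.+1))%:R / N%:R / (i - j.+1 + j).+1%:R).
  have dE (F : nat -> R[i]) : \sum_(i < j.+1 + N) d i * F i =
      \sum_(n < N) c * ((N - n)%:R / N%:R / (n + j).+1%:R) * F (n + j).+1.
    rewrite big_split_ord /= big1 ?add0r => [|i _]; last by rewrite /d ltn_ord mul0r.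
    by apply: eq_bigr => n _; rewrite /d ltnNge leq_addr /= addKn addSn addnC.
  have bnd : normc (\sum_(i < j.+1 + N) d i) <= 2 * C.
    apply: poly_abel_limit => r hr; rewrite (dE (fun n => r%:C ^+ n)).
    exact: (Tg_fejer_coef j ag hd hr N0 hC).
  have bE : \sum_(i < j.+1 + N) d i = c * (\sum_(n < N) (N - n)%:R / N%:R / (n + j).+1%:R)%:C.
    have := dE (fun=> 1); under eq_bigr do rewrite mulr1; move=> ->.
    rewrite (rmorph_sum (real_complex R)) mulr_sumr; apply: eq_bigr => n _.
    by rewrite mulr1 !rmorphM !fmorphV !rmorph_nat.
  (* Only the terms n < P are kept; there 1 / (n + j + 1) is at least 1 / ((j + 1) (n + 1)). *)
  have low : (2 * j.+1%:R)^-1 * \sum_(n < P) n.+1%:R^-1 <= \sum_(n < N) (N - n)%:R / N%:R / (n + j).+1%:R :> R.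
    rewrite /N big_split_ord /= -/N mulr_sumr -[leLHS]addr0; apply: lerD; last first.
      by apply: sumr_ge0 => n _; rewrite !divr_ge0.
    apply: ler_sum => n _.
    have h1 : 2^-1 <= (N - n)%:R / N%:R :> R.
      rewrite ler_pdivlMr // mulrC ler_pdivrMr // -natrM ler_nat /N muln2 -addnn leq_add //;
        by rewrite -addnBA ?leq_addr // ltnW.
    have -> : (2 * j.+1%:R)^-1 * n.+1%:R^-1 = 2^-1 * (j.+1%:R * n.+1%:R)^-1 :> R by rewrite !invfM mulrA.
    apply: ler_pM => //.
    rewrite lef_pV2 ?posrE ?mulr_gt0 // -natrM ler_nat mulSn mulnC mulSn.
    by rewrite addSn ltnS addnA leq_addr.
  have L0 : 0 <= \sum_(n < N) (N - n)%:R / N%:R / (n + j).+1%:R :> R.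
    by apply: sumr_ge0 => n _; rewrite !divr_ge0.
  move: bnd; rewrite bE normcM normc_real ger0_norm // => bnd.
  have : normc c * ((2 * j.+1%:R)^-1 * \sum_(n < P) n.+1%:R^-1) <= 2 * C.
    by apply: le_trans bnd; rewrite ler_wpM2l // ltW.
  apply/negP; rewrite -ltNge; move: hP; rewrite ltr_pdivrMr //.
  set S := \sum_(n < P) _; rewrite -(ltr_pM2l (_ : 0 < (2 * j.+1%:R)^-1)); last by rewrite invr_gt0 mulr_gt0.
  have j0 : j.+1%:R != 0 :> R by rewrite pnatr_eq0.
  have -> : (2 * j.+1%:R)^-1 * (4 * C * j.+1%:R) = 2 * C by field.
  by move=> /lt_le_trans; apply; rewrite le_eqVlt; apply/orP; left; apply/eqP; ring.
exists (a 0%N) => z /discE z1.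
have [rho hr zr] := disc_radius z1.
have [K [q [K0 hq hK]]] := ha _ hr; have /andP[q0 q1] := hq.
apply/eqP; rewrite -subr_eq0; apply/eqP; apply: (le_geometric_eq0 hq K0) => N.
apply: (@le_trans _ _ (K * q ^+ N.+1)); last first.
  by rewrite ler_wpM2l // exprS ler_piMl ?exprn_ge0 // ltW.
have := hK z zr N.+1; rewrite big_ord_recl expr0 mulr1 big1 ?addr0 // => i _.
by rewrite a0 mul0r.
Qed.

Lemma Tg_constant g (c : R[i]) X nX : (forall z, disc z -> g z = c) ->
  (forall f, X f -> (0 <= nX f)%E) ->
  bounded_operator (Tg g) X nX Hinfty (sup_norm disc).
Proof.
move=> gc nX0.
have d0 w : normc w < 1 -> derive1 g w = 0.
  move=> w1; have r0 : 0 < 1 - normc w by rewrite subr_gt0.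
  have : cder g w 0.
    apply: (cder_local r0 _ (cder_cst c w)) => v vw; rewrite gc //; apply/discE.
    have := le_normcD (v - w) w; rewrite subrK; lra.
  by move=> /cderP[].
have T0 f z : normc z < 1 -> Tg g f z = 0.
  move=> z1; rewrite /Tg path_integralE.
  rewrite (_ : cint _ _ _ = 0) ?mulr0 //.
  rewrite -[RHS](@cint0 _ _ R (@lebesgue_measure R) `[0, 1]); apply: eq_cint => t; rewrite /= in_itv /= => t01.
  by rewrite d0 ?mulr0 // (le_lt_trans (normc_segment z t01)).
split=> [f _|].
  split.
    move=> z /discE z1; have r0 : 0 < 1 - normc z by rewrite subr_gt0.
    have : cder (Tg g f) z 0.
      apply: (cder_local r0 _ (cder_cst 0 z)) => v vw; rewrite T0 //.
      have := le_normcD (v - z) z; rewrite subrK; lra.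
    by move=> /cderP[].
  apply: (@le_lt_trans _ _ 0%:E); last exact: ltry.
  by apply/sup_norm_le => z /discE z1; rewrite T0 // normc0.
exists 0 => f Xf; rewrite mul0e.
by apply/sup_norm_le => z /discE z1; rewrite T0 // normc0.
Qed.

End CauchyTransforms.

Theorem theorem1p2 (R : realType) (g : R[i] -> R[i]) (hg : analytic g) :
  ((bounded_operator (Tg g) Hinfty (sup_norm disc) Hinfty (sup_norm disc) <->
    bounded_operator (Tg g) disc_algebra (sup_norm closed_disc)
                            Hinfty (sup_norm disc)) /\
   (bounded_operator (Tg g) disc_algebra (sup_norm closed_disc)
                            Hinfty (sup_norm disc) <->
    (ereal_sup [set cauchy_norm (GH2 g z) | z in disc] < +oo)%E)) /\
  (bounded_operator (Tg g) Ka cauchy_norm Hinfty (sup_norm disc) <->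
   exists c : R[i], forall z, disc z -> g z = c).
Proof.
have ab := @Hinfty_to_disc_algebra R g hg.
have bc := @disc_algebra_to_GH2 R g hg.
have ca := @GH2_to_Hinfty R g hg.
have ck : (exists c : R[i], forall z, disc z -> g z = c) ->
    bounded_operator (Tg g) Ka cauchy_norm Hinfty (sup_norm disc).
  by move=> [c hc]; apply: (Tg_constant hc) => f _; exact: cauchy_norm_ge0.
exact: (conj (conj (conj ab (fun h => ca (bc h))) (conj bc (fun h => ab (ca h))))
  (conj (Tg_Ka_constant hg) ck)).
Qed.
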